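(* Let $d=2$ and $\mathfrak w\in\mathbb R^2\setminus\{0\}$. There exists a constant $C>0$ (independent of $\varepsilon\in(0,1)$, $\psi_1$, $\psi_2$) such that for every $\psi_1,\psi_2\in\Gamma L^2$ $$\Big|\Big\langle\big[-\mathcal A^\varepsilon_-(-\mathcal L_0-\mathcal L_0^{\mathfrak w}\mathcal G^\varepsilon)^{-1}\mathcal A^\varepsilon_++\mathcal L_0^{\mathfrak w}\mathcal G^\varepsilon\big]\psi_1,\psi_2\Big\rangle\Big|\le C\lambda_\varepsilon^2\,\|\mathcal N(-\mathcal L_0)^{\frac12}\psi_1\|\,\|\mathcal N(-\mathcal L_0)^{\frac12}\psi_2\|.$$
   Context: $\mathbb T^2$ is the torus of side length $2\pi$, $e_k(x)=(2\pi)^{-1}e^{\iota k\cdot x}$, $\iota=\sqrt{-1}$, $\mathbb Z^2_0=\mathbb Z^2\setminus\{0\}$, $|\cdot|$ is the Euclidean norm, and for a function $f$ on $(\mathbb T^2)^n$, $\hat f(k_{1:n})=\mathcal F(f)(k_{1:n})=\int f\prod_je_{-k_j}(x_j)\,dx$, with $k_{1:n}=(k_1,\dots,k_n)$, $|k_{1:n}|^2=\sum_j|k_j|^2$. Fock space: $\Gamma L^2_0$ denotes the constants and, for $n\ge1$, $\Gamma L^2_n$ is the space of symmetric $f\in L^2((\mathbb T^2)^n)$ whose Fourier coefficients vanish whenever some $k_j=0$. $\Gamma L^2=\bigoplus_{n\ge0}\Gamma L^2_n$ has scalar product $\langle f,g\rangle=\sum_nn!\langle f_n,g_n\rangle_{L^2((\mathbb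 T^2)^n)}$ and norm $\|\cdot\|$. The number operator $\mathcal N$ acts as $(\mathcal N\psi)_n=n\psi_n$. Operators, for $\varepsilon\in(0,1)$: $\lambda_\varepsilon=(\log\varepsilon^{-2})^{-1/2}$; $\mathbb J^\varepsilon_{\ell,m}=\mathbf 1\{0<\varepsilon|\ell|\le1,\,0<\varepsilon|m|\le1,\,0<\varepsilon|\ell+m|\le1\}$. For $f\in\Gamma L^2_n$, $$\mathcal F(\mathcal L_0f)(k_{1:n})=-\tfrac12|k_{1:n}|^2\hat f(k_{1:n}),\qquad\mathcal F(\mathcal L_0^{\mathfrak w}f)(k_{1:n})=-\tfrac12\sum_{i=1}^n(\mathfrak w\cdot k_i)^2\hat f(k_{1:n}),$$ $$\mathcal F(\mathcal A^\varepsilon_+f)(k_{1:n+1})=-\frac{2\iota}{2\pi}\frac{\lambda_\varepsilon}{n+1}\sum_{1\le i<j\le n+1}[\mathfrak w\cdot(k_i+k_j)]\,\mathbb J^\varepsilon_{k_i,k_j}\hat f(k_i+k_j,k_{\{1:n+1\}\setminus\{i,j\}}),$$ so $\mathcal A^\varepsilon_+:\Gamma L^2_n\to\Gamma L^2_{n+1}$ (and $\mathcal A^\varepsilon_+=0$ on $\Gamma L^2_0$); $\mathcal A^\varepsilon_-=-(\mathcal A^\varepsilon_+)^*$ (adjoint with respect to $\langle\cdot,\cdot\rangle$). Moreover, let $$\mathrm L^\varepsilon(x)=\lambda_\varepsilon^2\log\Big(1+\frac1{\varepsilon^2x}\Big)\ (x\ge\tfrac12),\qquad G(x)=\frac1{|\mathfrak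 w|^2}\Big[\Big(\frac{3|\mathfrak w|^2}{2\pi}x+1\Big)^{\frac23}-1\Big],$$ and $\mathcal G^\varepsilon=G(\mathrm L^\varepsilon(-\mathcal L_0))$, i.e. $\mathcal F(\mathcal G^\varepsilon\psi)(k_{1:n})=G(\mathrm L^\varepsilon(\tfrac12|k_{1:n}|^2))\hat\psi(k_{1:n})$ for $\psi\in\Gamma L^2_n$. Powers of $-\mathcal L_0$ and $(-\mathcal L_0-\mathcal L_0^{\mathfrak w}\mathcal G^\varepsilon)^{-1}$ are Fourier multipliers (the latter is applied only to chaos components of order $\ge 2$). The left-hand side is understood as a sesquilinear form, the first part being $\langle(-\mathcal L_0-\mathcal L_0^{\mathfrak w}\mathcal G^\varepsilon)^{-1}\mathcal A^\varepsilon_+\psi_1,\mathcal A^\varepsilon_+\psi_2\rangle$; the inequality has content only when the norms on the right-hand side are finite. *)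

(* Defs.v *)
From HB Require Import structures.
From mathcomp Require Import all_boot all_order all_algebra.
From mathcomp Require Import all_classical all_reals all_analysis.
From mathcomp Require Import perm complex.

Set Implicit Arguments.
Unset Strict Implicit.
Unset Printing Implicit Defensive.

Import Order.TTheory GRing.Theory Num.Theory.
Import numFieldNormedType.Exports.

Local Open Scope classical_set_scope.
Local Open Scope ring_scope.

Section torus.
Variable R : realType.

(* The torus of side 2 pi is modelled by the fundamental domain [0, 2 pi[ ^ 2;
   [torus1] is Lebesgue measure on it (total mass (2 pi)^2). *)
Local Notation plane := (measurableTypeR R * measurableTypeR R)%type.

Definition side : set (measurableTypeR R) := `[0, 2 * pi[%classic.

Lemma measurable_side : measurable side.
Proof. exact: measurable_itv. Qed.

Lemma lebesgue_side_lty : (@lebesgue_measure R side < +oo)%E.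
Proof.
rewrite /side lebesgue_measure_itv/=.
by case: ifP => _; rewrite -?EFinD ltry.
Qed.

Definition circle : {finite_measure set (measurableTypeR R) -> \bar R} :=
  mfrestr measurable_side lebesgue_side_lty.

Section product_finite.
Context d1 d2 (T1 : measurableType d1) (T2 : measurableType d2).
Variables (m1 : {finite_measure set T1 -> \bar R})
          (m2 : {finite_measure set T2 -> \bar R}).

Definition fprod : set (T1 * T2) -> \bar R := (m1 \x m2)%E.

HB.instance Definition _ := Measure.on fprod.

Lemma fprod_fin : fin_num_fun fprod.
Proof.
apply: lty_fin_num_fun => /=.
have -> : [set: T1 * T2] = [set: T1] `*` [set: T2] by rewrite setXTT.
rewrite /fprod product_measure1E// lte_mul_pinfty ?fin_num_measure//.
by rewrite -ge0_fin_numE// fin_num_measure.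
Qed.

HB.instance Definition _ := Measure_isFinite.Build _ _ _ fprod fprod_fin.

End product_finite.

Definition torus1 : {finite_measure set plane -> \bar R} := fprod circle circle.

Definition tcons n (x : plane * n.-tuple plane) : n.+1.-tuple plane :=
  [tuple of x.1 :: x.2].

Lemma measurable_tcons n : measurable_fun setT (@tcons n).
Proof. exact: measurable_cons. Qed.

Lemma measurable_pre_tcons n (A : set (n.+1.-tuple plane)) :
  measurable A -> measurable (@tcons n @^-1` A).
Proof.
by move=> mA; rewrite -[X in measurable X]setTI; exact: measurable_tcons.
Qed.

Section torus_step.
Variables (n : nat) (m : {finite_measure set (n.-tuple plane) -> \bar R}).

Definition torus_step : set (n.+1.-tuple plane) -> \bar R :=
  pushforward (fprod torus1 m) (@tcons n).

Let torus_step0 : torus_step set0 = 0%E.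
Proof. by rewrite /torus_step /pushforward preimage_set0 measure0. Qed.

Let torus_step_ge0 A : (0 <= torus_step A)%E.
Proof. by rewrite /torus_step /pushforward measure_ge0. Qed.

Let torus_step_sigma_additive : semi_sigma_additive torus_step.
Proof.
move=> F mF tF mUF; rewrite /torus_step /pushforward preimage_bigcup.
apply: measure_semi_sigma_additive.
- by move=> k; exact: measurable_pre_tcons.
- apply/trivIsetP => /= i j _ _ ij; rewrite -preimage_setI.
  by move/trivIsetP : tF => /(_ _ _ _ _ ij) ->//; rewrite preimage_set0.
- by rewrite -preimage_bigcup; exact: measurable_pre_tcons.
Qed.

HB.instance Definition _ := isMeasure.Build _ _ _ torus_step
  torus_step0 torus_step_ge0 torus_step_sigma_additive.

Lemma torus_step_fin : fin_num_fun torus_step.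
Proof.
move=> A mA; apply: (fin_num_measure (fprod torus1 m)).
exact: measurable_pre_tcons.
Qed.

HB.instance Definition _ :=
  Measure_isFinite.Build _ _ _ torus_step torus_step_fin.

End torus_step.

(* Lebesgue measure on the n-fold product of the torus. *)
Fixpoint torus n : {finite_measure set (n.-tuple plane) -> \bar R} :=
  if n is n'.+1 then torus_step (torus n') else \d_([tuple] : 0.-tuple plane).

End torus.

Notation plane R := (measurableTypeR R * measurableTypeR R)%type.
Notation Z2 := (int * int)%type.

Section fock_space.
Variable R : realType.

Definition cintegral d (T : measurableType d) (mu : {measure set T -> \bar R})
    (f : T -> R[i]) : R[i] :=
  Complex (\int[mu]_x complex.Re (f x))%R (\int[mu]_x complex.Im (f x))%R.

Definition expo (k : Z2) (x : plane R) : R[i] :=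
  let t := k.1%:~R * x.1 + k.2%:~R * x.2 in
  Complex ((2 * pi)^-1 * cos t) ((2 * pi)^-1 * sin t).

Definition fourier n (f : n.-tuple (plane R) -> R[i]) (k : n.-tuple Z2) : R[i] :=
  cintegral (torus R n)
    (fun x => f x * \prod_(j < n) expo (- tnth k j) (tnth x j)).

Definition normL2_sqr n (f : n.-tuple (plane R) -> R[i]) : \bar R :=
  (\int[torus R n]_x ((Normc.normc (f x)) ^+ 2)%:E)%E.

Definition symmetric_ae n (f : n.-tuple (plane R) -> R[i]) : Prop :=
  forall s : 'S_n,
    {ae torus R n, forall x, f [tuple tnth x (s i) | i < n] = f x}.

(* For n = 0 the domain is a single point, so that these are the constants. *)
Definition chaos n (f : n.-tuple (plane R) -> R[i]) : Prop :=
  [/\ measurable_fun setT (fun x => complex.Re (f x)),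
      measurable_fun setT (fun x => complex.Im (f x)),
      (normL2_sqr f < +oo)%E,
      symmetric_ae f
    & forall k : n.-tuple Z2, 0 \in (k : seq Z2) -> fourier f k = 0].

Definition GammaL2 (psi : forall n, n.-tuple (plane R) -> R[i]) : Prop :=
  (forall n, chaos (psi n)) /\
  (\sum_(n <oo) (n`!)%:R%:E * normL2_sqr (psi n) < +oo)%E.

(* A family of Fourier coefficients (one function of n frequencies for each
   n >= 0) is a single function on [seq Z2]: the chaos order of k is [size k]. *)
Definition fhat (psi : forall n, n.-tuple (plane R) -> R[i]) (k : seq Z2) : R[i] :=
  fourier (psi (size k)) (in_tuple k).

(* Unconditional sums of complex numbers; meaningful for summable families. *)
Definition rsum (T : choiceType) (a : T -> R) : R :=
  fine (\esum_(t in [set: T]) (Num.max (a t) 0)%:E) -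
  fine (\esum_(t in [set: T]) (Num.max (- a t) 0)%:E).

Definition csum (T : choiceType) (a : T -> R[i]) : R[i] :=
  Complex (rsum (fun t => complex.Re (a t))) (rsum (fun t => complex.Im (a t))).

(* The scalar product sum_n n! <f_n, g_n> written on Fourier coefficients: the
   functions [expo] are orthonormal, so no constant appears. In this form it
   also makes sense for images of Fourier multipliers that leave the Fock
   space, as needed for sesquilinear forms. *)
Definition pairing_term (f g : seq Z2 -> R[i]) (k : seq Z2) : R[i] :=
  ((size k)`!)%:R * f k * conjc (g k).

Definition pairing_summable (f g : seq Z2 -> R[i]) : Prop :=
  summable [set: seq Z2] (fun k => (Normc.normc (pairing_term f g k))%:E).

Definition pairing (f g : seq Z2 -> R[i]) : R[i] := csum (pairing_term f g).

Definition fock_norm (f : seq Z2 -> R[i]) : \bar R :=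
  sqrte (\esum_(k in [set: seq Z2])
           (((size k)`!)%:R * (Normc.normc (f k)) ^+ 2)%:E)%E.

End fock_space.

Section operators.
Variable R : realType.
Variables (w : R * R) (eps : R).

Definition w2 : R := w.1 ^+ 2 + w.2 ^+ 2.
Definition wdot (k : Z2) : R := w.1 * k.1%:~R + w.2 * k.2%:~R.
Definition norm2 (k : Z2) : R := k.1%:~R ^+ 2 + k.2%:~R ^+ 2.

Definition lambda : R := (ln (eps ^- 2)) `^ (- 2^-1).

Definition cutoff (l : Z2) : bool := 0 < eps * Num.sqrt (norm2 l) <= 1.
Definition J (l m : Z2) : bool := [&& cutoff l, cutoff m & cutoff (l + m)].

Definition multiplier (m : seq Z2 -> R) (f : seq Z2 -> R[i]) (k : seq Z2) : R[i] :=
  (m k)%:C%C * f k.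

Definition number (k : seq Z2) : R := (size k)%:R.
Definition L0 (k : seq Z2) : R := - 2^-1 * \sum_(l <- k) norm2 l.
Definition L0w (k : seq Z2) : R := - 2^-1 * \sum_(l <- k) (wdot l) ^+ 2.

Definition Leps (x : R) : R := lambda ^+ 2 * ln (1 + (eps ^+ 2 * x)^-1).
Definition G (x : R) : R :=
  w2^-1 * ((3 * w2 / (2 * pi) * x + 1) `^ (2 / 3) - 1).
Definition Geps (k : seq Z2) : R := G (Leps (- L0 k)).

Definition resolvent (k : seq Z2) : R := (- L0 k - L0w k * Geps k)^-1.

Definition remove2 (i j : nat) (k : seq Z2) : seq Z2 :=
  [seq nth 0 k l | l <- iota 0 (size k) & (l != i) && (l != j)].

(* Here [size k] is the order n + 1 of the image chaos; the sum is empty, hence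
   the value 0, when [size k <= 1]. *)
Definition Aplus (f : seq Z2 -> R[i]) (k : seq Z2) : R[i] :=
  Complex 0 (- (2 / (2 * pi))) * (lambda / (size k)%:R)%:C%C *
  \sum_(i < size k) \sum_(j < size k | (i < j)%N)
    (wdot (nth 0 k i + nth 0 k j))%:C%C * (J (nth 0 k i) (nth 0 k j))%:R *
    f ((nth 0 k i + nth 0 k j) :: remove2 i j k).

(* <[- A_- (- L0 - L0w G)^-1 A_+ + L0w G] f, g> as a sesquilinear form. Since
   A_- = - (A_+)^*, the first part is <(- L0 - L0w G)^-1 A_+ f, A_+ g>. *)
Definition op_form (f g : seq Z2 -> R[i]) : R[i] :=
  pairing (multiplier resolvent (Aplus f)) (Aplus g) +
  pairing (multiplier (fun k => L0w k * Geps k) f) g.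

Definition op_form_defined (f g : seq Z2 -> R[i]) : Prop :=
  pairing_summable (multiplier resolvent (Aplus f)) (Aplus g) /\
  pairing_summable (multiplier (fun k => L0w k * Geps k) f) g.

(* The norm of N (- L0)^(1/2) f; it is +oo outside the domain. *)
Definition energy (f : seq Z2 -> R[i]) : \bar R :=
  fock_norm (multiplier (fun k => number k * Num.sqrt (- L0 k)) f).

End operators.

(* Main.v *)
(** Idea. On the Fourier side, the first part of the form is a sum over frequencies
    [k] and over two pairs of entries of [k], each pair being merged into its sum.

    If the pairs coincide, merging gives a frequency [p :: K] and the sum over
    the splittings [p = l + (p - l)] of the resolvent. As the resolvent depends
    on [G] only through slowly varying logarithms, this two-dimensional sum can
    be computed up to a bounded error: the sum over a row is a telescoping sum of
    arctangents, about [pi / (r * sqrt (1 + w2 * G))], and because [G] solves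
    [G' = 1 / (pi * sqrt (1 + w2 * G))], the sum over the rows telescopes to
    [pi^2 / lambda^2 * G(Leps)]. This is the term that [L0w * Geps] cancels, and
    the bounded error contributes [O(lambda^2)].

    If the pairs differ, each contains an entry outside the other one, and a
    Schur test with weights in these two entries bounds the sum, without
    logarithmic loss, by [lambda^2] times the energies; the number of choices of
    the entries is absorbed by the number operator. *)

From HB Require Import structures.
Require Import Defs.
From mathcomp Require Import all_boot all_order all_algebra.
From mathcomp Require Import all_classical all_reals all_analysis.
From mathcomp Require Import measurable_realfun perm complex ring lra zify.

Set Implicit Arguments.
Unset Strict Implicit.
Unset Printing Implicit Defensive.

Import Order.TTheory GRing.Theory Num.Theory.
Import numFieldNormedType.Exports.

Local Open Scope ring_scope.
Local Notation normc := Normc.normc.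

(** * One-dimensional sums *)

Section lattice_sums.
Variable R : realType.
Implicit Types (f : R -> R) (c s x y : R) (n : nat).

(** The splitting sum is of order up to [lambda ^- 2], while the claim tolerates only an error
    [O(1)] in it, uniformly in [eps], in the merged momentum and in the spectator entries. Apart
    from tails of order [eps], a row at distance [r] may thus cost only
    [lambda ^+ 2 / r + sg / r ^+ 2], whose sum over the rows is bounded; [sg ^+ 2] is the energy of
    the midpoint splitting. For [eps] near [1], where [lambda] blows up, and for momenta beyond the
    cutoff, the sum and its limit are bounded separately.

    The form is defined through positive and negative parts of real sums, and only nonnegative sums
    can be rearranged freely. The diagonal analysis is therefore made for a nonnegative symmetric
    family [h], with sums in [[0, +oo]], and applied to the positive and negative parts of the real
    and imaginary parts of [f * conjc g]. These are dominated by [t |f|^2 + |g|^2 / t], and the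
    choice of [t] produces the product of the norms. Bringing a chosen entry to the front uses the
    symmetry of the Fourier coefficients, which rests on the permutation invariance of the torus
    measure. *)

Lemma sum_le_telescope (f Psi : nat -> R) n :
  (forall i, (i < n)%N -> f i <= Psi i - Psi i.+1) ->
  \sum_(i < n) f i <= Psi 0%N - Psi n.
Proof.
move=> h; rewrite -opprB -telescope_sumr// big_mkord -sumrN.
by apply: ler_sum => i _; rewrite opprB h.
Qed.

Lemma sum_approx_telescope (f e Psi : nat -> R) n :
  (forall i, (i < n)%N -> `|f i - (Psi i - Psi i.+1)| <= e i) ->
  `|\sum_(i < n) f i - (Psi 0%N - Psi n)| <= \sum_(i < n) e i.
Proof.
move=> h; rewrite -(opprB (Psi n)) -telescope_sumr// big_mkord -!sumrN -big_split/=.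
apply: (le_trans (ler_norm_sum _ _ _)); apply: ler_sum => i _.
by rewrite opprB h.
Qed.

(** The decrement [3 / (r * (r + 1))] of [3 / r] dominates [r ^- 2] exactly from [r = 2^-1] on; the
    lattice sums start at [Num.sqrt beta], which is at least [2^-1]. *)
Lemma sum_inv_sqr_le s n : 2^-1 <= s ->
  \sum_(i < n) (s + i%:R) ^- 2 <= 3 / s.
Proof.
move=> s1; have sp i : 2^-1 <= s + i%:R by rewrite (le_trans s1)// lerDl.
have -> : 3 / s = 3 / (s + 0%:R) by rewrite addr0.
apply: (@le_trans _ _ (3 / (s + 0%:R) - 3 / (s + n%:R))); last first.
  by rewrite lerBlDr lerDl divr_ge0// (le_trans _ (sp n)).
apply: (@sum_le_telescope (fun i => (s + i%:R) ^- 2) (fun i => 3 / (s + i%:R))).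
move=> i _; have := sp i; set r := s + i%:R => r1.
have -> : s + i.+1%:R = r + 1 by rewrite -natr1 addrA.
have -> : 3 / r - 3 / (r + 1) = 3 / (r * (r + 1)) by field; lra.
rewrite -div1r ler_pdivrMr ?exprn_gt0//; last by lra.
by rewrite mulrAC ler_pdivlMr; nra.
Qed.

Lemma sum_inv_pow32_le s n : 2^-1 <= s ->
  \sum_(i < n) ((s + i%:R) * Num.sqrt (s + i%:R))^-1 <= 6 / Num.sqrt s.
Proof.
move=> s1; have sp i : 2^-1 <= s + i%:R by rewrite (le_trans s1)// lerDl.
have -> : 6 / Num.sqrt s = 6 / Num.sqrt (s + 0%:R) by rewrite addr0.
apply: (@le_trans _ _ (6 / Num.sqrt (s + 0%:R) - 6 / Num.sqrt (s + n%:R))); last first.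
  by rewrite lerBlDr lerDl divr_ge0// sqrtr_ge0.
apply: (@sum_le_telescope (fun i => ((s + i%:R) * Num.sqrt (s + i%:R))^-1)
                          (fun i => 6 / Num.sqrt (s + i%:R))).
move=> i _; have := sp i.
have -> : s + i.+1%:R = (s + i%:R) + 1 by rewrite -natr1 addrA.
set r := s + i%:R => r1.
have r0 : 0 < r by lra.
have a0 : 0 < Num.sqrt r by rewrite sqrtr_gt0.
have b0 : 0 < Num.sqrt (r + 1) by rewrite sqrtr_gt0; lra.
have a2 : Num.sqrt r ^+ 2 = r by rewrite sqr_sqrtr// ltW.
have b2 : Num.sqrt (r + 1) ^+ 2 = r + 1 by rewrite sqr_sqrtr//; lra.
move: a0 b0 a2 b2; set a := Num.sqrt r; set b := Num.sqrt (r + 1) => a0 b0 a2 b2.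
have ba : b ^+ 2 = a ^+ 2 + 1 by rewrite a2.
have a21 : 2^-1 <= a ^+ 2 by rewrite a2.
have ab : a <= b by rewrite ler_sqrt; lra.
have -> : 6 / a - 6 / b = 6 / (a * b * (a + b)).
  have e : b - a = (a + b)^-1.
    by apply: (@mulIf _ (a + b)); [lra|rewrite mulVf; [lra|lra]].
  rewrite (_ : 6 / a - 6 / b = 6 * (b - a) / (a * b)); last by field; lra.
  by rewrite e; field; lra.
have p0 : 0 < a * b * (a + b) by rewrite !mulr_gt0// addr_gt0.
rewrite -a2 -div1r ler_pdivrMr ?mulr_gt0// ?exprn_gt0//.
rewrite mulrAC ler_pdivlMr// mul1r.
have h1 : a * b * (a + b) <= a * (2 * b ^+ 2) by rewrite -mulrA ler_pM2l//; nra.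
apply: (le_trans h1); rewrite ba.
nra.
Qed.

Lemma sum_inv_le s n : 2^-1 <= s ->
  \sum_(i < n) (s + i%:R)^-1 <= 3 * ln ((s + n%:R) / s).
Proof.
move=> s1; have sp i : 2^-1 <= s + i%:R by rewrite (le_trans s1)// lerDl.
have spos i : 0 < s + i%:R by have := sp i; lra.
have s0 : 0 < s by lra.
apply: (@le_trans _ _ (- 3 * ln (s + 0%:R) - - 3 * ln (s + n%:R))); last first.
  by rewrite ln_div ?posrE// addr0; lra.
apply: (@sum_le_telescope (fun i => (s + i%:R)^-1) (fun i => - 3 * ln (s + i%:R))).
move=> i _; have := sp i; have := spos i.+1.
have -> : s + i.+1%:R = (s + i%:R) + 1 by rewrite -natr1 addrA.
set r := s + i%:R => r10 r1; have r0 : 0 < r by lra.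
have := @le_ln1Dx R (- (r + 1)^-1).
have -> : 1 - (r + 1)^-1 = r / (r + 1) by field; lra.
rewrite ln_div ?posrE// ltrN2 invf_lt1; last by lra.
move=> /(_ ltac:(lra)) h.
suff : r^-1 <= 3 * (r + 1)^-1 by lra.
by rewrite ler_pdivlMr// mulrC ler_pdivrMr//; lra.
Qed.

(** Discrete form of the integral of [sqrt x / (sqrt t * (t + x))] over [t > 0], which equals [pi].
    The algebraic function [4 * sqrt t / (sqrt t + sqrt x)] replaces the primitive
    [2 * atan (sqrt (t / x))]; that its increments dominate comes down to
    [2 * s * (s - b) ^+ 2 >= 0]. *)
Lemma sum_interpolated_le x n : 1 <= x ->
  \sum_(i < n) Num.sqrt x / (Num.sqrt (1 + i%:R) * (1 + i%:R + x)) <= 4.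
Proof.
move=> x1; set b := Num.sqrt x.
have b0 : 0 < b by rewrite sqrtr_gt0; lra.
have b2 : b ^+ 2 = x by rewrite sqr_sqrtr//; lra.
pose Psi (i : nat) := - (4 * Num.sqrt i%:R / (Num.sqrt i%:R + b)).
apply: (@le_trans _ _ (Psi 0%N - Psi n)); last first.
  rewrite /Psi sqrtr0 mulr0 mul0r oppr0 sub0r opprK.
  rewrite ler_pdivrMr; last by rewrite ltr_wpDl ?sqrtr_ge0.
  by rewrite ler_pM2l// lerDl ltW.
apply: (@sum_le_telescope (fun i => b / (Num.sqrt (1 + i%:R) * (1 + i%:R + x)))).
move=> i _; rewrite /Psi -b2.
have -> : i.+1%:R = 1 + i%:R :> R by rewrite -natr1 addrC.
have t0 : 0 <= Num.sqrt i%:R :> R by rewrite sqrtr_ge0.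
have t2 : Num.sqrt i%:R ^+ 2 = i%:R :> R by rewrite sqr_sqrtr.
have s0 : 0 < Num.sqrt (1 + i%:R) :> R by rewrite sqrtr_gt0 ltr_pwDl.
have s2 : Num.sqrt (1 + i%:R) ^+ 2 = 1 + i%:R :> R by rewrite sqr_sqrtr// addr_ge0.
move: t0 t2 s0 s2; set t := Num.sqrt i%:R; set s := Num.sqrt _ => t0 t2 s0 s2.
have e : s - t = (s + t)^-1.
  by apply: (@mulIf _ (s + t)); [lra|rewrite mulVf; [|lra]; nra].
have -> : - (4 * t / (t + b)) - - (4 * s / (s + b)) =
   4 * b * (s - t) / ((s + b) * (t + b)) by field; lra.
rewrite e -s2 -subr_ge0.
have ts : t <= s by rewrite ler_sqrt ?lerDr// addr_ge0.
rewrite -[4 * b / _ / _]mulrA -invfM.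
rewrite subr_ge0 ler_pdivlMr ?mulr_gt0//; [|lra..].
rewrite mulrAC ler_pdivrMr ?mulr_gt0//; last by nra.
have h : (s + t) * ((s + b) * (t + b)) <= 2 * s * ((s + b) * (s + b)).
  by apply: ler_pM; [lra|nra|lra|apply: ler_pM; lra].
rewrite (_ : 4 * b * (s * (s ^+ 2 + b ^+ 2)) = b * (4 * (s * (s ^+ 2 + b ^+ 2)))); last by ring.
rewrite ler_pM2l//; apply: (le_trans h).
rewrite -subr_ge0 (_ : _ - _ = 2 * s * (s - b) ^+ 2); last by ring.
by rewrite mulr_ge0 ?sqr_ge0//; lra.
Qed.

Lemma split_at c n : exists m : nat, [/\ (m <= n)%N,
  forall i, (i < m)%N -> i%:R < c & forall i, (m <= i < n)%N -> c <= i%:R].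
Proof.
elim: n => [|n [m [mn h1 h2]]].
  by exists 0%N; split => // i /andP[]; rewrite ltn0.
have [nc|cn] := ltrP n%:R c.
  exists n.+1; split => // [i|i /andP[/leq_trans h /h]]; last by rewrite ltnn.
  by rewrite ltnS => ilt; rewrite (le_lt_trans _ nc)// ler_nat.
exists m; split => //; first exact: leq_trans mn _.
move=> i /andP[mi]; rewrite ltnS leq_eqVlt => /orP[/eqP ->//|i_n].
by rewrite h2// mi.
Qed.

(** On either side of [c] the points are at distances at least [0, 1, 2, ...], so a nonincreasing
    [f] reduces both halves to the one-sided sum, wherever [c] lies. *)
Lemma sum_two_sided f c s n (B : R) :
  (forall i m, s <= i -> i <= m -> f m <= f i) ->
  (forall m, (m <= n)%N -> \sum_(i < m) f (s + i%:R) <= B) ->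
  \sum_(i < n) f (s + `|i%:R - c|) <= 2 * B.
Proof.
move=> fmono fB; have [m [mn h1 h2]] := split_at c n.
rewrite -(big_mkord xpredT (fun i => f (s + `|i%:R - c|))).
rewrite (@big_cat_nat _ _ _ m)//= mulr2n mulrDl mul1r lerD//.
  rewrite big_nat_rev/= add0n; apply: (le_trans _ (fB m mn)).
  rewrite -(big_mkord xpredT (fun i => f (s + i%:R))).
  apply: ler_sum_nat => i /andP[_ im]; apply: fmono; first by rewrite lerDl.
  rewrite lerD2l distrC; apply: le_trans (ler_norm _).
  have := h1 m.-1; case: m im {mn h1 h2} => // m im /= /(_ (ltnSn _)).
  by rewrite subSS ltnS in im * => h; rewrite natrB//; lra.
apply: (le_trans _ (fB (n - m)%N (leq_subr _ _))).
rewrite -{1}[m]add0n big_addn big_mkord.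
apply: ler_sum => -[i /= im] _; apply: fmono; first by rewrite lerDl.
rewrite lerD2l; apply: le_trans (ler_norm _).
have := h2 m; rewrite leqnn/= -subn_gt0 (leq_ltn_trans _ im)// => /(_ isT).
by rewrite natrD; lra.
Qed.

End lattice_sums.

(** * The functions L and G *)

Section profile.
Variables (R : realType) (w : R * R).
Hypothesis w0 : 0 < w2 w.

Definition cbrt (x : R) : R := (3 * w2 w / (2 * pi) * x + 1) `^ 3^-1.

Let u := 3 * w2 w / (2 * pi).

Let u0 : 0 < u.
Proof. by rewrite divr_gt0 ?mulr_gt0// pi_gt0. Qed.

Lemma cbrtK x : 0 <= x -> cbrt x ^+ 3 = u * x + 1.
Proof.
move=> x0; have y0 : 0 <= u * x + 1 by rewrite addr_ge0// mulr_ge0// ltW.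
by rewrite -powR_mulrn ?powR_ge0// -powRrM mulVf// powRr1.
Qed.

Lemma cbrt_ge1 x : 0 <= x -> 1 <= cbrt x.
Proof.
move=> x0; have : 0 <= cbrt x by rewrite powR_ge0.
have := cbrtK x0; have : 0 <= u * x by rewrite mulr_ge0// ltW.
by move: (cbrt x) (u * x) => t y y0 ty t0; rewrite leNgt; apply/negP => t1; nra.
Qed.

Lemma GE x : 0 <= x -> w2 w * G w x = cbrt x ^+ 2 - 1.
Proof.
move=> x0; rewrite /G mulrA divff ?mul1r ?gt_eqF//.
by rewrite (mulrC 2 3^-1) powRrM -/(cbrt x) powR_mulrn// powR_ge0.
Qed.

Lemma cbrt_sub (x y : R) : 0 <= y -> y <= x ->
  [/\ 1 <= cbrt y, cbrt y <= cbrt x & u * (x - y) =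
   (cbrt x - cbrt y) * (cbrt x ^+ 2 + cbrt x * cbrt y + cbrt y ^+ 2)].
Proof.
move=> y0 yx; have x0 := le_trans y0 yx.
have yx3 : u * (x - y) = cbrt x ^+ 3 - cbrt y ^+ 3 by rewrite !cbrtK//; ring.
have := cbrt_ge1 y0; have := cbrt_ge1 x0; have : 0 <= u * (x - y).
  by rewrite mulr_ge0 ?subr_ge0// ltW.
rewrite yx3; move: (cbrt x) (cbrt y) => s t st s1 t1; split => //; last by ring.
rewrite leNgt; apply/negP => ts; have h : 0 < t ^+ 2 + t * s + s ^+ 2 by nra.
have : 0 < (t - s) * (t ^+ 2 + t * s + s ^+ 2) by rewrite mulr_gt0// subr_gt0.
by rewrite (_ : _ * _ = t ^+ 3 - s ^+ 3); [lra|ring].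
Qed.

Let u_le : u <= w2 w.
Proof.
rewrite ler_pdivrMr ?mulr_gt0 ?pi_gt0// mulrC ler_pM2l//.
by have := pi_ge2 R; lra.
Qed.

(** Both increments factor through the increment [s - t] of [cbrt], and
    [s + t <= s ^+ 2 + s * t + t ^+ 2] because [1 <= t <= s]; the constant is [1] since
    [u <= w2 w]. *)
Lemma G_sub (x y : R) : 0 <= y -> y <= x -> 0 <= G w x - G w y <= x - y.
Proof.
move=> y0 yx; have [t1 ts e] := cbrt_sub y0 yx.
have x0 := le_trans y0 yx.
have : w2 w * (G w x - G w y) = cbrt x ^+ 2 - cbrt y ^+ 2 by rewrite mulrBr !GE//; ring.
have : u * (x - y) <= w2 w * (x - y) by rewrite ler_wpM2r ?u_le// subr_ge0.
rewrite e; move: (cbrt x) (cbrt y) ts t1 => s t ts t1 {e}.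
move=> h1 h2; apply/andP; split.
  rewrite -(pmulr_rge0 _ w0) h2; by rewrite subr_ge0 ler_pXn2r// nnegrE; lra.
rewrite -(ler_pM2l w0) h2; apply: le_trans h1; rewrite subr_sqr ler_wpM2l ?subr_ge0//; nra.
Qed.

Lemma G0 : G w 0 = 0.
Proof. by rewrite /G mulr0 add0r powR1 subrr mulr0. Qed.

Lemma G_ge0 x : 0 <= x -> 0 <= G w x.
Proof. by move=> x0; have /andP[] := G_sub (lexx 0) x0; rewrite G0 subr0. Qed.

Lemma G_le x : 0 <= x -> G w x <= x.
Proof. by move=> x0; have /andP[_] := G_sub (lexx 0) x0; rewrite G0 !subr0. Qed.

(* [cbrt x] is the square root of [1 + w2 * G x], so this is the discrete form
   of the differential equation G' = 1 / (pi * sqrt (1 + w2 * G)). *)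
Lemma G_increment (x y : R) : 0 <= y -> y <= x ->
  `|(x - y) / cbrt x - pi * (G w x - G w y)| <= w2 w * (x - y) ^+ 2.
Proof.
move=> y0 yx; have [t1 ts e] := cbrt_sub y0 yx.
have x0 := le_trans y0 yx.
have h2 : w2 w * (G w x - G w y) = cbrt x ^+ 2 - cbrt y ^+ 2 by rewrite mulrBr !GE//; ring.
have p2 : 2 <= pi :> R := pi_ge2 R.
have uE : u * pi = 3 / 2 * w2 w by rewrite /u; field; lra.
move: e ts t1 h2; move: (cbrt x) (cbrt y) (G w x - G w y) => s t g e ts t1 h2.
have s0 : s != 0 by lra.
have xy : w2 w * (x - y) = 2 / 3 * pi * ((s - t) * (s ^+ 2 + s * t + t ^+ 2)).
  by rewrite -e; move: uE; set W := w2 w => uE; rewrite (_ : _ * (u * _) = 2 / 3 * (u * pi) * (x - y)); [rewrite uE; field|ring].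
(* Freezing the derivative at [x] leaves an explicit multiple of [(s - t) ^+ 2], hence a defect of
   second order. *)
have id : w2 w * ((x - y) / s - pi * g) = - (pi / 3) * ((s - t) ^+ 2 * (s + 2 * t) / s).
  rewrite (_ : _ * _ = w2 w * (x - y) / s - pi * (w2 w * g)); last by field.
  by rewrite xy h2; field.
have st0 : 0 <= s - t by lra.
rewrite -(ler_pM2l w0) -{1}(gtr0_norm w0) -normrM id normrM normrN.
rewrite !ger0_norm; last first.
- by rewrite divr_ge0 ?mulr_ge0 ?sqr_ge0//; lra.
- by rewrite divr_ge0; lra.
have h1 : (s - t) ^+ 2 * (s + 2 * t) / s <= 3 * (s - t) ^+ 2.
  rewrite ler_pdivrMr; last by lra.
  rewrite (mulrC 3) -[leRHS]mulrA ler_wpM2l ?sqr_ge0//; lra.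
have h3 : 3 * (s - t) <= u * (x - y).
  rewrite e (mulrC 3) ler_wpM2l//; nra.
have h4 : pi * (s - t) <= w2 w / 2 * (x - y).
  have : pi * (3 * (s - t)) <= pi * (u * (x - y)) by rewrite ler_pM2l//; lra.
  by rewrite (mulrA pi u) (mulrC pi u) uE; lra.
have h5 : (pi * (s - t)) ^+ 2 <= (w2 w / 2 * (x - y)) ^+ 2.
  have p1 : 0 <= pi * (s - t) by rewrite mulr_ge0//; lra.
  by rewrite ler_pXn2r// nnegrE (le_trans p1 h4).
apply: (@le_trans _ _ (pi * (s - t) ^+ 2)).
  have -> : pi * (s - t) ^+ 2 = pi / 3 * (3 * (s - t) ^+ 2) by field.
  by rewrite ler_wpM2l//; lra.
have h6 : pi * (s - t) ^+ 2 <= pi * (pi * (s - t) ^+ 2).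
  by rewrite ler_peMl; [lra|rewrite mulr_ge0 ?sqr_ge0|]; lra.
apply: (le_trans h6); rewrite (_ : pi * _ = (pi * (s - t)) ^+ 2); last by ring.
apply: (le_trans h5); rewrite (_ : _ ^+ 2 = (w2 w * (x - y)) ^+ 2 / 4); last by field.
rewrite [leRHS](_ : _ = (w2 w * (x - y)) ^+ 2); [|ring].
by have := sqr_ge0 (w2 w * (x - y)); move: (_ ^+ 2) => z z0; lra.
Qed.

End profile.

(** * The logarithmic scale set by the cutoff *)

Section scale.
Variables (R : realType) (eps : R).
Hypothesis eps01 : 0 < eps < 1.

Let e0 : 0 < eps. Proof. by case/andP: eps01. Qed.

Lemma ln_epsV_gt0 : 0 < ln (eps ^- 2).
Proof.
rewrite ln_gt0// invf_gt1 ?exprn_gt0// expr_lt1//; first by case/andP: eps01.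
exact: ltW.
Qed.

Lemma lambda2E : lambda eps ^+ 2 = (ln (eps ^- 2))^-1.
Proof.
rewrite /lambda -powR_mulrn ?powR_ge0// -powRrM.
by rewrite mulNr mulVf// powR_inv1// ltW// ln_epsV_gt0.
Qed.

Lemma lambda2_gt0 : 0 < lambda eps ^+ 2.
Proof. by rewrite lambda2E invr_gt0 ln_epsV_gt0. Qed.

Let arg_gt1 x : 0 < x -> 1 < 1 + (eps ^+ 2 * x)^-1.
Proof. by move=> x0; rewrite ltrDl invr_gt0 mulr_gt0// exprn_gt0. Qed.

Lemma Leps_ge0 x : 0 < x -> 0 <= Leps eps x.
Proof.
by move=> x0; rewrite mulr_ge0 ?sqr_ge0// ln_ge0// ltW// arg_gt1.
Qed.

Lemma Leps_sub (x y : R) : 0 < x -> x <= y ->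
  0 <= Leps eps x - Leps eps y <= lambda eps ^+ 2 * ln (y / x).
Proof.
move=> x0 xy; have y0 := lt_le_trans x0 xy.
have ax := arg_gt1 x0; have ay := arg_gt1 y0.
have ax0 := lt_trans ltr01 ax; have ay0 := lt_trans ltr01 ay.
rewrite -mulrBr -ln_div ?posrE//.
have ex : 0 < eps ^+ 2 * x by rewrite mulr_gt0// exprn_gt0.
have ey : 0 < eps ^+ 2 * y by rewrite mulr_gt0// exprn_gt0.
have exy : eps ^+ 2 * x <= eps ^+ 2 * y by rewrite ler_pM2l// exprn_gt0.
apply/andP; split.
  by rewrite mulr_ge0 ?sqr_ge0// ln_ge0// ler_pdivlMr// mul1r lerD2l lef_pV2.
rewrite ler_pM2l ?lambda2_gt0// ler_ln ?posrE ?divr_gt0//.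
rewrite ler_pdivrMr//.
have -> : y / x * (1 + (eps ^+ 2 * y)^-1) = y / x + (eps ^+ 2 * x)^-1.
  by field; rewrite !gt_eqF.
by rewrite lerD2r ler_pdivlMr// mul1r.
Qed.

Lemma Leps_le x : 0 < x -> Leps eps x <= lambda eps ^+ 2 / (eps ^+ 2 * x).
Proof.
move=> x0; rewrite ler_pM2l ?lambda2_gt0// le_ln1Dx//.
by rewrite (lt_le_trans _ (ltW _ : 0 <= _))// ?ltrN10// invr_gt0 mulr_gt0// exprn_gt0.
Qed.

(** The argument of the logarithm is [(1 + (eps * r) ^+ 2) / (eps * r) ^+ 2], so the decrement is
    twice the increment of [ln r] minus that of [ln (1 + (eps * r) ^+ 2)]. The former is [2 / r] up
    to [2 / r ^+ 2], the latter at most [2 * eps]; over [O(eps^-1)] steps both errors add up to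
    [O(1)]. *)
Lemma Leps_step r : 2^-1 <= r ->
  `|Leps eps (r ^+ 2) - Leps eps ((r + 1) ^+ 2) - 2 * lambda eps ^+ 2 / r|
   <= lambda eps ^+ 2 * (2 / r ^+ 2 + 2 * eps).
Proof.
move=> r1; have r0 : 0 < r by lra.
have lp := lambda2_gt0.
rewrite /Leps -mulrBr.
have e2 : 0 < eps ^+ 2 by rewrite exprn_gt0.
have num s : 0 < s -> 1 + (eps ^+ 2 * s ^+ 2)^-1 = (1 + eps ^+ 2 * s ^+ 2) / (eps ^+ 2 * s ^+ 2).
  by move=> s0; field; rewrite !gt_eqF.
have np s : 0 < 1 + eps ^+ 2 * s ^+ 2 by rewrite ltr_pwDl// mulr_ge0 ?sqr_ge0// ltW.
rewrite !num//; last by lra.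
have sq s : 0 < s -> 0 < eps ^+ 2 * s ^+ 2 by move=> s0; rewrite mulr_gt0// exprn_gt0.
have r10 : 0 < r + 1 by lra.
rewrite !ln_div ?posrE ?np ?sq// !lnM ?posrE// ?exprn_gt0//.
set a := ln (1 + _ * r ^+ 2); set b := ln (1 + _); set c := ln r; set d := ln (r + 1).
rewrite (_ : _ - 2 * _ / r = lambda eps ^+ 2 * ((d - c - r^-1) *+ 2 - (b - a))); last first.
  by rewrite !mulr2n; ring.
rewrite normrM (ger0_norm (ltW lp)) ler_pM2l//.
have h1 : d - c <= r^-1.
  rewrite -ln_div ?posrE// (_ : _ / r = 1 + r^-1); last by field; lra.
  by rewrite le_ln1Dx// (lt_trans (ltrN10 _))// invr_gt0.
have h2 : (r + 1)^-1 <= d - c.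
  have := @le_ln1Dx R (- (r + 1)^-1).
  have -> : 1 - (r + 1)^-1 = r / (r + 1) by field; lra.
  rewrite ln_div ?posrE// ltrN2 invf_lt1//.
  by move=> /(_ ltac:(lra)); rewrite -/c -/d; lra.
have h3 : r^-1 - (r + 1)^-1 <= r ^- 2.
  rewrite (_ : _ - _ = (r * (r + 1))^-1); last by field; lra.
  by rewrite lef_pV2 ?posrE ?mulr_gt0 ?exprn_gt0//; nra.
have h4 : 0 <= b - a.
  rewrite subr_ge0 ler_ln ?posrE ?np// lerD2l ler_pM2l// ler_pXn2r// ?nnegrE; lra.
have h5 : b - a <= 2 * eps.
  rewrite -ln_div ?posrE ?np//.
  set x := _ / _; have -> : x = 1 + (2 * r + 1) * eps ^+ 2 / (1 + eps ^+ 2 * r ^+ 2).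
    have D0 : 1 + eps ^+ 2 * r ^+ 2 != 0 by rewrite gt_eqF ?np.
    by rewrite /x; field; rewrite exprMn.
  apply: (@le_trans _ _ ((2 * r + 1) * eps ^+ 2 / (1 + eps ^+ 2 * r ^+ 2))).
    rewrite le_ln1Dx// (lt_le_trans (ltrN10 _))// divr_ge0 ?ltW ?mulr_gt0//; lra.
  rewrite ler_pdivrMr ?np//.
  rewrite [leLHS](_ : _ = eps * ((2 * r + 1) * eps)); last by ring.
  rewrite [leRHS](_ : _ = eps * (2 * (1 + eps ^+ 2 * r ^+ 2))); last by ring.
  rewrite ler_pM2l//.
  have : 0 <= (1 - eps * r) ^+ 2 by rewrite sqr_ge0.
  have : eps * (4 * r - (2 * r + 1)) >= 0 by apply: mulr_ge0; [exact: ltW|lra].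
  by nra.
rewrite mulr2n ler_norml; apply/andP; split; lra.
Qed.

End scale.

(** * Lattice sums of the resolvent *)

Section arctangent.
Variable R : realType.
Implicit Types x y z : R.

Lemma atan_sub x y : x < y ->
  exists2 z, x < z < y & atan y - atan x = (y - x) / (1 + z ^+ 2).
Proof.
move=> xy.
have [z] := @MVT R atan (fun t => (1 + t ^+ 2)^-1) x y xy
  (fun t _ => is_derive1_atan t) (continuous_subspaceT (@continuous_atan R)).
by rewrite in_itv/= => zi ->; exists z => //; rewrite mulrC.
Qed.

Lemma atan_le z : 0 < z -> atan z <= z.
Proof.
move=> z0; have [x /andP[x0 _]] := atan_sub z0; rewrite atan0 !subr0 => ->.
rewrite ler_pdivrMr ?ltr_pwDl ?sqr_ge0//.
by apply: ler_peMr; [exact: ltW|rewrite lerDl sqr_ge0].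
Qed.

Lemma pihalf_sub_atan z : 0 < z -> 0 <= pi / 2 - atan z <= z^-1.
Proof.
move=> z0; have a1 := atan_ltpi2 z; have a2 : 0 < atan z by rewrite -(atan0 R) lt_atan.
apply/andP; split; first by lra.
have <- : atan z^-1 = pi / 2 - atan z; last by rewrite atan_le// invr_gt0.
rewrite -[RHS]tanK; last by rewrite in_itv/=; apply/andP; split; lra.
congr atan; rewrite /tan sinB cosB sin_pihalf cos_pihalf.
rewrite !mul0r !mul1r add0r subr0.
by rewrite -[in LHS](atanK z) /tan invf_div.
Qed.

Lemma ln_le_sub1 z : 0 < z -> ln z <= z - 1.
Proof.
move=> z0; rewrite -[in leLHS](subrK 1 z) addrC le_ln1Dx//; lra.
Qed.

End arctangent.

(** Collects the errors of [row_sum]: freezing the denominator, telescoping by arctangents, the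
    tails [q], and the replacement of [s] by [t * r]. The bare [r ^- 2] is absorbed by [sg / r ^+ 2]
    because [sg] is at least [2^-1]. *)
Fact row_errors (R : realType) (W M r l sg q : R) :
  0 < r -> 2^-1 <= sg -> 0 <= l -> 0 <= W -> W <= M -> 1 <= M ->
  45 * W * (12 * l / r + 6 * sg / r ^+ 2) +
    (6 * 96 * M ^+ 2 / r ^+ 2 + (q + 4 * (4 * M * sg / r ^+ 2))) <=
  q + 30 * 100 * M ^+ 2 * (l / r + sg / r ^+ 2).
Proof.
move=> r0 sg0 l0 W0 WM M1.
have : (r ^+ 2)^-1 <= 2 * (sg / r ^+ 2).
  by rewrite mulrA ler_peMl ?invr_ge0 ?sqr_ge0//; lra.
have : 0 <= sg / r ^+ 2 by rewrite divr_ge0 ?sqr_ge0//; lra.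
have : 0 <= l / r by apply: divr_ge0 => //; exact: ltW.
have M2 : M <= M ^+ 2 by rewrite expr2 ler_peMl; lra.
move: r^-1 (r ^+ 2)^-1 => a b.
set x := l * a; set y := sg * b => x0 y0 zy.
have p1 : W * x <= M ^+ 2 * x by rewrite ler_wpM2r; lra.
have p2 : W * y <= M ^+ 2 * y by rewrite ler_wpM2r; lra.
have p3 : M * y <= M ^+ 2 * y by rewrite ler_wpM2r; lra.
have p4 : M ^+ 2 * b <= M ^+ 2 * (2 * y) by rewrite ler_wpM2l// sqr_ge0.
have p5 : 0 <= M ^+ 2 * x by rewrite mulr_ge0// sqr_ge0.
have p6 : 0 <= M ^+ 2 * y by rewrite mulr_ge0// sqr_ge0.
rewrite [leLHS](_ : _ = 45 * 12 * (W * x) + 45 * 6 * (W * y) + 6 * 96 * (M ^+ 2 * b) + q + 16 * (M * y)); last by rewrite /x /y; ring.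
rewrite (mulrCA _ 2) in p4; rewrite -(mulrA (30 * 100)) [M ^+ 2 * (x + y)]mulrDr.
move: p1 p2 p3 p4 p5 p6; move: (W * x) (W * y) (M ^+ 2 * b) (M * y) (M ^+ 2 * x) (M ^+ 2 * y) => z1 z2 z3 z4 z5 z6.
by clear; lra.
Qed.

(** * Sum of the resolvent along a row *)

Section scale.
Variables (R : realType) (w : R * R) (eps : R).
Hypothesis w0 : 0 < w2 w.
Hypothesis e01 : 0 < eps < 2^-1.

Let e0 : 0 < eps. Proof. by case/andP: e01. Qed.
Let eh : eps < 2^-1. Proof. by case/andP: e01. Qed.
Let e1 : 0 < eps < 1. Proof. by rewrite e0; have := eh; lra. Qed.
Let lam2 : R := lambda eps ^+ 2.
Let lam0 : 0 < lam2. Proof. exact: lambda2_gt0. Qed.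
Let N : R := eps^-1.
Let N2 : 2 < N. Proof. by rewrite -[2]invrK ltf_pV2 ?posrE. Qed.
Let N0 : 0 < N. Proof. by have := N2; lra. Qed.

(** As [lam2] is [1 / (2 * ln N)], it absorbs the logarithm of any quantity polynomial in the cutoff
    [N]. *)
Lemma lambda2_ln x k : 0 < x -> x <= N ^+ k -> lam2 * ln x <= k%:R / 2.
Proof.
move=> x0 xN; rewrite /lam2 lambda2E//.
have lN : ln (eps ^- 2) = 2 * ln N by rewrite -exprVn lnXn// mulr_natl.
have lN0 : 0 < ln N by rewrite ln_gt0//; have := N2; lra.
rewrite lN ler_pdivrMl ?mulr_gt0//.
have -> : 2 * ln N * (k%:R / 2) = ln N *+ k by rewrite -mulr_natr; field.
by rewrite -lnXn// ler_ln ?posrE// exprn_gt0.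
Qed.

Lemma lambda2_le1 : lam2 <= 1.
Proof.
rewrite /lam2 lambda2E// invf_le1 ?ln_epsV_gt0//.
have := @le_ln1Dx R (- 2^-1) ltac:(lra).
have -> : 1 + - 2^-1 = 2^-1 :> R by field.
rewrite lnV ?posrE// => h.
apply: (@le_trans _ _ (ln (2 ^+ 2))); first by rewrite lnXn// mulr2n; lra.
rewrite ler_ln ?posrE ?exprn_gt0// ?invr_gt0 ?exprn_gt0//.
by rewrite -exprVn ler_pXn2r ?nnegrE// ltW// N2.
Qed.

Definition geps (x : R) := G w (Leps eps x).

Lemma geps_ge0 x : 0 < x -> 0 <= geps x.
Proof. by move=> x0; apply: G_ge0 => //; apply: Leps_ge0. Qed.

Lemma geps_sub (x y : R) : 0 < x -> x <= y ->
  0 <= geps x - geps y <= lam2 * ln (y / x).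
Proof.
move=> x0 xy; have y0 := lt_le_trans x0 xy.
have /andP[L1 L2] := Leps_sub e1 x0 xy.
have ly0 := Leps_ge0 e1 y0; rewrite subr_ge0 in L1.
by have /andP[-> /=] := G_sub w0 ly0 L1; move/le_trans; apply.
Qed.

(** The argument of the logarithm is at most [1 + 4 * N ^+ 2 <= N ^+ 6], and [lam2] halves the
    exponent. *)
Lemma geps_le3 x : 4^-1 <= x -> geps x <= 3.
Proof.
move=> x4; have x0 : 0 < x by lra.
apply: (le_trans (G_le w0 (Leps_ge0 e1 x0))).
have -> : 3 = 6%:R / 2 :> R by field.
apply: lambda2_ln; first by rewrite ltr_pwDl// invr_ge0 mulr_ge0 ?sqr_ge0// ltW.
rewrite invfM -exprVn -/N.
have xV : x^-1 <= 4 by rewrite -[4]invrK lef_pV2 ?posrE//; lra.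
have z4 : 4 < N ^+ 2 by have := N2; nra.
apply: (@le_trans _ _ (1 + N ^+ 2 * 4)).
  by rewrite lerD2l ler_wpM2l ?sqr_ge0.
rewrite (_ : N ^+ 6 = (N ^+ 2) ^+ 3); last by rewrite -exprM.
by move: (N ^+ 2) z4 => z z4; nra.
Qed.

Section row.
Variables (beta b y : R).
Hypothesis beta4 : 4^-1 <= beta.
Hypothesis b0 : 0 <= b <= w2 w * beta.

(** The inverse of the resolvent in coordinates centred at the midpoint splitting: [(x, y)] stands
    for [l - p / 2], while [beta] and [b] collect what [p] and the spectator entries contribute. *)
Definition den (x : R) :=
  x ^+ 2 + y ^+ 2 + beta + ((w.1 * x + w.2 * y) ^+ 2 + b) * geps (x ^+ 2 + y ^+ 2 + beta).

Let sg : R := Num.sqrt beta.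
(** Comparable to the square root of [y ^+ 2 + beta], but affine in [|y|], so that consecutive rows
    have radii one apart and the column sum can telescope. *)
Let r : R := `|y| + sg.
Let a : R := geps (r ^+ 2).

Let bet0 : 0 < beta. Proof. by have := beta4; lra. Qed.

Let sg2 : sg ^+ 2 = beta.
Proof. by rewrite sqr_sqrtr// ltW. Qed.

Let sgh : 2^-1 <= sg.
Proof.
have -> : 2^-1 = Num.sqrt (2^-1 ^+ 2) :> R by rewrite sqrtr_sqr ger0_norm.
by rewrite ler_sqrt// (le_trans _ beta4)//; lra.
Qed.

Let rsg : sg <= r. Proof. by rewrite lerDr. Qed.
Let rh : 2^-1 <= r. Proof. exact: le_trans rsg. Qed.
Let a0 : 0 <= a. Proof. by apply: geps_ge0; rewrite exprn_gt0//; have := rh; lra. Qed.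
Let a3 : a <= 3. Proof. by apply: geps_le3; have := rh; nra. Qed.

Let rho (x : R) : R := r + `|x|.
Let h (x : R) : R := x ^+ 2 + y ^+ 2 + beta.

Let rho_h x : rho x ^+ 2 <= 3 * h x.
Proof.
rewrite /h -(real_normK (num_real x)) -(real_normK (num_real y)) -sg2 /rho /r.
move: (`|x|) (`|y|) sg => p q s.
have := sqr_ge0 (p - q); have := sqr_ge0 (p - s); have := sqr_ge0 (q - s); nra.
Qed.

Let h_rho x : h x <= rho x ^+ 2.
Proof.
rewrite /h -(real_normK (num_real x)) -(real_normK (num_real y)) -sg2 /rho /r.
have := normr_ge0 x; have := normr_ge0 y; have := sgh.
move: (`|x|) (`|y|) sg => p q s s0 q0 p0.
have : 0 <= p * q by apply: mulr_ge0.
have : 0 <= p * s by apply: mulr_ge0; lra.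
have : 0 <= q * s by apply: mulr_ge0; lra.
nra.
Qed.

Let r2_h x : r ^+ 2 <= 2 * h x.
Proof.
rewrite /h -(real_normK (num_real y)) -sg2 /r.
have := sqr_ge0 x; move: (`|y|) sg (x ^+ 2) => q s p p0.
have := sqr_ge0 (q - s); nra.
Qed.

Let rhor x : r <= rho x. Proof. by rewrite lerDl. Qed.

Let h4 x : 4^-1 <= h x.
Proof.
by rewrite (le_trans beta4)// lerDr addr_ge0// sqr_ge0.
Qed.

Let wdot2_le x : (w.1 * x + w.2 * y) ^+ 2 <= w2 w * h x.
Proof.
rewrite /w2 /h; have := sqr_ge0 (w.1 * y - w.2 * x).
have : 0 <= (w.1 ^+ 2 + w.2 ^+ 2) * beta by rewrite mulr_ge0 ?addr_ge0 ?sqr_ge0// ltW.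
nra.
Qed.

(** The logarithm of [rho x / r] is traded for a square root: after multiplication by [rho x ^- 2]
    this leaves the power [-3/2] of [rho x], which is summable along the row. *)
Let g_diff x : `|geps (h x) - a| <= lam2 * (5 * Num.sqrt (rho x / r)).
Proof.
have r0 : 0 < r by have := rh; lra.
have q1 : 1 <= rho x / r by rewrite ler_pdivlMr// mul1r.
have s1 : 1 <= Num.sqrt (rho x / r) by rewrite -[1]sqrtr1 ler_sqrt; lra.
have h0 : 0 < h x by have := h4 x; lra.
have r20 : 0 < r ^+ 2 by rewrite exprn_gt0.
have [hr|/ltW hr] := leP (h x) (r ^+ 2).
  have /andP[g1 g2] := geps_sub h0 hr; rewrite ger0_norm//.
  apply: (le_trans g2); rewrite ler_pM2l//.
  apply: (@le_trans _ _ 1); last by lra.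
  have t2 : r ^+ 2 / h x <= 2 by rewrite ler_pdivrMr.
  have d0 : 0 < r ^+ 2 / h x by rewrite divr_gt0.
  by have := ln_le_sub1 d0; lra.
have /andP[g1 g2] := geps_sub r20 hr; rewrite distrC ger0_norm//.
apply: (le_trans g2); rewrite ler_pM2l//.
set s := Num.sqrt _ in s1 *.
have s0 : 0 < s by lra.
have ss : s ^+ 2 = rho x / r by rewrite sqr_sqrtr//; lra.
apply: (@le_trans _ _ (ln (s ^+ 4))).
  rewrite ler_ln ?posrE ?divr_gt0 ?exprn_gt0//.
  rewrite (_ : s ^+ 4 = (s ^+ 2) ^+ 2); last by ring.
  by rewrite ss expr_div_n ler_pM2r ?invr_gt0 ?h_rho.
rewrite lnXn//; have := ln_le_sub1 s0.
by rewrite !mulrS mulr0n; lra.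
Qed.

(* [den] with the slowly varying factor [geps] frozen at its value [a] for the
   row and the lower order term [b * geps] dropped. *)
Definition frozen (x : R) := (h x + a * (w.1 * x + w.2 * y) ^+ 2)^-1.

(** Both denominators are at least [h x], so the error is their difference over [h x ^+ 2]. The
    variation of [geps] gives the first term; the dropped [b * geps] is at most [3 * w2 w * sg ^+ 2]
    and gives the second, through [sg <= r <= rho x]. *)
Let den_frozen x : `|(den x)^-1 - frozen x| <=
  45 * w2 w * (lam2 / Num.sqrt r * (rho x * Num.sqrt (rho x))^-1 + sg / r * rho x ^- 2).
Proof.
have r0 : 0 < r by have := rh; lra.
have rho0 : 0 < rho x by have := rhor x; lra.
have h0 : 0 < h x by have := h4 x; lra.
have q0 : 0 <= (w.1 * x + w.2 * y) ^+ 2 by rewrite sqr_ge0.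
have gh0 : 0 <= geps (h x) by exact: geps_ge0.
have gh3 : geps (h x) <= 3 by exact: geps_le3.
have [b00 bb] := andP b0.
rewrite /den /frozen -/(h x).
have qW := wdot2_le x; have gd := g_diff x; have hr := rho_h x.
move: q0 qW; set q := (_ + _) ^+ 2 => q0 qW.
set D := h x + (q + b) * _; set F := h x + a * q.
have DF : F - D = q * (a - geps (h x)) - b * geps (h x) by rewrite /D /F; ring.
have D0 : h x <= D by rewrite lerDl mulr_ge0// addr_ge0.
have F0 : h x <= F by rewrite lerDl mulr_ge0.
rewrite (_ : D^-1 - F^-1 = (F - D) / (D * F)); last by field; lra.
rewrite normrM (ger0_norm (_ : 0 <= (D * F)^-1)); last by rewrite invr_ge0 mulr_ge0; lra.
have hDF : (D * F)^-1 <= (h x ^+ 2)^-1.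
  by rewrite lef_pV2 ?posrE ?mulr_gt0 ?exprn_gt0//; [apply: ler_pM; lra|lra|lra].
have nDF : `|F - D| <= w2 w * h x * (lam2 * (5 * Num.sqrt (rho x / r))) + 3 * (w2 w * beta).
  rewrite DF; apply: (le_trans (ler_normB _ _)); rewrite (normrM q) (normrM b).
  rewrite (ger0_norm q0) (ger0_norm b00) (ger0_norm gh0) lerD//.
    by rewrite ler_pM// distrC.
  by rewrite mulrC ler_pM.
apply: (le_trans (ler_pM _ _ nDF hDF)) => //; first by rewrite invr_ge0 mulr_ge0; lra.
rewrite mulrDl [leRHS]mulrDr lerD//.
  rewrite sqrtrM; last by lra.
  rewrite sqrtrV; last by lra.
  set s := Num.sqrt (rho x); set t := Num.sqrt r.
  have s0 : 0 < s by rewrite sqrtr_gt0.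
  have t0 : 0 < t by rewrite sqrtr_gt0.
  have ss : s ^+ 2 = rho x by rewrite sqr_sqrtr// ltW.
  rewrite (_ : _ / _ = 5 * w2 w * lam2 / t * s * (h x)^-1); last by field; rewrite !gt_eqF.
  rewrite (_ : _ * (lam2 / t * _) = 5 * w2 w * lam2 / t * (9 / (rho x * s))); last by field; rewrite !gt_eqF.
  rewrite -mulrA ler_pM2l; last by apply: divr_gt0 => //; apply: mulr_gt0 => //; exact: mulr_gt0.
  rewrite ler_pdivrMr// mulrAC ler_pdivlMr ?mulr_gt0//.
  rewrite (_ : s * (rho x * s) = rho x ^+ 2); last by rewrite -ss; ring.
  by rewrite (le_trans hr)// ler_pM2r//; lra.
rewrite (_ : 3 * _ / _ = 3 * w2 w * (beta / h x ^+ 2)); last by field; lra.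
rewrite (_ : 45 * _ * _ = 3 * w2 w * (15 * (sg / r * rho x ^- 2))); last by ring.
rewrite ler_pM2l ?mulr_gt0// -sg2.
rewrite ler_pdivrMr ?exprn_gt0//.
rewrite (_ : _ * h x ^+ 2 = 15 * sg * h x ^+ 2 / (r * rho x ^+ 2)); last by field; lra.
rewrite ler_pdivlMr ?mulr_gt0 ?exprn_gt0//.
have sg0 : 0 < sg by have := sgh; lra.
rewrite (_ : sg ^+ 2 * _ = sg * (sg * r * rho x ^+ 2)); last by ring.
rewrite (_ : 15 * sg * _ = sg * (15 * h x ^+ 2)); last by ring.
rewrite ler_pM2l//.
have : (rho x ^+ 2) ^+ 2 <= (3 * h x) ^+ 2 by rewrite ler_pXn2r ?nnegrE ?sqr_ge0//; lra.
have : sg * r * rho x ^+ 2 <= rho x ^+ 2 * rho x ^+ 2.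
  rewrite ler_wpM2r ?sqr_ge0// expr2 ler_pM//; [lra|lra|].
  by rewrite (le_trans rsg).
rewrite -expr2; move: (h x) (rho x) => p1 p2; nra.
Qed.

Let sum_rho_pow32 c n : \sum_(i < n)
  (rho (i%:R - c) * Num.sqrt (rho (i%:R - c)))^-1 <= 12 / Num.sqrt r.
Proof.
have -> : 12 / Num.sqrt r = 2 * (6 / Num.sqrt r) by ring.
apply: (@sum_two_sided _ (fun t => (t * Num.sqrt t)^-1) c r n) => [i m ri im|m _].
  have i0 : 0 < i by have := rh; lra.
  have m0 : 0 < m by lra.
  rewrite lef_pV2 ?posrE ?mulr_gt0 ?sqrtr_gt0//.
  by rewrite ler_pM ?sqrtr_ge0// ?ler_sqrt//; lra.
by apply: sum_inv_pow32_le; exact: rh.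
Qed.

Let sum_rho_sqr c n : \sum_(i < n) rho (i%:R - c) ^- 2 <= 6 / r.
Proof.
have -> : 6 / r = 2 * (3 / r) by ring.
apply: (@sum_two_sided _ (fun t => t ^- 2) c r n) => [i m ri im|m _].
  have i0 : 0 < i by have := rh; lra.
  have m0 : 0 < m by lra.
  by rewrite lef_pV2 ?posrE ?exprn_gt0// ler_pXn2r// ?nnegrE; lra.
by apply: sum_inv_sqr_le; exact: rh.
Qed.

Let sum_den_frozen c n :
  `|\sum_(i < n) (den (i%:R - c))^-1 - \sum_(i < n) frozen (i%:R - c)|
  <= 45 * w2 w * (12 * lam2 / r + 6 * sg / r ^+ 2).
Proof.
have r0 : 0 < r by have := rh; lra.
rewrite -sumrB; apply: (le_trans (ler_norm_sum _ _ _)).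
apply: (le_trans (ler_sum _ (fun (i : 'I_n) _ => den_frozen (i%:R - c)))).
rewrite -mulr_sumr ler_pM2l ?mulr_gt0// big_split/= -!mulr_sumr lerD//.
  apply: (le_trans (ler_wpM2l _ (sum_rho_pow32 c n))).
    by rewrite divr_ge0 ?sqrtr_ge0// ltW.
  rewrite (_ : _ * (12 / _) = 12 * lam2 / (Num.sqrt r ^+ 2)).
    by rewrite sqr_sqrtr// ltW.
  by field; rewrite sqrtr_eq0 -ltNge.
apply: (le_trans (ler_wpM2l _ (sum_rho_sqr c n))).
  by rewrite divr_ge0//; [have := sgh; lra|lra].
by rewrite (_ : _ * (6 / r) = 6 * sg / r ^+ 2)//; field; lra.
Qed.

Let A : R := 1 + a * w.1 ^+ 2.
Let t : R := cbrt w (Leps eps (r ^+ 2)).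
Let s2 : R := t ^+ 2 * y ^+ 2 + A * beta.
Let s : R := Num.sqrt s2.
Let P (x : R) : R := A * x + a * w.1 * w.2 * y.
Let M : R := 1 + 3 * w2 w.

Let tE : t ^+ 2 = 1 + a * w2 w.
Proof.
have L0 : 0 <= Leps eps (r ^+ 2) by apply: Leps_ge0 => //; have := rh; nra.
by have := GE w0 L0; rewrite -/t -/a mulrC /a /geps => ->; ring.
Qed.

Let t1 : 1 <= t.
Proof. by apply: cbrt_ge1 => //; apply: Leps_ge0 => //; have := rh; nra. Qed.

Let A1 : 1 <= A.
Proof. by rewrite lerDl mulr_ge0 ?sqr_ge0. Qed.

Let At : A <= t ^+ 2.
Proof. by rewrite tE lerD2l ler_wpM2l// lerDl sqr_ge0. Qed.

Let tM : t ^+ 2 <= M.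
Proof. by rewrite tE lerD2l ler_wpM2r// ltW. Qed.

Let AM : A <= M. Proof. exact: le_trans tM. Qed.

Let frozenE x : frozen x = A / (P x ^+ 2 + s2).
Proof.
have A0 : A != 0 by have := A1; lra.
rewrite /frozen -[LHS]mul1r -(divff A0) -mulrA -invfM; congr (_ / _).
by rewrite /s2 tE /P /A /h /w2; ring.
Qed.

Let h_Ps x : h x <= P x ^+ 2 + s2.
Proof.
have -> : P x ^+ 2 + s2 = A * (h x + a * (w.1 * x + w.2 * y) ^+ 2).
  by rewrite /s2 tE /P /A /h /w2; ring.
have h0 : 0 <= h x by have := h4 x; lra.
have F0 : h x <= h x + a * (w.1 * x + w.2 * y) ^+ 2 by rewrite lerDl mulr_ge0 ?sqr_ge0.
apply: (le_trans F0); apply: ler_peMl => //; exact: le_trans F0.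
Qed.

Let s2_ge : r ^+ 2 <= 4 * s2.
Proof.
have := r2_h 0; rewrite /h expr0n/= add0r /s2 => rr; apply: (le_trans rr).
have := A1; have := At; have := sqr_ge0 y; have := bet0.
move: (y ^+ 2) (t ^+ 2) => z u b1 z0 u1 A1'; nra.
Qed.

Let s0 : 0 < s.
Proof. by rewrite sqrtr_gt0; have := s2_ge; have := rh; nra. Qed.

Let s_sqr : s ^+ 2 = s2.
Proof. by rewrite sqr_sqrtr//; have := s2_ge; have := rh; nra. Qed.

Let s_ge : r <= 2 * s.
Proof.
have h1 := rh; have h2 := s0.
rewrite -(@ler_pXn2r _ 2) ?nnegrE//; [|lra|lra].
by rewrite exprMn s_sqr; have := s2_ge; lra.
Qed.

(* [prim] is a primitive of [frozen], so that row sums telescope up to the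
   errors of [frozen_step]. *)
Definition prim (x : R) := atan (P x / s) / s.

(** By the mean value theorem the increment of [prim] is [frozen x'] for some [x'] in [[x, x + 1]].
    Over a unit step [frozen] varies by [O(rho x ^- 3)]; one power is given up for [r], the other
    two sum to [O(1 / r)] along the row. *)
Let frozen_step x : `|frozen x - (prim (x + 1) - prim x)| <= 96 * M ^+ 2 / r * rho x ^- 2.
Proof.
have A0 : 0 < A by have := A1; lra.
have ss0 := s0; have r0 : 0 < r by have := rh; lra.
have PA : P (x + 1) = P x + A by rewrite /P; ring.
have lt1 : P x / s < P (x + 1) / s by rewrite ltr_pM2r ?invr_gt0// PA ltrDl.
have [z /andP[z1 z2] e] := atan_sub lt1.
rewrite /prim -mulrBl e.
have -> : P (x + 1) / s - P x / s = A / s by rewrite PA; field; lra.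
pose xi := z * s; pose x' := (xi - a * w.1 * w.2 * y) / A.
have Px' : P x' = xi by rewrite /P /x'; field; lra.
have xx' : x <= x' <= x + 1.
  move: z1 z2; rewrite ltr_pdivrMr// ltr_pdivlMr// -/xi -Px' PA /P => z1 z2.
  by apply/andP; split; rewrite -(ler_pM2l A0); lra.
have [V0 U0] : 0 < P x' ^+ 2 + s2 /\ 0 < P x ^+ 2 + s2.
  by have := h_Ps x; have := h_Ps x'; have := h4 x; have := h4 x'; lra.
have -> : A / s / (1 + z ^+ 2) / s = A / (P x' ^+ 2 + s2).
  have D : 1 + z ^+ 2 != 0 by rewrite gt_eqF// ltr_pwDl ?sqr_ge0.
  have D2 : (z * s) ^+ 2 + s ^+ 2 != 0 by rewrite s_sqr -/xi -Px' gt_eqF.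
  rewrite Px' /xi -s_sqr; field.
  by rewrite D D2 gt_eqF.
rewrite frozenE.
have rr : rho x <= 3 * rho x'.
  have := ler_norm (x - x'); have := ler_normB x' (x' - x).
  rewrite subKr => hh; have : `|x' - x| <= 1 by rewrite ler_norml; lra.
  by have := rh; rewrite /rho; have := normr_ge0 x'; lra.
have rhoU : rho x ^+ 2 <= 3 * (P x ^+ 2 + s2).
  by apply: (le_trans (rho_h x)); rewrite ler_pM2l// h_Ps.
have rho0 : 0 < rho x by have := rhor x; lra.
have rhoV : rho x ^+ 2 <= 27 * (P x' ^+ 2 + s2).
  apply: (@le_trans _ _ ((3 * rho x') ^+ 2)); first by rewrite ler_pXn2r ?nnegrE//; lra.
  by have := rho_h x'; have := h_Ps x'; rewrite exprMn; lra.
have s20 : 0 <= s2 by rewrite -s_sqr sqr_ge0.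
have hxi : `|P x' - P x| <= A by rewrite ler_norml /P; nra.
move: (P x) (P x') (rho x) (rhor x) U0 V0 rhoU rhoV hxi rho0 => p q m rm U0 V0 hU hV pq m0.
rewrite (_ : _ - _ = A * ((q - p) * (q + p) / ((p ^+ 2 + s2) * (q ^+ 2 + s2)))); last by field; lra.
rewrite normrM (gtr0_norm A0) normrM normrM normfV (gtr0_norm (mulr_gt0 U0 V0)).
have hp : `|p| * m <= 2 * (p ^+ 2 + s2).
  by have := sqr_ge0 (`|p| - m); rewrite sqrrB (real_normK (num_real p)); lra.
have hq : `|q| * m <= 14 * (q ^+ 2 + s2).
  by have := sqr_ge0 (`|q| - m); rewrite sqrrB (real_normK (num_real q)); lra.
(* The constant is [14 * 3 + 2 * 27], from the bounds [hq], [hU], [hp], [hV]. *)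
have key : `|q + p| / ((p ^+ 2 + s2) * (q ^+ 2 + s2)) <= 96 / m ^+ 3.
  rewrite ler_pdivrMr ?mulr_gt0// mulrAC ler_pdivlMr ?exprn_gt0//.
  apply: (@le_trans _ _ ((`|q| + `|p|) * m ^+ 3)).
    by rewrite ler_pM2r ?exprn_gt0// ler_normD.
  rewrite (_ : _ * _ = (`|q| * m) * m ^+ 2 + (`|p| * m) * m ^+ 2); last by ring.
  move: (p ^+ 2 + s2) (q ^+ 2 + s2) U0 V0 hU hV hp hq => U V U0 V0 hU hV hp hq.
  have k1 : `|q| * m * m ^+ 2 <= 14 * V * (3 * U).
    by apply: ler_pM => //; rewrite ?sqr_ge0// mulr_ge0// ltW.
  have k2 : `|p| * m * m ^+ 2 <= 2 * U * (27 * V).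
    by apply: ler_pM => //; rewrite ?sqr_ge0// mulr_ge0// ltW.
  apply: (le_trans (lerD k1 k2)).
  by rewrite le_eqVlt; apply/orP; left; apply/eqP; ring.
have -> : 96 * M ^+ 2 / r * m ^- 2 = M * (M * (96 / (r * m ^+ 2))).
  by field; lra.
apply: ler_pM => //; [lra|by rewrite !mulr_ge0 ?normr_ge0// invr_ge0 mulr_ge0 ?ltW|].
rewrite -mulrA; apply: ler_pM => //.
- by rewrite mulr_ge0 ?normr_ge0// invr_ge0 mulr_ge0 ?ltW.
- exact: le_trans AM.
apply: (le_trans key); rewrite ler_pM2l// lef_pV2 ?posrE ?mulr_gt0 ?exprn_gt0//.
by rewrite (_ : m ^+ 3 = m * m ^+ 2) ?ler_pM2r ?exprn_gt0//; ring.
Qed.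

Let sum_frozen c n : `|\sum_(i < n) frozen (i%:R - c) - (prim (n%:R - c) - prim (- c))|
  <= 6 * 96 * M ^+ 2 / r ^+ 2.
Proof.
have r0 : 0 < r by have := rh; lra.
have M0 : 0 <= M ^+ 2 by rewrite sqr_ge0.
have := @sum_approx_telescope R (fun i => frozen (i%:R - c))
  (fun i => 96 * M ^+ 2 / r * rho (i%:R - c) ^- 2) (fun i => - prim (i%:R - c)) n.
rewrite sub0r !opprK (addrC (- prim (- c))) => step; apply: (le_trans (step _)).
  move=> i _; rewrite opprK (addrC (- prim _)) -natr1 addrAC; exact: frozen_step.
rewrite -mulr_sumr; apply: (le_trans (ler_wpM2l _ (sum_rho_sqr c n))).
  by apply: divr_ge0; [exact: mulr_ge0|exact: ltW].
by rewrite (_ : _ * (6 / r) = 6 * 96 * M ^+ 2 / r ^+ 2)//; field; lra.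
Qed.

(** As [pi / 2 - atan z <= z^-1], the division by [s] in [prim] makes each tail at most [1 / N'],
    whatever [s] is. *)
Let prim_tails (N' c : R) n : 0 < N' -> P (- c) <= - N' -> N' <= P (n%:R - c) ->
  `|prim (n%:R - c) - prim (- c) - pi / s| <= 2 / N'.
Proof.
move=> N'0 h1 h2; have ss0 := s0.
have tail p : N' <= p -> 0 <= (pi / 2 - atan (p / s)) / s <= N'^-1.
  move=> Np; have p0 : 0 < p by lra.
  have /andP[k1 k2] := pihalf_sub_atan (divr_gt0 p0 ss0).
  rewrite divr_ge0 ?(ltW ss0)//= ler_pdivrMr//; apply: (le_trans k2).
  by rewrite invf_div mulrC ler_pM2r// lef_pV2.
have /andP[k1 k2] := tail _ h2.
have /andP[k3 k4] : 0 <= (pi / 2 - atan (- P (- c) / s)) / s <= N'^-1 by apply: tail; lra.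
have e : prim (n%:R - c) - prim (- c) - pi / s =
  - ((pi / 2 - atan (P (n%:R - c) / s)) / s + (pi / 2 - atan (- P (- c) / s)) / s).
  by rewrite /prim mulNr atanN; field; lra.
rewrite e normrN ger0_norm; last by lra.
by rewrite mulr_natl mulr2n lerD.
Qed.

(** [s] and [t * r] share the leading part [t * |y|]: their squares differ by at most
    [2 * M * sg * r], while the denominator [s * (t * r) * (s + t * r)] is of order [r ^+ 3]. *)
Let inv_s_approx : `|s^-1 - (t * r)^-1| <= 4 * M * sg / r ^+ 2.
Proof.
have [r0 ss0 sr t1' sg0] : [/\ 0 < r, 0 < s, r <= 2 * s, 1 <= t & 0 < sg].
  by split; have := s_ge; have := rh; have := sgh; have := t1; lra.
have M1 : 1 <= M by have := A1; have := AM; lra.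
have id : (t * r) ^+ 2 - s ^+ 2 = t ^+ 2 * (2 * `|y| * sg) + (t ^+ 2 - A) * sg ^+ 2.
  by rewrite s_sqr /s2 sg2 -(real_normK (num_real y)) exprMn /r -sg2; ring.
have y0 := normr_ge0 y.
have ys : `|y| * sg <= sg * r by rewrite /r; nra.
have d0 : 0 <= (t * r) ^+ 2 - s ^+ 2.
  rewrite id; apply: addr_ge0; first by rewrite mulr_ge0 ?sqr_ge0// !mulr_ge0// ltW.
  by rewrite mulr_ge0 ?sqr_ge0// subr_ge0.
have d1 : (t * r) ^+ 2 - s ^+ 2 <= 2 * M * sg * r.
  rewrite id (_ : 2 * M * sg * r = M * (2 * `|y| * sg) + (2 * M) * sg ^+ 2); last by rewrite /r; ring.
  rewrite lerD// ler_wpM2r// ?sqr_ge0//; first by rewrite !mulr_ge0// ltW.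
  by have := A1; have := tM; lra.
have tr0 : r <= t * r by apply: ler_peMl => //; exact: ltW.
have -> : s^-1 - (t * r)^-1 = ((t * r) ^+ 2 - s ^+ 2) / (s * (t * r) * (s + t * r)).
  by field; lra.
have D : r ^+ 3 / 2 <= s * (t * r) * (s + t * r).
  have -> : r ^+ 3 / 2 = (r / 2) * r * r by field.
  have h1 : r / 2 * r <= s * (t * r) by apply: ler_pM; lra.
  by apply: ler_pM; [apply: mulr_ge0; lra|exact: ltW|exact: h1|lra].
have r30 : 0 < r ^+ 3 / 2 by rewrite divr_gt0 ?exprn_gt0.
rewrite ger0_norm; last by rewrite divr_ge0// (le_trans _ D)// ltW.
apply: (@le_trans _ _ (2 * M * sg * r / (r ^+ 3 / 2))).
  apply: ler_pM => //; last by rewrite lef_pV2// posrE (lt_le_trans r30).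
  by rewrite invr_ge0 (le_trans _ D)// ltW.
by rewrite (_ : _ / _ = 4 * M * sg / r ^+ 2)//; field; lra.
Qed.

(** The zero of [P] is shifted by the cross term [a * w.1 * w.2 * y], at most [3 * w2 w * |y|] in
    size; a row overlapping by that much on both sides reaches [-N'] and [N'] in the variable
    [P]. *)
Lemma row_sum (c : R) n (N' : R) : 0 < N' ->
  N' + 3 * w2 w * `|y| <= c -> N' + 3 * w2 w * `|y| <= n%:R - c ->
  `|\sum_(i < n) (den (i%:R - c))^-1 - pi / (cbrt w (Leps eps (r ^+ 2)) * r)|
  <= 2 / N' + (30 * 100 * M ^+ 2) * (lam2 / r + sg / r ^+ 2).
Proof.
move=> N'0 c1 c2; rewrite -/t.
have W0 := w0; have l0 := lam0.
have [r0 sg0 sgr] : [/\ 0 < r, 2^-1 <= sg & sg <= r] by have := rh; have := sgh; have := rsg; split; lra.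
have M1 : 1 <= M by have := A1; have := AM; lra.
have aw : `|a * w.1 * w.2 * y| <= 3 * w2 w * `|y|.
  rewrite normrM ler_wpM2r// -mulrA normrM (ger0_norm a0) ler_pM ?a3//.
  have := sqr_ge0 (w.1 - w.2); have := sqr_ge0 (w.1 + w.2); rewrite /w2 ler_norml.
  by have := sqr_ge0 w.1; have := sqr_ge0 w.2; rewrite sqrrB sqrrD; nra.
have /andP[aw1 aw2] : - (3 * w2 w * `|y|) <= a * w.1 * w.2 * y <= 3 * w2 w * `|y|.
  by rewrite -ler_norml.
have Wy : 0 <= 3 * w2 w * `|y| by rewrite mulr_ge0// mulr_ge0// ltW.
have AA := A1.
have P1 : P (- c) <= - N' by rewrite /P; nra.
have P2 : N' <= P (n%:R - c) by rewrite /P; nra.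
have e1' := sum_den_frozen c n; have e2 := sum_frozen c n.
have e3 := prim_tails N'0 P1 P2.
have e4 : `|pi / s - pi / (t * r)| <= 4 * (4 * M * sg / r ^+ 2).
  rewrite -mulrBr normrM ger0_norm ?pi_ge0// ler_pM ?pi_ge0 ?inv_s_approx//.
  by have := pihalf_lt2 R; lra.
set X := \sum_(i < n) _ in e1' *; set Y := \sum_(i < n) _ in e1' e2 *.
have : `|X - pi / (t * r)| <= `|X - Y| + (`|Y - (prim (n%:R - c) - prim (- c))| +
   (`|prim (n%:R - c) - prim (- c) - pi / s| + `|pi / s - pi / (t * r)|)).
  apply: (le_trans (ler_distD Y _ _)); rewrite lerD2l.
  apply: (le_trans (ler_distD (prim (n%:R - c) - prim (- c)) _ _)); rewrite lerD2l.
  exact: ler_distD.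
move/le_trans; apply; apply: (le_trans (lerD e1' (lerD e2 (lerD e3 e4)))).
by apply: row_errors => //; [exact: ltW|exact: ltW|rewrite /M; lra].
Qed.

End row.
End scale.

(** * Sum of the rows *)

Section column.
Variables (R : realType) (w : R * R) (eps : R).
Hypothesis w0 : 0 < w2 w.
Hypothesis e01 : 0 < eps < 2^-1.

Let e0 : 0 < eps. Proof. by case/andP: e01. Qed.
Let eh : eps < 2^-1. Proof. by case/andP: e01. Qed.
Let e1 : 0 < eps < 1. Proof. by rewrite e0; have := eh; lra. Qed.
Let lam2 : R := lambda eps ^+ 2.
Let lam0 : 0 < lam2. Proof. exact: lambda2_gt0. Qed.
Let N : R := eps^-1.
Let N2 : 2 < N. Proof. by rewrite -[2]invrK ltf_pV2 ?posrE. Qed.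
Let N0 : 0 < N. Proof. by have := N2; lra. Qed.
Let t (r : R) : R := cbrt w (Leps eps (r ^+ 2)).
Let g (x : R) : R := geps w eps x.

(* By [G_increment], the row sums [pi / (t r)] are nearly the increments of
   [geps] along [r ^+ 2], so that the column sum telescopes as well. *)
Let column_step (r : R) : 2^-1 <= r ->
  `|(t r * r)^-1 - pi / (2 * lam2) * (g (r ^+ 2) - g ((r + 1) ^+ 2))|
  <= (1 + 2 * w2 w) * r ^- 2 + eps.
Proof.
move=> r1; have r0 : 0 < r by lra.
have r20 : 0 < r ^+ 2 by rewrite exprn_gt0.
have rr : r ^+ 2 <= (r + 1) ^+ 2 by rewrite ler_pXn2r ?nnegrE//; lra.
have st := Leps_step e1 r1.
have /andP[d0 d1] := Leps_sub e1 r20 rr.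
have inc := G_increment w0 (Leps_ge0 e1 (lt_le_trans r20 rr)) (_ : _ <= Leps eps (r ^+ 2)).
rewrite subr_ge0 in d0; have {}inc := inc d0.
have L0 : 0 <= Leps eps (r ^+ 2) by exact: Leps_ge0.
have t1 := cbrt_ge1 w0 L0; have ll := lambda2_le1 e01; have l0 := lam0.
have W0 := w0.
rewrite /g /geps /t in t1 inc *; rewrite -/lam2 in d1 st ll *.
have d2 : Leps eps (r ^+ 2) - Leps eps ((r + 1) ^+ 2) <= 2 * lam2 / r.
  apply: (le_trans d1); rewrite (_ : 2 * lam2 / r = lam2 * (2 / r)); last by ring.
  rewrite ler_pM2l// -expr_div_n lnXn; last by rewrite divr_gt0//; lra.
  rewrite (_ : (r + 1) / r = 1 + r^-1); last by field; lra.
  have rV : 0 < r^-1 by rewrite invr_gt0.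
  by have := @le_ln1Dx R r^-1 ltac:(lra); rewrite mulr2n; lra.
move: d0 st inc d2 L0 t1 d1; rewrite -subr_ge0.
move: (cbrt _ _) (_ - Leps _ _) (G w _ - G w _) => u d dg d0 st inc d2 _ t1 _.
have a1 : `|(u * r)^-1 - d / (2 * lam2 * u)| <= r ^- 2 + eps.
  rewrite (_ : _ - _ = - (d - 2 * lam2 / r) / (2 * lam2 * u)); last by field; lra.
  have k0 : 0 < 2 * lam2 * u by rewrite mulr_gt0//; lra.
  rewrite normrM normrN normfV (gtr0_norm k0) ler_pdivrMr//.
  apply: (le_trans st); rewrite (_ : _ * (_ + _) = (r ^- 2 + eps) * (2 * lam2)); last by ring.
  have : 0 <= r ^- 2 + eps by rewrite addr_ge0 ?invr_ge0 ?ltW.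
  move: (r ^- 2 + eps) => q q0; rewrite ler_wpM2l// ler_peMr; lra.
have a2 : `|d / (2 * lam2 * u) - pi / (2 * lam2) * dg| <= 2 * w2 w * r ^- 2.
  rewrite (_ : _ - _ = (d / u - pi * dg) / (2 * lam2)); last by field; lra.
  have k0 : 0 < 2 * lam2 by lra.
  rewrite normrM normfV (gtr0_norm k0) ler_pdivrMr//.
  apply: (le_trans inc).
  apply: (@le_trans _ _ (w2 w * (2 * lam2 / r) ^+ 2)).
    by rewrite ler_pM2l// ler_pXn2r ?nnegrE//; lra.
  rewrite [leLHS](_ : _ = (4 * w2 w * r ^- 2 * lam2) * lam2); last by field; lra.
  rewrite [leRHS](_ : _ = (4 * w2 w * r ^- 2 * lam2) * 1); last by ring.
  rewrite ler_wpM2l// mulr_ge0 ?ltW// mulr_gt0// ?invr_gt0// mulr_gt0//.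
apply: (le_trans (ler_distD (d / (2 * lam2 * u)) _ _)).
by apply: (le_trans (lerD a1 a2)); lra.
Qed.

Let half_column (r0 : R) m : 2^-1 <= r0 ->
  `|\sum_(i < m) (t (r0 + i%:R) * (r0 + i%:R))^-1 -
    pi / (2 * lam2) * (g (r0 ^+ 2) - g ((r0 + m%:R) ^+ 2))|
  <= 6 * (1 + 2 * w2 w) + m%:R * eps.
Proof.
move=> r1; have W0 := w0.
have := @sum_approx_telescope R (fun i => (t (r0 + i%:R) * (r0 + i%:R))^-1)
  (fun i => (1 + 2 * w2 w) * (r0 + i%:R) ^- 2 + eps)
  (fun i => pi / (2 * lam2) * g ((r0 + i%:R) ^+ 2)) m.
rewrite addr0 -mulrBr => step; apply: (le_trans (step _)).
  move=> i _; rewrite -mulrBr -[i.+1%:R]natr1 addrA; apply: column_step.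
  by rewrite (le_trans r1)// lerDl.
rewrite big_split/= -mulr_sumr sumr_const card_ord -[eps *+ m]mulr_natl lerD2r.
rewrite mulrC ler_pM2r; last by lra.
apply: (le_trans (sum_inv_sqr_le m r1)).
by rewrite ler_pdivrMr; lra.
Qed.

Variable beta : R.
Hypothesis beta4 : 4^-1 <= beta.
Let sg : R := Num.sqrt beta.

Let bet0 : 0 < beta. Proof. by have := beta4; lra. Qed.
Let sg2 : sg ^+ 2 = beta. Proof. by rewrite sqr_sqrtr// ltW. Qed.

Let sgh : 2^-1 <= sg.
Proof.
have -> : 2^-1 = Num.sqrt (2^-1 ^+ 2) :> R by rewrite sqrtr_sqr ger0_norm.
by rewrite ler_sqrt// (le_trans _ beta4)//; lra.
Qed.

(** Both ends of the telescoped sum are off by [4 * lam2]: at the far end [eps * r] is at least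
    [2^-1], so [geps] itself is that small; at the near end [r0 / sg <= 3] bounds the change of the
    logarithm. The factor [pi / (2 * lam2)] turns this into a constant. *)
Let half_column_limit (r0 : R) m : sg <= r0 -> r0 <= sg + 1 -> N / 2 <= r0 + m%:R ->
  `|\sum_(i < m) (t (r0 + i%:R) * (r0 + i%:R))^-1 - pi / (2 * lam2) * g beta|
  <= 6 * (1 + 2 * w2 w) + m%:R * eps + 16.
Proof.
move=> sr rs rm; have s1 := sgh.
have rh : 2^-1 <= r0 by lra.
have l0 := lam0; have NN := N0.
have p0 : 0 < r0 by lra.
have e : `|pi / (2 * lam2) * (g (r0 ^+ 2) - g ((r0 + m%:R) ^+ 2)) - pi / (2 * lam2) * g beta| <= 16.
  rewrite -mulrBr normrM ger0_norm; last by rewrite divr_ge0 ?pi_ge0//; lra.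
  have x0 : 0 < r0 + m%:R by rewrite ltr_wpDr.
  have g1 : 0 <= g ((r0 + m%:R) ^+ 2) <= 4 * lam2.
    rewrite /g geps_ge0 ?exprn_gt0//=.
    have L0 := Leps_ge0 e1 (exprn_gt0 2 x0).
    apply: (le_trans (G_le w0 L0)).
    apply: (le_trans (Leps_le e1 (exprn_gt0 2 x0))).
    rewrite -/lam2 mulrC ler_pM2r// -exprMn -[4]invrK lef_pV2 ?posrE ?exprn_gt0 ?mulr_gt0//.
    have : 2^-1 <= eps * (r0 + m%:R).
      rewrite mulrC -ler_pdivrMr//; apply: le_trans rm.
      by rewrite /N mulrC.
    by move: (eps * _) => z z1; nra.
  have g2 : 0 <= g beta - g (r0 ^+ 2) <= 4 * lam2.
    have br : beta <= r0 ^+ 2 by rewrite -sg2 ler_pXn2r ?nnegrE//; lra.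
    have /andP[h1 h2] := geps_sub w0 e01 bet0 br; rewrite /g h1/=.
    apply: (le_trans h2); rewrite -/lam2 mulrC ler_pM2r//.
    have ss0 : 0 < sg by lra.
    rewrite -sg2 -expr_div_n lnXn ?divr_gt0//.
    have := ln_le_sub1 (divr_gt0 p0 ss0).
    have : r0 / sg <= 3 by rewrite ler_pdivrMr//; lra.
    by rewrite mulr2n; lra.
  have pp : pi <= 4 :> R by have := pihalf_lt2 R; lra.
  apply: (@le_trans _ _ (4 / (2 * lam2) * (8 * lam2))); last by rewrite le_eqVlt; apply/orP; left; apply/eqP; field; lra.
  apply: ler_pM; rewrite ?divr_ge0 ?pi_ge0//; [lra| |].
    by rewrite ler_pM2r// invr_gt0; lra.
  by move: g1 g2 => /andP[? ?] /andP[? ?]; rewrite ler_norml; apply/andP; split; lra.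
apply: (le_trans (ler_distD (pi / (2 * lam2) * (g (r0 ^+ 2) - g ((r0 + m%:R) ^+ 2))) _ _)).
exact: (lerD (half_column m rh) e).
Qed.

Let column_sum (c : R) n : N / 2 <= c -> N / 2 <= n%:R - c ->
  `|\sum_(j < n) (t (`|j%:R - c| + sg) * (`|j%:R - c| + sg))^-1 - pi / lam2 * g beta|
  <= 12 * (1 + 2 * w2 w) + n%:R * eps + 32.
Proof.
move=> c1 c2; have NN := N2; have l0 := lam0; have s1 := sgh.
have [m [mn h1 h2]] := split_at c n.
have m0 : (0 < m)%N.
  rewrite lt0n; apply/eqP => m0; have := h2 0%N; rewrite m0 leq0n/=.
  have n0 : (0 < n)%N by rewrite -(ltr_nat R); lra.
  by move=> /(_ n0); lra.
have m1 : (m < n)%N.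
  rewrite ltn_neqAle mn andbT; apply/eqP => m1; have := h1 n.-1.
  rewrite m1 ltn_predL -m1 m0 => /(_ isT).
  have : n%:R = n.-1%:R + 1 :> R by rewrite natr1 prednK// -m1.
  by rewrite m1; lra.
have cm : c <= m%:R by apply: h2; rewrite leqnn.
have mc : m%:R - 1 < c.
  have := h1 m.-1; rewrite ltn_predL => /(_ m0).
  by have : m%:R = m.-1%:R + 1 :> R; [rewrite natr1 prednK|lra].
pose F (j : nat) : R := (t (`|j%:R - c| + sg) * (`|j%:R - c| + sg))^-1.
have e1' : \sum_(j < m) F j = \sum_(i < m) (t (c - (m%:R - 1) + sg + i%:R) * (c - (m%:R - 1) + sg + i%:R))^-1.
  rewrite -(big_mkord xpredT F) big_nat_rev/= add0n big_mkord.
  apply: eq_bigr => i _; rewrite /F.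
  have ic : `|(m - i.+1)%:R - c| = c - (m%:R - 1) + i%:R.
    rewrite natrB// distrC ger0_norm; first by rewrite -natr1; ring.
    by rewrite -natr1; have := ler0n R i; lra.
  by rewrite ic addrAC.
have e2' : \sum_(m <= j < n) F j = \sum_(i < n - m) (t (m%:R - c + sg + i%:R) * (m%:R - c + sg + i%:R))^-1.
  rewrite -{1}[m]add0n big_addn big_mkord.
  apply: eq_bigr => i _; rewrite /F.
  have ic : `|(i + m)%:R - c| = m%:R - c + i%:R.
    by rewrite natrD ger0_norm; [ring|have := ler0n R i; lra].
  by rewrite ic addrAC.
rewrite -(big_mkord xpredT F) (@big_cat_nat _ _ _ m)//= big_mkord e1' e2'.
(* The integers [m - 1] and [m] enclose [c], so both halves start within one of [sg], and each
   yields half of the limit. *)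
have k1 := @half_column_limit (c - (m%:R - 1) + sg) m ltac:(lra) ltac:(lra) ltac:(lra).
have k2 := @half_column_limit (m%:R - c + sg) (n - m)%N ltac:(lra) ltac:(lra).
have nm : (n - m)%:R = n%:R - m%:R :> R by rewrite natrB.
have {}k2 := k2 ltac:(rewrite nm; lra).
have -> : pi / lam2 * g beta = pi / (2 * lam2) * g beta + pi / (2 * lam2) * g beta by field; lra.
have aux (x y q : R) : x + y - (q + q) = (x - q) + (y - q) by ring.
rewrite aux; apply: (le_trans (ler_normD _ _)).
by apply: (le_trans (lerD k1 k2)); rewrite nm; lra.
Qed.

(** Of the row errors, [2 / N] is summed over at most [8 * N] rows, [lam2 / r] gives [lam2] times a
    logarithm of the cutoff, and [sg / r ^+ 2] gives a constant. The margin [24 * w2 w * N] is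
    [3 * w2 w * |y|] for the largest possible [|y|], at most [8 * N]. *)
Lemma lattice_sum b (c1 c2 : R) n1 n2 : 0 <= b <= w2 w * beta ->
  N / 2 <= c2 -> N / 2 <= n2%:R - c2 -> n2%:R <= 8 * N ->
  N + 24 * w2 w * N <= c1 -> N + 24 * w2 w * N <= n1%:R - c1 ->
  `|\sum_(j < n2) \sum_(i < n1) (den w eps beta b (j%:R - c2) (i%:R - c1))^-1 -
    pi ^+ 2 / lam2 * g beta| <= 30 * 100 * 30 * (1 + 3 * w2 w) ^+ 2.
Proof.
move=> b0 c21 c22 n2N c11 c12; have NN := N0; have l0 := lam0; have W0 := w0.
set M := 1 + 3 * w2 w.
have row (j : 'I_n2) := @row_sum R w eps w0 e01 beta b (j%:R - c2) beta4 b0 c1 n1 N NN.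
have yb (j : 'I_n2) : `|j%:R - c2| <= 8 * N.
  have := ltn_ord j; rewrite -(ltr_nat R) => jn; have := ler0n R j.
  by rewrite ler_norml => j0; apply/andP; split; lra.
have Wyb (j : 'I_n2) : 3 * w2 w * `|j%:R - c2| <= 24 * w2 w * N.
  rewrite (_ : 24 * w2 w * N = 3 * w2 w * (8 * N)); last by ring.
  by rewrite ler_wpM2l ?yb// mulr_ge0// ltW.
have {}row j := row j ltac:(have := Wyb j; lra) ltac:(have := Wyb j; lra).
have col := column_sum c21 c22.
set S := \sum_(j < n2) (_)^-1 in col.
have pp : pi <= 4 :> R by have := pihalf_lt2 R; lra.
have p0 : 0 <= pi :> R := pi_ge0 R.
have c3 : `|pi * S - pi ^+ 2 / lam2 * g beta| <= 4 * (12 * (1 + 2 * w2 w) + n2%:R * eps + 32).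
  have -> : pi * S - pi ^+ 2 / lam2 * g beta = pi * (S - pi / lam2 * g beta) by ring.
  by rewrite normrM (ger0_norm p0) ler_pM.
apply: (le_trans (ler_distD (pi * S) _ _)).
have n2e : n2%:R * eps <= 8.
  by rewrite -ler_pdivlMr.
have r1 : `|\sum_(j < n2) \sum_(i < n1) (den w eps beta b (j%:R - c2) (i%:R - c1))^-1 - pi * S|
   <= 16 + 30 * 100 * M ^+ 2 * 24.
  rewrite /S mulr_sumr -sumrB; apply: (le_trans (ler_norm_sum _ _ _)).
  apply: (le_trans (ler_sum _ (fun (j : 'I_n2) _ => row j))).
  rewrite big_split/= sumr_const card_ord -mulr_sumr lerD//.
    by rewrite -[_ *+ n2]mulr_natl /N invrK; move: n2e; lra.
  apply: ler_wpM2l; first by apply: mulr_ge0; rewrite ?sqr_ge0 // mulr_ge0.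
  rewrite big_split/= -!mulr_sumr.
  have s1 := sgh.
  have q1 : \sum_(j < n2) (`|j%:R - c2| + sg) ^- 2 <= 2 * (3 / sg).
    have := @sum_two_sided R (fun x => x ^- 2) c2 sg n2 (3 / sg).
    under eq_bigr do rewrite addrC.
    apply=> [i m ri im|m _]; last exact: sum_inv_sqr_le.
    have i0 : 0 < i by lra.
    have m0 : 0 < m by lra.
    by rewrite lef_pV2 ?posrE ?exprn_gt0// ler_pXn2r// ?nnegrE; lra.
  have n1' : 1 <= n2%:R :> R by have := N2; lra.
  have q2 : \sum_(j < n2) (`|j%:R - c2| + sg)^-1 <= 2 * (3 * ln ((sg + n2%:R) / sg)).
    have := @sum_two_sided R (fun x => x^-1) c2 sg n2 (3 * ln ((sg + n2%:R) / sg)).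
    under eq_bigr do rewrite addrC.
    apply=> [i m ri im|m mn].
      by rewrite lef_pV2 ?posrE; lra.
    apply: (le_trans (sum_inv_le m s1)); rewrite ler_pM2l//.
    have m0 := ler0n R m; have mn' : m%:R <= n2%:R :> R by rewrite ler_nat.
    have sg0 : 0 < sg by lra.
    by rewrite ler_ln ?posrE ?divr_gt0 ?ler_pM2r ?invr_gt0//; lra.
  have q3 : lam2 * ln ((sg + n2%:R) / sg) <= 3.
    have -> : 3 = 6%:R / 2 :> R by field.
    have sg0 : 0 < sg by lra.
    apply: (lambda2_ln e01); first by rewrite divr_gt0//; lra.
    rewrite ler_pdivrMr//.
    have h1 : 2 * (n2%:R + 1) <= N ^+ 6.
      apply: (@le_trans _ _ (2 ^+ 5 * N)); first by have := N2; lra.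
      rewrite (exprSr _ 5) ler_pM2r// ler_pXn2r ?nnegrE ?ltW//.
    have : 2 * (n2%:R + 1) * sg <= N ^+ 6 * sg by rewrite ler_pM2r.
    by move: (N ^+ 6) => z; nra.
  have q4 : sg * (2 * (3 / sg)) <= 6 by rewrite le_eqVlt; apply/orP; left; apply/eqP; field; lra.
  have q5 := ler_wpM2l (ltW l0) q2.
  have q6 : sg * _ <= _ := ler_wpM2l (le_trans (ltac:(by rewrite invr_ge0) : 0 <= 2^-1) s1) q1.
  rewrite -/lam2 -/sg.
  have q7 : lam2 * (2 * (3 * ln ((sg + n2%:R) / sg))) <= 18.
    rewrite (_ : _ * _ = 6 * (lam2 * ln ((sg + n2%:R) / sg))); last by ring.
    by move: q3; move: (lam2 * _) => z; lra.
  apply: (@le_trans _ _ (18 + 6)); last by lra.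
  by rewrite lerD// ?(le_trans q5 q7) ?(le_trans q6 q4).
apply: (le_trans (lerD r1 c3)).
have M1 : 1 <= M by rewrite /M; lra.
have MM : M <= M ^+ 2 by rewrite expr2 ler_peMl; lra.
by move: n2e MM M1; rewrite /M; move: (_ ^+ 2) => z; lra.
Qed.

End column.

(** * Finite boxes of frequencies *)

Section box.

Definition box (m1 m2 : nat) : seq Z2 :=
  [seq (i%:Z - m1%:Z, j%:Z - m2%:Z) | j <- iota 0 (2 * m2).+1, i <- iota 0 (2 * m1).+1].

Lemma box_uniq m1 m2 : uniq (box m1 m2).
Proof.
apply: allpairs_uniq; rewrite ?iota_uniq// => -[j i] [j' i'] _ _ /= [].
by move=> /addIr[->] /addIr[->].
Qed.

Lemma mem_box m1 m2 l : (`|l.1| <= m1)%N -> (`|l.2| <= m2)%N -> l \in box m1 m2.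
Proof.
case: l => x y; rewrite [(x, y).1]/= [(x, y).2]/= => xm ym; apply/allpairsP.
exists (absz (y + m2%:Z), absz (x + m1%:Z)); rewrite !mem_iota ![(_, _).1]/= ![(_, _).2]/=.
by split; [lia|lia|congr pair; lia].
Qed.

Lemma size_box m1 m2 : size (box m1 m2) = ((2 * m2).+1 * (2 * m1).+1)%N.
Proof. by rewrite size_allpairs !size_iota. Qed.

Lemma sum_box (V : nmodType) (F : Z2 -> V) m1 m2 :
  \sum_(l <- box m1 m2) F l =
  \sum_(j < (2 * m2).+1) \sum_(i < (2 * m1).+1) F (i%:Z - m1%:Z, j%:Z - m2%:Z).
Proof.
rewrite /box big_allpairs_dep/=.
rewrite -(big_mkord xpredT (fun j => \sum_(i < (2 * m1).+1) F (i%:Z - m1%:Z, j%:Z - m2%:Z))).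
rewrite /index_iota subn0; apply: eq_bigr => j _.
by rewrite -(big_mkord xpredT (fun i => F (i%:Z - m1%:Z, j%:Z - m2%:Z))) /index_iota subn0.
Qed.

Lemma esum_box (R : realType) (F : Z2 -> R) m1 m2 : (forall l, 0 <= F l) ->
  (forall l, F l != 0 -> l \in box m1 m2) ->
  (\esum_(l in [set: Z2]) (F l)%:E)%E = (\sum_(l <- box m1 m2) F l)%:E.
Proof.
move=> F0 Fs; have bu := box_uniq m1 m2.
transitivity (\esum_(l in [set` box m1 m2]) (F l)%:E)%E.
  rewrite [RHS]esum_mkcond; apply: eq_esum => l _.
  case: ifPn => //; rewrite notin_setE/= => /negP lb.
  by congr EFin; apply/eqP; apply: contraNT lb => /Fs.
rewrite -[X in esum X _]set_mem_set esum_fset; last first.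
- by move=> i _; rewrite lee_fin.
- by rewrite set_mem_set; exact: finite_seq.
by rewrite set_mem_set -fsbig_seq// sumEFin.
Qed.

Lemma sum_indicator_le (R : realType) (s : seq Z2) (a : Z2) : uniq s ->
  \sum_(l <- s) (l == a)%:R <= 1 :> R.
Proof.
move=> us; rewrite -natr_sum (_ : (\sum_(l <- s) _)%N = count_mem a s).
  by rewrite count_uniq_mem// lern1 leq_b1.
by rewrite -sum1_count [RHS]big_mkcond; apply: eq_bigr => l _ /=; case: (l == a).
Qed.

End box.

Lemma cutoffE (R : realType) (eps : R) (l : Z2) : 0 < eps ->
  cutoff eps l = (l != 0) && (norm2 R l <= eps ^- 2).
Proof.
move=> e0; have n0 : 0 <= norm2 R l by rewrite addr_ge0 ?sqr_ge0.
rewrite /cutoff pmulr_rgt0// sqrtr_gt0; congr (_ && _).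
  rewrite lt0r n0 andbT /norm2 paddr_eq0 ?sqr_ge0// !sqrf_eq0 !intr_eq0.
  by case: l {n0}.
rewrite mulrC -ler_pdivlMr// mul1r.
have -> : eps^-1 = Num.sqrt (eps ^- 2).
  by rewrite -exprVn sqrtr_sqr gtr0_norm// invr_gt0.
by rewrite ler_sqrt// invr_ge0 exprn_ge0// ltW.
Qed.

Lemma norm2_ge1 (R : realType) (l : Z2) : l != 0 -> 1 <= norm2 R l.
Proof.
case: l => x y; rewrite /norm2 /= => xy0.
rewrite -!rmorphXn -rmorphD/= ler1z.
have : (x != 0) || (y != 0) by rewrite -negb_and; apply: contra xy0 => /andP[/eqP-> /eqP->].
by move=> /orP[]; nia.
Qed.

Lemma norm2_ge0 (R : realType) (l : Z2) : 0 <= norm2 R l.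
Proof. by rewrite addr_ge0 ?sqr_ge0. Qed.

Lemma wdot_le (R : realType) (w : R * R) (l : Z2) : wdot w l ^+ 2 <= w2 w * norm2 R l.
Proof.
rewrite /wdot /norm2 /w2; move: (l.1%:~R : R) (l.2%:~R : R) => x y.
by have := sqr_ge0 (w.1 * y - w.2 * x); nra.
Qed.

(** * The sum over the splittings of one momentum *)

Section resolvent_sum.
Variables (R : realType) (w : R * R).
Hypothesis w0 : 0 < w2 w.

(* The inverse of the resolvent at [l :: (p - l) :: K], for
   [kappa = - L0 K] and [omega = - L0w K]. *)
Definition pair_den (eps kappa omega : R) (p l : Z2) : R :=
  let h := 2^-1 * (norm2 R l + norm2 R (p - l)) + kappa in
  h + (2^-1 * (wdot w l ^+ 2 + wdot w (p - l) ^+ 2) + omega) * geps w eps h.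

Definition pair_sum_term (eps kappa omega : R) (p l : Z2) : R :=
  (J eps l (p - l))%:R / pair_den eps kappa omega p l.

Section fixed_momentum.
Variables (eps kappa omega : R) (p : Z2).
Hypotheses (e01 : 0 < eps < 1) (kappa0 : 0 <= kappa).
Hypotheses (omega0 : 0 <= omega) (omegaK : omega <= w2 w * kappa) (p0 : p != 0).

Let e0 : 0 < eps. Proof. by case/andP: e01. Qed.
Let N : R := eps^-1.
Let N1 : 1 < N. Proof. by rewrite -[1]invr1 ltf_pV2 ?posrE//; case/andP: e01. Qed.
(** [beta] is the energy of the midpoint splitting, where the lattice sum is computed; [alpha] is
    the energy [- L0] of the merged frequency, where [Geps] is evaluated. As
    [beta <= alpha <= 2 * beta], the two values of [geps] differ by at most [lam2]. *)
Let beta : R := 4^-1 * norm2 R p + kappa.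
Let alpha : R := 2^-1 * norm2 R p + kappa.
Let np1 : 1 <= norm2 R p. Proof. exact: norm2_ge1. Qed.

Let JE l : J eps l (p - l) =
  [&& l != 0, l != p, norm2 R l <= N ^+ 2, norm2 R (p - l) <= N ^+ 2 & norm2 R p <= N ^+ 2].
Proof.
rewrite /J (addrC l) subrK !cutoffE// p0/= subr_eq0 (eq_sym p l) -exprVn -/N.
by rewrite -!andbA; do !bool_congr.
Qed.

Let g_ge0 (x : R) : 0 < x -> 0 <= geps w eps x.
Proof. by move=> x0; apply: G_ge0 => //; apply: Leps_ge0. Qed.

Let term_ge0 l : 0 <= pair_sum_term eps kappa omega p l.
Proof.
rewrite divr_ge0// /pair_den.
have h0 : 0 <= 2^-1 * (norm2 R l + norm2 R (p - l)) + kappa.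
  by have := norm2_ge0 R l; have := norm2_ge0 R (p - l); have := kappa0; lra.
have : norm2 R p <= 2 * (norm2 R l + norm2 R (p - l)).
  have : p = l + (p - l) by rewrite addrC subrK.
  move: (p - l) => m ->; rewrite /norm2 /= !intrD.
  move: (l.1%:~R : R) (l.2%:~R : R) (m.1%:~R : R) (m.2%:~R : R) => x y x' y'.
  by have := sqr_ge0 (x - x'); have := sqr_ge0 (y - y'); nra.
move=> h1; apply: addr_ge0 => //; apply: mulr_ge0.
  by rewrite addr_ge0// mulr_ge0// addr_ge0 ?sqr_ge0.
by apply: g_ge0; have := np1; have := kappa0; lra.
Qed.

Let support M1 M2 : N <= M1%:R -> N <= M2%:R ->
  forall l, pair_sum_term eps kappa omega p l != 0 -> l \in box M1 M2.
Proof.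
move=> NM1 NM2 l; rewrite /pair_sum_term JE; case: (boolP (_ && _)) => [|]; last by rewrite mul0r eqxx.
move=> /and5P[_ _ lN _ _] _.
have bnd (x : int) (m : nat) : N <= m%:R -> x%:~R ^+ 2 <= N ^+ 2 :> R -> (`|x| <= m)%N.
  move=> Nm xN; rewrite -(ler_nat R) natr_absz intr_norm; apply: le_trans Nm.
  rewrite -(@ler_pXn2r _ 2) ?nnegrE ?normr_ge0 ?(le_trans _ (ltW N1))//.
  by rewrite real_normK ?num_real.
by apply: mem_box; apply: bnd => //; apply: le_trans lN; rewrite ?lerDl ?lerDr sqr_ge0.
Qed.

Let limit : R := pi ^+ 2 / lambda eps ^+ 2 * geps w eps alpha.

(** From [ln (1 + z) <= z] the factors [lambda] cancel. This bound serves the regimes in which no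
    asymptotics is required. *)
Let limit_le : 0 <= limit <= 16 * (eps ^- 2 / alpha).
Proof.
have a0 : 0 < alpha by rewrite /alpha; have := np1; have := kappa0; lra.
have l0 := lambda2_gt0 e01.
rewrite /limit mulr_ge0 ?g_ge0// ?divr_ge0 ?sqr_ge0//=.
have p4 : pi ^+ 2 <= 16 :> R by have := pihalf_lt2 R; have := pi_gt0 R; nra.
rewrite -mulrA; apply: ler_pM => //; rewrite ?sqr_ge0//.
  by rewrite mulr_ge0 ?g_ge0// invr_ge0 ltW.
rewrite ler_pdivrMl//; apply: (le_trans (G_le w0 (Leps_ge0 e01 a0))).
by apply: (le_trans (Leps_le e01 a0)); rewrite invfM.
Qed.

(** With [N <= 2] at most the 25 frequencies of a fixed box contribute, each at most [1], and the
    limit is bounded by [limit_le] although [lambda] is unbounded as [eps] tends to [1]. *)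
Let large_eps : 2^-1 <= eps ->
  exists s : R, (\esum_(l in [set: Z2]) (pair_sum_term eps kappa omega p l)%:E = s%:E)%E /\
    `|s - limit| <= 25 + 32 * 4.
Proof.
move=> eh.
have N2 : N <= 2 by rewrite /N -[2]invrK lef_pV2 ?posrE.
rewrite (esum_box term_ge0 (@support 2 2 N2 N2)); eexists; split; first by [].
have a0 : 2^-1 <= alpha by rewrite /alpha; have := np1; have := kappa0; lra.
have /andP[l1 l2] := limit_le.
have l3 : limit <= 32 * 4.
  apply: (le_trans l2); rewrite (_ : 32 * 4 = 16 * (4 * 2)); last by ring.
  rewrite ler_pM2l//; apply: ler_pM; rewrite ?invr_ge0 ?exprn_ge0 ?(ltW e0)//; first by lra.
    by rewrite -exprVn -/N; have := N1; nra.
  by rewrite -[2]invrK lef_pV2 ?posrE//; lra.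
set s := \sum_(l <- _) _.
have s0 : 0 <= s by apply: sumr_ge0.
have s1 : s <= 25.
  apply: (@le_trans _ _ (\sum_(l <- box 2 2) 1)); last first.
    by rewrite big_const_seq count_predT size_box iter_addr_0.
  apply: ler_sum => l _; rewrite /pair_sum_term JE.
  case: (boolP (_ && _)) => [/and5P[l0 lp _ _ _]|_]; last by rewrite mul0r.
  have n1 := norm2_ge1 R l0.
  have n2 : 1 <= norm2 R (p - l) by apply: norm2_ge1; rewrite subr_eq0 eq_sym.
  have h1 : 1 <= 2^-1 * (norm2 R l + norm2 R (p - l)) + kappa by have := kappa0; lra.
  rewrite mul1r invf_le1 /pair_den.
    rewrite (le_trans h1)// lerDl mulr_ge0 ?g_ge0//; last by lra.
    by rewrite addr_ge0// mulr_ge0// addr_ge0 ?sqr_ge0.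
  rewrite ltr_wpDr//; last by lra.
  by rewrite mulr_ge0 ?g_ge0//; [rewrite addr_ge0// mulr_ge0// addr_ge0 ?sqr_ge0|lra].
by rewrite ler_norml; apply/andP; split; lra.
Qed.

(** The cutoff also acts on the sum [p] of the two momenta, so no splitting survives, and [limit_le]
    is a constant because [eps ^+ 2 * alpha] is at least [2^-1]. *)
Let large_momentum : N ^+ 2 < norm2 R p ->
  exists s : R, (\esum_(l in [set: Z2]) (pair_sum_term eps kappa omega p l)%:E = s%:E)%E /\
    `|s - limit| <= 32.
Proof.
move=> pN; exists 0; split.
  apply: esum1 => l _; rewrite /pair_sum_term JE (leNgt (norm2 R p)) pN /= !andbF.
  by rewrite mul0r.
have /andP[l1 l2] := limit_le.
rewrite sub0r normrN ger0_norm//; apply: (le_trans l2).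
rewrite (_ : 32 = 16 * 2); last by ring.
rewrite ler_pM2l// ler_pdivrMr; last by rewrite /alpha; have := np1; have := kappa0; lra.
by rewrite -exprVn -/N /alpha; have := kappa0; lra.
Qed.

Section small_eps.
Hypotheses (eh : eps < 2^-1) (pN : norm2 R p <= N ^+ 2).

Let e0h : 0 < eps < 2^-1. Proof. by rewrite e0. Qed.
Let N2 : 2 < N. Proof. by rewrite -[2]invrK ltf_pV2 ?posrE. Qed.
Let beta4 : 4^-1 <= beta. Proof. by rewrite /beta; have := np1; have := kappa0; lra. Qed.
Let b : R := 4^-1 * wdot w p ^+ 2 + omega.

Let b0 : 0 <= b <= w2 w * beta.
Proof.
have := wdot_le w p; have := sqr_ge0 (wdot w p); have := omega0; have := omegaK.
rewrite /b /beta (_ : w2 w * (4^-1 * norm2 R p + kappa) = 4^-1 * (w2 w * norm2 R p) + w2 w * kappa); last by ring.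
move: (wdot w p ^+ 2) (w2 w * norm2 R p) (w2 w * kappa) => x y z *.
by apply/andP; split; lra.
Qed.

Let full_den (l : Z2) : R :=
  den w eps beta b (l.2%:~R - p.2%:~R / 2) (l.1%:~R - p.1%:~R / 2).

Let pair_denE l : pair_den eps kappa omega p l = full_den l.
Proof.
rewrite /pair_den /full_den /den.
set h := _ + kappa; set h' := _ + beta.
have -> : h' = h.
  rewrite /h' /h /beta /norm2 /= !intrB; move: (l.1%:~R : R) (l.2%:~R : R) (p.1%:~R : R) (p.2%:~R : R) => x y x' y'.
  by field.
congr (_ + _ * _); rewrite /b /wdot /= !intrB.
move: (l.1%:~R : R) (l.2%:~R : R) (p.1%:~R : R) (p.2%:~R : R) => x y x' y'.
by field.
Qed.

Let full_den_ge l : beta <= full_den l.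
Proof.
have q20 : 0 <= (l.1%:~R - p.1%:~R / 2) ^+ 2 + (l.2%:~R - p.2%:~R / 2) ^+ 2 :> R.
  by rewrite addr_ge0 ?sqr_ge0.
apply: (@le_trans _ _ ((l.1%:~R - p.1%:~R / 2) ^+ 2 + (l.2%:~R - p.2%:~R / 2) ^+ 2 + beta)).
  by rewrite lerDr.
rewrite /full_den /den lerDl mulr_ge0//.
  by rewrite addr_ge0 ?sqr_ge0//; case/andP: b0.
by apply: g_ge0; have := beta4; lra.
Qed.

(** The lattice sum over the box includes splittings removed by [J]. The points [0] and [p] cost at
    most [4] each. Any other has [|l| > N] or [|p - l| > N], hence, as [|p| <= N], lies at distance
    at least [N / 2] from [p / 2]; it costs [4 / N ^+ 2], and the box has [O(N ^+ 2)] points. *)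
Let outside l : (~~ J eps l (p - l))%:R / full_den l <=
  4 / N ^+ 2 + (4 * (l == 0)%:R + 4 * (l == p)%:R).
Proof.
set q2 := (l.1%:~R - p.1%:~R / 2) ^+ 2 + (l.2%:~R - p.2%:~R / 2) ^+ 2 : R.
have q20 : 0 <= q2 by rewrite addr_ge0 ?sqr_ge0.
have dq : q2 + beta <= full_den l.
  rewrite /full_den /den lerDl mulr_ge0//; last first.
    by apply: g_ge0; rewrite -/q2; have := beta4; lra.
  by rewrite addr_ge0 ?sqr_ge0//; case/andP: b0.
have N0 : 0 < N ^+ 2 by rewrite exprn_gt0//; have := N1; lra.
have d4 : (full_den l)^-1 <= 4 by rewrite -[4]invrK lef_pV2 ?posrE//; have := beta4; lra.
have t0 : 0 <= 4 / N ^+ 2 by rewrite divr_ge0// ltW.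
have n1 : (0 <= (l == 0)%:R :> R) by [].
have n2 : (0 <= (l == p)%:R :> R) by [].
case: (boolP (J _ _ _)) => [_|]; first by rewrite mul0r; lra.
rewrite JE pN andbT mul1r.
case: eqVneq => [_ _|_]; first by rewrite /=; lra.
case: eqVneq => [_ _|_] /=; first by lra.
rewrite negb_and -!ltNge => lN.
suff : 4^-1 * N ^+ 2 <= q2.
  move=> qN; apply: (@le_trans _ _ (4 / N ^+ 2)); last by lra.
  rewrite -[4 / _]invrK invf_div lef_pV2 ?posrE.
  - by rewrite mulrC; have := beta4; lra.
  - by have := beta4; lra.
  - by rewrite divr_gt0.
move: lN pN; rewrite /q2 /norm2 /= !intrB.
move: (l.1%:~R : R) (l.2%:~R : R) (p.1%:~R : R) (p.2%:~R : R) (N ^+ 2) => x y x' y' n h1 h2.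
have e : 2 * ((x - x' / 2) ^+ 2 + (y - y' / 2) ^+ 2) =
  (x ^+ 2 + y ^+ 2) + ((x' - x) ^+ 2 + (y' - y) ^+ 2) - 2^-1 * (x' ^+ 2 + y' ^+ 2) by field.
have [z1 z2] : 0 <= x ^+ 2 + y ^+ 2 /\ 0 <= (x' - x) ^+ 2 + (y' - y) ^+ 2.
  by split; rewrite addr_ge0 ?sqr_ge0.
move: e z1 z2 h1 h2; move: (x ^+ 2 + y ^+ 2) ((x' - x) ^+ 2 + (y' - y) ^+ 2) => l1 l2.
move: ((x - x' / 2) ^+ 2 + _) (x' ^+ 2 + _) => q p1 e z1 z2 /orP[]; lra.
Qed.

Lemma pair_sum_small_eps : exists s : R, (\esum_(l in [set: Z2]) (pair_sum_term eps kappa omega p l)%:E = s%:E)%E /\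
    `|s - limit| <= 30 * 100 * 30 * (1 + 3 * w2 w) ^+ 2 + 16 * (6 + 48 * w2 w) + 8 + 16.
Proof.
have NN := N2; have W0 := w0.
have nat_above (x : R) : 0 <= x -> exists m : nat, x <= m%:R <= x + 1.
  move=> x0; exists (Num.truncn x).+1; have /andP[h1 h2] := truncn_itv x0.
  by rewrite (ltW h2)/= -natr1 lerD2r.
have [M2 /andP[M2l M2u]] := nat_above N ltac:(lra).
have KN : 0 <= w2 w * N by rewrite mulr_ge0; lra.
(* The rows have to extend by [N + 24 * w2 w * N] on both sides of a centre that [p.1 / 2] displaces
   by at most [N / 2]. *)
have [M1 /andP[M1l M1u]] := nat_above (2 * N + 24 * (w2 w * N)) ltac:(lra).
have NM1 : N <= M1%:R by lra.
rewrite (esum_box term_ge0 (support NM1 M2l)); eexists; split; first by [].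
have ph (x : R) : x ^+ 2 <= norm2 R p -> `|x| <= N.
  move=> xp; rewrite -(@ler_pXn2r _ 2) ?nnegrE ?normr_ge0//; last by lra.
  by rewrite real_normK ?num_real// (le_trans xp).
have /ler_normlP[p1l p1u] : `|p.1%:~R : R| <= N by apply: ph; rewrite lerDl sqr_ge0.
have /ler_normlP[p2l p2u] : `|p.2%:~R : R| <= N by apply: ph; rewrite lerDr sqr_ge0.
set n1 := (2 * M1).+1; set n2 := (2 * M2).+1.
have n1E : n1%:R = 2 * M1%:R + 1 :> R by rewrite /n1 -natr1 natrM.
have n2E : n2%:R = 2 * M2%:R + 1 :> R by rewrite /n2 -natr1 natrM.
have lat := @lattice_sum R w eps w0 e0h beta beta4 b (M1%:R + p.1%:~R / 2) (M2%:R + p.2%:~R / 2) n1 n2 b0.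
have {}lat := lat ltac:(rewrite -/N; lra) ltac:(rewrite -/N; lra) ltac:(rewrite -/N; lra).
have {}lat := lat ltac:(rewrite -/N -mulrA; lra) ltac:(rewrite -/N -mulrA; lra).
have latE : \sum_(j < n2) \sum_(i < n1)
    (den w eps beta b (j%:R - (M2%:R + p.2%:~R / 2)) (i%:R - (M1%:R + p.1%:~R / 2)))^-1 =
    \sum_(l <- box M1 M2) (full_den l)^-1.
  rewrite sum_box; apply: eq_bigr => j _; apply: eq_bigr => i _.
  by rewrite /full_den /= !intrB !opprD !addrA.
rewrite latE -/(geps w eps beta) in lat.
set S := \sum_(l <- _) pair_sum_term _ _ _ _ _.
have SE : \sum_(l <- box M1 M2) (full_den l)^-1 =
    S + \sum_(l <- box M1 M2) (~~ J eps l (p - l))%:R / full_den l.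
  rewrite -big_split/=; apply: eq_bigr => l _; rewrite /pair_sum_term pair_denE -mulrDl.
  by case: J; rewrite ?addr0 ?add0r mul1r.
have out0 : 0 <= \sum_(l <- box M1 M2) (~~ J eps l (p - l))%:R / full_den l.
  apply: sumr_ge0 => l _; rewrite divr_ge0//.
  by rewrite (le_trans _ (full_den_ge l))//; have := beta4; lra.
have out1 : \sum_(l <- box M1 M2) (~~ J eps l (p - l))%:R / full_den l <= 16 * (6 + 48 * w2 w) + 8.
  apply: (le_trans (ler_sum _ (fun l _ => outside l))).
  rewrite big_split/= big_split/= -!mulr_sumr.
  have i1 := @sum_indicator_le R (box M1 M2) 0 (box_uniq M1 M2).
  have i2 := @sum_indicator_le R (box M1 M2) p (box_uniq M1 M2).
  have : 4 * \sum_(l <- box M1 M2) N ^- 2 <= 16 * (6 + 48 * w2 w).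
    rewrite mulr_sumr big_const_seq count_predT size_box -/n1 -/n2 iter_addr_0 -[_ *+ _]mulr_natl natrM.
    rewrite mulrA ler_pdivrMr; last by rewrite exprn_gt0//; lra.
    have k1 : n1%:R <= (6 + 48 * w2 w) * N by rewrite n1E; lra.
    have k2 : n2%:R <= 4 * N by rewrite n2E; lra.
    have := ler_pM (ler0n R n2) (ler0n R n1) k2 k1.
    by move: (n2%:R * n1%:R) => z; nra.
  by lra.
rewrite SE in lat.
have gab : `|pi ^+ 2 / lambda eps ^+ 2 * geps w eps beta - limit| <= 16.
  have l0 := lambda2_gt0 e01.
  have bet0 : 0 < beta by have := beta4; lra.
  have ab : beta <= alpha by rewrite /alpha /beta; have := np1; have := kappa0; lra.
  have /andP[h1 h2] := geps_sub w0 e0h bet0 ab.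
  have c0 : 0 <= pi ^+ 2 / lambda eps ^+ 2 by rewrite divr_ge0 ?sqr_ge0.
  rewrite -mulrBr ger0_norm; last exact: mulr_ge0.
  have p4 : pi ^+ 2 <= 16 :> R by have := pihalf_lt2 R; have := pi_gt0 R; nra.
  rewrite -mulrA -[16]mulr1; apply: ler_pM; rewrite ?sqr_ge0//.
    by rewrite mulr_ge0// invr_ge0 ltW.
  rewrite ler_pdivrMl// mulr1; apply: (le_trans h2).
  rewrite ler_piMr//; first exact: ltW.
  have ab2 : alpha / beta <= 2 by rewrite ler_pdivrMr// /alpha /beta; have := np1; have := kappa0; lra.
  by have := ln_le_sub1 (divr_gt0 (lt_le_trans bet0 ab) bet0); lra.
apply: (le_trans (ler_distD (pi ^+ 2 / lambda eps ^+ 2 * geps w eps beta) _ _)).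
rewrite lerD//; move: lat out0 out1.
move: (\sum_(l <- _) _ / _) (_ * geps w eps beta) (30 * 100 * 30 * _) (16 * (6 + _)) => o x c d.
by move=> /ler_normlP[a1 a2] o0 o1; rewrite ler_norml; apply/andP; split; lra.
Qed.

End small_eps.

Lemma pair_sum : exists s : R,
  (\esum_(l in [set: Z2]) (pair_sum_term eps kappa omega p l)%:E = s%:E)%E /\
  `|s - pi ^+ 2 / lambda eps ^+ 2 * G w (Leps eps (2^-1 * norm2 R p + kappa))| <=
  30 * 100 * 30 * (1 + 3 * w2 w) ^+ 2 + 16 * (6 + 48 * w2 w) + 32 * 10.
Proof.
have c1 : 0 <= 30 * 100 * 30 * (1 + 3 * w2 w) ^+ 2 by rewrite mulr_ge0 ?sqr_ge0.
have W0 := w0.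
rewrite -/alpha -/(geps w eps alpha) -/limit.
have [eh|eh] := leP 2^-1 eps.
  have [s [e h]] := large_eps eh; exists s; split=> //; apply: (le_trans h).
  by move: c1; move: (30 * 100 * 30 * _) => c; lra.
have [pN|pN] := leP (norm2 R p) (N ^+ 2); last first.
  have [s [e h]] := large_momentum pN; exists s; split=> //; apply: (le_trans h).
  by move: c1; move: (30 * 100 * 30 * _) => c; lra.
have [s [e h]] := pair_sum_small_eps eh pN; exists s; split=> //; apply: (le_trans h).
by move: c1; move: (30 * 100 * 30 * _) => c; lra.
Qed.

End fixed_momentum.

End resolvent_sum.

(** * Sums over sequences of frequencies *)

Section rsum.
Variables (R : realType) (T : choiceType).
Implicit Types (a u v o : T -> R).

Lemma esum_EFin_ge0 u : (forall t, 0 <= u t) -> (0 <= \esum_(t in [set: T]) (u t)%:E)%E.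
Proof. by move=> u0; apply: esum_ge0 => t _; rewrite lee_fin. Qed.

Lemma esum_EFin_lty_le u v : (forall t, 0 <= u t) -> (forall t, u t <= v t) ->
  (\esum_(t in [set: T]) (v t)%:E < +oo)%E -> (\esum_(t in [set: T]) (u t)%:E < +oo)%E.
Proof.
move=> u0 uv; apply: le_lt_trans; apply: le_esum => t _; by rewrite lee_fin.
Qed.

Lemma esum_EFinD u v : (forall t, 0 <= u t) -> (forall t, 0 <= v t) ->
  (\esum_(t in [set: T]) (u t + v t)%:E =
   \esum_(t in [set: T]) (u t)%:E + \esum_(t in [set: T]) (v t)%:E)%E.
Proof.
move=> u0 v0; rewrite -esumD; first by apply: eq_esum => t _; rewrite EFinD.
- by move=> t _; rewrite lee_fin.
- by move=> t _; rewrite lee_fin.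
Qed.

Lemma esum_fineK u : (forall t, 0 <= u t) -> (\esum_(t in [set: T]) (u t)%:E < +oo)%E ->
  ((fine (\esum_(t in [set: T]) (u t)%:E))%:E = \esum_(t in [set: T]) (u t)%:E)%E.
Proof. by move=> u0 uoo; rewrite fineK// ge0_fin_numE// esum_EFin_ge0. Qed.

(** The pointwise hypothesis is recast as inequalities between sums of nonnegative terms, such as
    [p t + v t <= q t + (u t + o t)]. They can be summed in the extended reals, and subtraction is
    performed only after finiteness is known. *)
Lemma rsum_approx a u v o :
  (forall t, 0 <= u t) -> (forall t, 0 <= v t) -> (forall t, 0 <= o t) ->
  (\esum_(t in [set: T]) (u t)%:E < +oo)%E ->
  (\esum_(t in [set: T]) (v t)%:E < +oo)%E ->
  (\esum_(t in [set: T]) (o t)%:E < +oo)%E ->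
  (forall t, `|a t - (u t - v t)| <= o t) ->
  `|rsum a - (fine (\esum_(t in [set: T]) (u t)%:E) - fine (\esum_(t in [set: T]) (v t)%:E))|
    <= fine (\esum_(t in [set: T]) (o t)%:E).
Proof.
have aux (x y z s : R) : 0 <= y -> 0 <= z -> 0 <= s -> `|x - (y - z)| <= s ->
    [/\ Num.max x 0 <= y + s, Num.max (- x) 0 <= z + s,
     Num.max x 0 + z <= Num.max (- x) 0 + (y + s) &
     Num.max (- x) 0 + y <= Num.max x 0 + (z + s)].
  move=> y0 z0 s0 /ler_normlP[h1 h2].
  by case: (leP x 0) => h; case: (leP (- x) 0) => h'; split; lra.
have aux' (x y z s r : R) : x + r <= y + (z + s) -> y + z <= x + (r + s) ->
    `|x - y - (z - r)| <= s.
  by move=> h1 h2; rewrite ler_norml; apply/andP; split; lra.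
move=> u0 v0 o0 uoo voo ooo auv; rewrite /rsum.
pose p t : R := Num.max (a t) 0; pose q t : R := Num.max (- a t) 0.
have p0 t : 0 <= p t by rewrite le_max lexx orbT.
have q0 t : 0 <= q t by rewrite le_max lexx orbT.
have b t := aux _ _ _ _ (u0 t) (v0 t) (o0 t) (auv t).
have poo : (\esum_(t in [set: T]) (p t)%:E < +oo)%E.
  apply: (@esum_EFin_lty_le _ (fun t => u t + o t) p0) => [t|]; first by have [] := b t.
  by rewrite esum_EFinD// lte_add_pinfty.
have qoo : (\esum_(t in [set: T]) (q t)%:E < +oo)%E.
  apply: (@esum_EFin_lty_le _ (fun t => v t + o t) q0) => [t|]; first by have [] := b t.
  by rewrite esum_EFinD// lte_add_pinfty.
have h1 : (\esum_(t in [set: T]) (p t + v t)%:E <= \esum_(t in [set: T]) (q t + (u t + o t))%:E)%E.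
  by apply: le_esum => t _; rewrite lee_fin; have [] := b t.
have h2 : (\esum_(t in [set: T]) (q t + u t)%:E <= \esum_(t in [set: T]) (p t + (v t + o t))%:E)%E.
  by apply: le_esum => t _; rewrite lee_fin; have [] := b t.
move: h1 h2; rewrite !esum_EFinD//; do ?by move=> t; rewrite addr_ge0.
rewrite -(esum_fineK p0 poo) -(esum_fineK q0 qoo) -(esum_fineK u0 uoo)
  -(esum_fineK v0 voo) -(esum_fineK o0 ooo) /= -!EFinD !lee_fin.
exact: aux'.
Qed.

End rsum.

(** * Rearrangement of sums over frequency sequences *)

Section chaos_sums.
Variables (R : realType).

Definition arrange (pi : seq nat) (k : seq Z2) : seq Z2 := [seq nth 0 k i | i <- pi].

Lemma perm_arrange pi k : perm_eq pi (iota 0 (size k)) -> perm_eq (arrange pi k) k.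
Proof.
move=> /(perm_map (nth 0 k))/perm_trans; apply.
by rewrite map_nth_iota0// take_size.
Qed.

Lemma esum_arrange n (pi : seq nat) (Phi : seq Z2 -> \bar R) : perm_eq pi (iota 0 n) ->
  (\esum_(k in [set k | size k = n]) Phi (arrange pi k) =
   \esum_(k in [set k | size k = n]) Phi k)%E.
Proof.
move=> pin; have spi : size pi = n by rewrite (perm_size pin) size_iota.
have upi : uniq pi by rewrite (perm_uniq pin) iota_uniq.
rewrite [RHS](reindex_esum [set k | size k = n] _ (arrange pi))//; split.
- by move=> k /= _; rewrite size_map.
- move=> k k' /set_mem/= sk /set_mem/= sk' e; apply: (@eq_from_nth _ 0); first by rewrite sk sk'.
  move=> i; rewrite sk => ilt.
  have ipi : i \in pi by rewrite (perm_mem pin) mem_iota.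
  have := congr1 (fun s => nth 0 s (index i pi)) e.
  by rewrite /arrange !(nth_map 0%N) ?index_mem// nth_index.
- move=> k /= sk; exists [seq nth 0 k (index i pi) | i <- iota 0 n].
    by rewrite /= size_map size_iota.
  apply: (@eq_from_nth _ 0); first by rewrite size_map spi sk.
  move=> i; rewrite size_map => ipi.
  rewrite /arrange (nth_map 0%N)//.
  have pi_n : (nth 0%N pi i < n)%N.
    by have := mem_nth 0%N ipi; rewrite (perm_mem pin) mem_iota.
  by rewrite (nth_map 0%N) ?size_iota// nth_iota// add0n index_uniq.
Qed.

Lemma esum_by_size (F : seq Z2 -> \bar R) : (forall k, 0 <= F k)%E ->
  (\esum_(k in [set: seq Z2]) F k =
   \esum_(n in [set: nat]) \esum_(k in [set k | size k = n]) F k)%E.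
Proof.
move=> F0; rewrite esum_esum//.
rewrite (reindex_esum [set: seq Z2] _ (fun k => (size k, k)))//; split => //=.
- by move=> k k' _ _ [].
- by move=> [n k] [_ /= <-]; exists k.
Qed.

Definition remove1 (i : nat) (k : seq Z2) : seq Z2 :=
  [seq nth 0 k l | l <- iota 0 (size k) & l != i].

Lemma perm_split1 n i : (i < n)%N -> perm_eq (i :: [seq l <- iota 0 n | l != i]) (iota 0 n).
Proof.
move=> iltn; rewrite -(rem_filter _ (iota_uniq 0 n)) perm_sym.
by apply: perm_to_rem; rewrite mem_iota.
Qed.

Lemma perm_split2 n i j : (i < j)%N -> (j < n)%N ->
  perm_eq (i :: j :: [seq l <- iota 0 n | (l != i) && (l != j)]) (iota 0 n).
Proof.
move=> ij jn; have iltn := ltn_trans ij jn.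
apply: perm_trans (perm_split1 iltn); rewrite perm_cons.
have jin : j \in [seq l <- iota 0 n | l != i].
  by rewrite mem_filter mem_iota jn andbT gtn_eqF.
have un : uniq [seq l <- iota 0 n | l != i] by rewrite filter_uniq ?iota_uniq.
rewrite perm_sym; apply: perm_trans (perm_to_rem jin) _.
rewrite perm_cons rem_filter// -filter_predI.
rewrite (@eq_filter _ _ (fun l => (l != i) && (l != j)))//.
by move=> l /=; rewrite andbC.
Qed.

(** At fixed length, bringing position [i] to the front is a bijection of sequences, so every [i]
    contributes the same sum. *)
Lemma esum_one (Phi : seq Z2 -> R) : (forall k, 0 <= Phi k) ->
  (\esum_(k in [set: seq Z2]) (\sum_(i < size k) Phi (nth 0 k i :: remove1 i k))%:E =
   \esum_(k in [set: seq Z2]) ((size k)%:R * Phi k)%:E)%E.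
Proof.
move=> P0; rewrite !esum_by_size; last 2 first.
- by move=> k; rewrite lee_fin mulr_ge0.
- by move=> k; rewrite lee_fin sumr_ge0.
apply: eq_esum => /= n _.
transitivity (\esum_(k in [set k : seq Z2 | size k = n])
    \sum_(i < n) (Phi (arrange ((i : nat) :: [seq l <- iota 0 n | l != i :> nat]) k))%:E)%E.
  by apply: eq_esum => k /= <-; rewrite sumEFin.
rewrite esum_sum; last by move=> *; rewrite lee_fin.
under eq_bigr => i _ do rewrite (esum_arrange (fun k => (Phi k)%:E) (perm_split1 (ltn_ord i))).
rewrite -esum_sum; last by move=> *; rewrite lee_fin.
apply: eq_esum => k /= <-.
by rewrite sumEFin sumr_const card_ord mulr_natl.
Qed.

Lemma sum_pairs_const n (c : R) : \sum_(i < n) \sum_(j < n | (i < j)%N) c = 'C(n, 2)%:R * c.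
Proof.
rewrite (exchange_big_dep xpredT)//=.
transitivity (\sum_(j < n) j%:R * c).
  apply: eq_bigr => j _.
  rewrite (eq_bigl (fun i : 'I_n => (i < j)%N))//.
  rewrite -(big_ord_widen n (fun=> c) (ltnW (ltn_ord j))).
  by rewrite sumr_const card_ord mulr_natl.
by rewrite -mulr_suml -natr_sum -bin2_sum big_mkord.
Qed.

Lemma esum_two (Phi : seq Z2 -> R) : (forall k, 0 <= Phi k) ->
  (\esum_(k in [set: seq Z2])
     (\sum_(i < size k) \sum_(j < size k | (i < j)%N)
        Phi (nth 0 k i :: nth 0 k j :: remove2 i j k))%:E =
   \esum_(k in [set: seq Z2]) ('C(size k, 2)%:R * Phi k)%:E)%E.
Proof.
move=> P0; rewrite !esum_by_size; last 2 first.
- by move=> k; rewrite lee_fin mulr_ge0.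
- by move=> k; rewrite lee_fin sumr_ge0// => i _; rewrite sumr_ge0.
apply: eq_esum => /= n _.
transitivity (\esum_(k in [set k : seq Z2 | size k = n])
    \sum_(i < n) \sum_(j < n | (i < j)%N)
     (Phi (arrange ((i : nat) :: (j : nat) :: [seq l <- iota 0 n | (l != i :> nat) && (l != j :> nat)]) k))%:E)%E.
  by apply: eq_esum => k /= <-; rewrite -sumEFin; apply: eq_bigr => i _; rewrite sumEFin.
rewrite esum_sum; last by move=> *; apply: sume_ge0 => *; rewrite lee_fin.
transitivity (\sum_(i < n) \sum_(j < n | (i < j)%N)
    \esum_(k in [set k : seq Z2 | size k = n]) (Phi k)%:E)%E.
  apply: eq_bigr => i _; rewrite esum_sum; last by move=> *; rewrite lee_fin.
  apply: eq_bigr => j ij.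
  by rewrite (esum_arrange (fun k => (Phi k)%:E) (perm_split2 ij (ltn_ord j))).
transitivity (\esum_(k in [set k : seq Z2 | size k = n])
    \sum_(i < n) \sum_(j < n | (i < j)%N) (Phi k)%:E)%E.
  rewrite esum_sum; last by move=> *; apply: sume_ge0 => *; rewrite lee_fin.
  by apply: eq_bigr => i _; rewrite esum_sum// => *; rewrite lee_fin.
apply: eq_esum => k /= <-; rewrite -sum_pairs_const -sumEFin.
by apply: eq_bigr => i _; rewrite sumEFin.
Qed.

Lemma esum_cons (F : seq Z2 -> \bar R) : (forall k, 0 <= F k)%E -> F [::] = 0%E ->
  (\esum_(k in [set: seq Z2]) F k =
   \esum_(K in [set: seq Z2]) \esum_(p in [set: Z2]) F (p :: K))%E.
Proof.
move=> F0 Fnil; rewrite esum_esum//.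
transitivity (\esum_(k in [set k | k != [::]]) F k)%E.
  rewrite [RHS]esum_mkcond; apply: eq_esum => k _.
  by case: ifPn => //; rewrite notin_setE/= => /negP; rewrite negbK => /eqP ->.
rewrite (reindex_esum (setT `*`` (fun=> setT)) _ (fun x : seq Z2 * Z2 => x.2 :: x.1))//; split => //=.
- by move=> [K p] [K' p'] _ _ /= [-> ->].
- by move=> [|p K]//= _; exists (K, p).
Qed.

Lemma esum_exchange (S T : choiceType) (F : S -> T -> \bar R) : (forall s t, 0 <= F s t)%E ->
  (\esum_(s in [set: S]) \esum_(t in [set: T]) F s t =
   \esum_(t in [set: T]) \esum_(s in [set: S]) F s t)%E.
Proof.
move=> F0; rewrite !esum_esum//.
rewrite (reindex_esum (setT `*`` (fun=> setT)) _ (fun x : T * S => (x.2, x.1)))//; split => //=.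
- by move=> [s t] [s' t'] _ _ /= [-> ->].
- by move=> [s t] _; exists (t, s).
Qed.

(** The shear from [(l, m)] to [(l + m, l)] of the two leading entries makes the merged momentum [p]
    a summation variable. *)
Lemma esum_two_cons (F : seq Z2 -> \bar R) : (forall k, 0 <= F k)%E ->
  (forall k, (size k <= 1)%N -> F k = 0%E) ->
  (\esum_(k in [set: seq Z2]) F k =
   \esum_(K in [set: seq Z2]) \esum_(p in [set: Z2]) \esum_(l in [set: Z2])
     F (l :: (p - l)%R :: K))%E.
Proof.
move=> F0 F1; rewrite esum_cons//; last exact: F1.
rewrite esum_cons; last 2 first.
- by move=> K; apply: esum_ge0.
- by apply: esum1 => p _; exact: F1.
apply: eq_esum => K _.
rewrite esum_exchange// [RHS]esum_exchange//.
apply: eq_esum => l _.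
rewrite (reindex_esum [set: Z2] _ (fun p => p - l))//; split => //=.
- by move=> p p' _ _ /addIr.
- by move=> m _; exists (m + l) => //; rewrite addrK.
Qed.

End chaos_sums.

(** * Off-diagonal terms *)

Section weights.
Variable R : realType.

(* Weights for a Schur test: the sum of [weight u v] over [u] is bounded
   uniformly in [v], while the geometric mean of [weight u v] and [weight v u]
   dominates the resolvent. *)
Definition weight1 (x y : R) : R :=
  Num.sqrt (1 + `|y|) / (Num.sqrt (1 + `|x|) * (1 + `|x| + (1 + `|y|))).

Definition weight (u v : Z2) : R :=
  weight1 u.1%:~R v.1%:~R * weight1 u.2%:~R v.2%:~R.

Lemma weight1_gt0 x y : 0 < weight1 x y.
Proof.
have x0 := normr_ge0 x; have y0 := normr_ge0 y.
by rewrite divr_gt0 ?mulr_gt0 ?sqrtr_gt0//; lra.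
Qed.

Lemma weight_gt0 u v : 0 < weight u v.
Proof. by rewrite mulr_gt0 ?weight1_gt0. Qed.

Lemma sum_weight1_le (c y : R) n : \sum_(i < n) weight1 (i%:R - c) y <= 8.
Proof.
have y0 := normr_ge0 y; have X1 : 1 <= 1 + `|y| by lra.
have -> : 8 = 2 * 4 :> R by ring.
apply: (@sum_two_sided _ (fun t => Num.sqrt (1 + `|y|) / (Num.sqrt t * (t + (1 + `|y|)))) c 1 n)
  => [i m i1 im|m _]; last exact: sum_interpolated_le.
have i0 : 0 < i by lra.
have m0 : 0 < m by lra.
rewrite ler_pM2l ?sqrtr_gt0//.
rewrite lef_pV2 ?posrE ?mulr_gt0 ?sqrtr_gt0//; [|lra..].
by rewrite ler_pM ?sqrtr_ge0// ?ler_sqrt//; lra.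
Qed.

Lemma sum_weight_le (p v : Z2) m1 m2 :
  \sum_(l <- box m1 m2) (weight l v + weight (p - l) v) <= 2 * (8 * 8).
Proof.
rewrite big_split/= mulr_natl mulr2n; apply: lerD.
- rewrite sum_box.
  rewrite (eq_bigr (fun j : 'I__ => (\sum_(i < (2 * m1).+1) weight1 (i%:R - m1%:R) v.1%:~R) *
      weight1 (j%:R - m2%:R) v.2%:~R)); last first.
    by move=> j _; rewrite mulr_suml; apply: eq_bigr => i _; rewrite /weight /= !intrB.
  rewrite -mulr_sumr; apply: ler_pM; rewrite ?sum_weight1_le//.
  + by apply: sumr_ge0 => i _; rewrite ltW ?weight1_gt0.
  + by apply: sumr_ge0 => i _; rewrite ltW ?weight1_gt0.
- have w1N (x y : R) : weight1 (- x) y = weight1 x y by rewrite /weight1 normrN.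
  rewrite sum_box.
  rewrite (eq_bigr (fun j : 'I__ => (\sum_(i < (2 * m1).+1) weight1 (i%:R - (m1%:R + p.1%:~R)) v.1%:~R) *
      weight1 (j%:R - (m2%:R + p.2%:~R)) v.2%:~R)); last first.
    move=> j _; rewrite mulr_suml; apply: eq_bigr => i _; rewrite /weight /= !intrB.
    by rewrite -(w1N (i%:R - _)) -(w1N (j%:R - _)); congr (weight1 _ _ * weight1 _ _); rewrite /intmul; ring.
  rewrite -mulr_sumr; apply: ler_pM; rewrite ?sum_weight1_le//.
  + by apply: sumr_ge0 => i _; rewrite ltW ?weight1_gt0.
  + by apply: sumr_ge0 => i _; rewrite ltW ?weight1_gt0.
Qed.

Definition weight_mean (u v : Z2) : R :=
  ((2 + `|u.1%:~R| + `|v.1%:~R|) * (2 + `|u.2%:~R| + `|v.2%:~R|))^-1.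

Lemma weight_meanE u v : weight_mean u v ^+ 2 = weight u v * weight v u.
Proof.
rewrite /weight_mean /weight /weight1.
have := normr_ge0 (u.1%:~R : R); have := normr_ge0 (u.2%:~R : R).
have := normr_ge0 (v.1%:~R : R); have := normr_ge0 (v.2%:~R : R).
move: `|u.1%:~R| `|u.2%:~R| `|v.1%:~R| `|v.2%:~R| => a b c d d0 c0 b0 a0.
have s x : 0 <= x -> Num.sqrt (1 + x) != 0 :> R.
  by move=> x0; rewrite sqrtr_eq0 -ltNge; lra.
have := s _ a0; have := s _ b0; have := s _ c0; have := s _ d0.
move: (Num.sqrt (1 + a)) (Num.sqrt (1 + b)) (Num.sqrt (1 + c)) (Num.sqrt (1 + d)) => sa sb sc sd nd nc nb na.
by field; rewrite nd nc nb na /= !gt_eqF //; lra.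
Qed.

(** Replaces a Euclidean norm by a product over coordinates, so that sums of weights factor. The
    product [(2 + a + c) * (2 + b + d)] is quadratic; its constant and linear parts are absorbed
    because both norms are at least [1]. *)
Lemma inv_norm2_le u v : u != 0 -> v != 0 ->
  (2^-1 * (norm2 R u + norm2 R v))^-1 <= 15 * weight_mean u v.
Proof.
move=> u0 v0; have := norm2_ge1 R u0; have := norm2_ge1 R v0; rewrite /weight_mean /norm2.
rewrite -(real_normK (num_real (u.1%:~R : R))) -(real_normK (num_real (u.2%:~R : R))).
rewrite -(real_normK (num_real (v.1%:~R : R))) -(real_normK (num_real (v.2%:~R : R))).
have := normr_ge0 (u.1%:~R : R); have := normr_ge0 (u.2%:~R : R).
have := normr_ge0 (v.1%:~R : R); have := normr_ge0 (v.2%:~R : R).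
move: `|u.1%:~R| `|u.2%:~R| `|v.1%:~R| `|v.2%:~R| => a b c d d0 c0 b0 a0 h1 h2.
rewrite ler_pdivlMr; last by rewrite mulr_gt0; lra.
rewrite mulrC ler_pdivrMr; last by lra.
have := sqr_ge0 (a + c - (b + d)); have := sqr_ge0 (a - c); have := sqr_ge0 (b - d).
have := sqr_ge0 (a - 1); have := sqr_ge0 (b - 1); have := sqr_ge0 (c - 1); have := sqr_ge0 (d - 1).
nra.
Qed.

Lemma weighted_amgm (x x' m z y t : R) : 0 < x -> m ^+ 2 = x * x' -> 0 < t ->
  2 * (m * (z * y)) <= t * (z ^+ 2 * x) + t^-1 * (y ^+ 2 * x').
Proof.
move=> x0 mx t0; have tx0 : 0 < t * x by rewrite mulr_gt0.
rewrite -subr_ge0 -(pmulr_rge0 _ tx0).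
have -> : t * x * (t * (z ^+ 2 * x) + t^-1 * (y ^+ 2 * x') - 2 * (m * (z * y))) =
    (t * x * z) ^+ 2 + y ^+ 2 * (x * x') - 2 * (t * x * z) * (m * y) by field; lra.
rewrite -mx (_ : _ - _ = (t * x * z - m * y) ^+ 2) ?sqr_ge0//; ring.
Qed.

End weights.

(** As pairs are listed increasingly, distinct pairs are distinct sets with two elements, and
    neither contains the other. *)
Lemma pair_escape n (e e' : 'I_n * 'I_n) : (e.1 < e.2)%N -> (e'.1 < e'.2)%N -> e != e' ->
  exists u, ((u == e.1) || (u == e.2)) /\ ~~ ((u == e'.1) || (u == e'.2)).
Proof.
case: e e' => [i j] [i' j'] /= ij ij'; rewrite xpair_eqE -!val_eqE /= => ne.
have [h|h] := boolP ((i == i') || (i == j')); last by exists i; rewrite eqxx.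
exists j; rewrite eqxx orbT; split=> //; move: h; rewrite -!val_eqE /=; lia.
Qed.

Section off_diagonal.
Variables (R : realType) (k : seq Z2) (r : R).
Local Notation N := (size k).
Hypothesis r_le : forall u v : 'I_N, u != v -> nth 0 k u != 0 -> nth 0 k v != 0 ->
  r <= (2^-1 * (norm2 R (nth 0 k u) + norm2 R (nth 0 k v)))^-1.

(** Both entries of [e] are included since it is not known in advance which of them escapes the
    other pair. *)
Definition pair_weight (e : 'I_N * 'I_N) (v : 'I_N) : R :=
  if (v == e.1) || (v == e.2) then 0
  else weight R (nth 0 k e.1) (nth 0 k v) + weight R (nth 0 k e.2) (nth 0 k v).

Lemma pair_weight_ge0 e v : 0 <= pair_weight e v.
Proof. by rewrite /pair_weight; case: ifP => // _; rewrite addr_ge0 ?ltW ?weight_gt0. Qed.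

Variables (z y : 'I_N * 'I_N -> R) (t : R).
Hypotheses (z0 : forall e, 0 <= z e) (y0 : forall e, 0 <= y e) (t0 : 0 < t).
Hypothesis z_supp : forall e, z e != 0 -> nth 0 k e.1 != 0 /\ nth 0 k e.2 != 0.
Hypothesis y_supp : forall e, y e != 0 -> nth 0 k e.1 != 0 /\ nth 0 k e.2 != 0.

(* Of two distinct pairs, one contains some [u] outside the other and vice versa
   some [v]; [r] is at most [2 / (|k_u|^2 + |k_v|^2)], which the weights
   distribute over the squares of [z e] and [y e']. *)
Let pair_bound (e e' : 'I_N * 'I_N) : (e.1 < e.2)%N -> (e'.1 < e'.2)%N -> e != e' ->
  r * (z e * y e') <= 15 / 2 *
    (t * (z e ^+ 2 * (pair_weight e e'.1 + pair_weight e e'.2)) +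
     t^-1 * (y e' ^+ 2 * (pair_weight e' e.1 + pair_weight e' e.2))).
Proof.
move=> lt_e lt_e' ee'.
have rhs0 : 0 <= 15 / 2 *
    (t * (z e ^+ 2 * (pair_weight e e'.1 + pair_weight e e'.2)) +
     t^-1 * (y e' ^+ 2 * (pair_weight e' e.1 + pair_weight e' e.2))).
  have tV : 0 <= t^-1 by rewrite invr_ge0 ltW.
  have q1 := addr_ge0 (pair_weight_ge0 e e'.1) (pair_weight_ge0 e e'.2).
  have q2 := addr_ge0 (pair_weight_ge0 e' e.1) (pair_weight_ge0 e' e.2).
  have := mulr_ge0 (ltW t0) (mulr_ge0 (sqr_ge0 (z e)) q1).
  by have := mulr_ge0 tV (mulr_ge0 (sqr_ge0 (y e')) q2); lra.
have [ze|ze] := eqVneq (z e) 0; first by rewrite ze mul0r mulr0 in rhs0 *.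
have [ye|ye] := eqVneq (y e') 0; first by rewrite ye !mulr0 in rhs0 *.
have [k1 k2] := z_supp ze; have [k1' k2'] := y_supp ye.
have [u [ue ue']] := pair_escape lt_e lt_e' ee'.
have [v [ve' ve]] : exists v, ((v == e'.1) || (v == e'.2)) /\ ~~ ((v == e.1) || (v == e.2)).
  by apply: pair_escape; rewrite // eq_sym.
have ku : nth 0 k u != 0 by case/orP: ue => /eqP ->.
have kv : nth 0 k v != 0 by case/orP: ve' => /eqP ->.
have uv : u != v by apply: contraNneq ve => <-.
have W1 : weight R (nth 0 k u) (nth 0 k v) <= pair_weight e e'.1 + pair_weight e e'.2.
  apply: (@le_trans _ _ (pair_weight e v)).
    rewrite /pair_weight (negbTE ve); case/orP: ue => /eqP ->.
      by rewrite lerDl ltW ?weight_gt0.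
    by rewrite lerDr ltW ?weight_gt0.
  case/orP: ve' => /eqP ->; first by rewrite lerDl pair_weight_ge0.
  by rewrite lerDr pair_weight_ge0.
have W2 : weight R (nth 0 k v) (nth 0 k u) <= pair_weight e' e.1 + pair_weight e' e.2.
  apply: (@le_trans _ _ (pair_weight e' u)).
    rewrite /pair_weight (negbTE ue'); case/orP: ve' => /eqP ->.
      by rewrite lerDl ltW ?weight_gt0.
    by rewrite lerDr ltW ?weight_gt0.
  case/orP: ue => /eqP ->; first by rewrite lerDl pair_weight_ge0.
  by rewrite lerDr pair_weight_ge0.
have zy0 : 0 <= z e * y e' by rewrite mulr_ge0.
apply: (@le_trans _ _ (15 * weight_mean R (nth 0 k u) (nth 0 k v) * (z e * y e'))).
  by rewrite ler_wpM2r// (le_trans (r_le uv ku kv))// inv_norm2_le.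
have := @weighted_amgm R _ _ _ (z e) (y e') t (weight_gt0 R (nth 0 k u) (nth 0 k v))
  (weight_meanE R (nth 0 k u) (nth 0 k v)) t0.
have := ler_wpM2l (ltW t0) (ler_wpM2l (sqr_ge0 (z e)) W1).
have tV : 0 <= t^-1 by rewrite invr_ge0 ltW.
have := ler_wpM2l tV (ler_wpM2l (sqr_ge0 (y e')) W2).
rewrite -(mulrA 15).
move: (weight_mean _ _ _ * _) (t * (_ * weight _ _ _)) (t^-1 * (_ * weight _ _ _)) => m a b.
by move: (t * _) (t^-1 * _) => c d; lra.
Qed.

Let sum_pair_weight (e : 'I_N * 'I_N) :
  \sum_(e' : 'I_N * 'I_N) (pair_weight e e'.1 + pair_weight e e'.2) =
  (2 * N%:R) * \sum_v pair_weight e v.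
Proof.
rewrite big_split/= -(pair_bigA _ (fun i j => pair_weight e i))/=.
rewrite -(pair_bigA _ (fun i j => pair_weight e j))/=.
under eq_bigr do rewrite sumr_const card_ord -[_ *+ _]mulr_natl.
rewrite -mulr_sumr sumr_const card_ord -[X in _ + X]mulr_natl; ring.
Qed.

(** In each half of the Schur bound the other pair enters only through one of its entries [v].
    Summing over all pairs counts every [v] at most [2 * N] times, which is one of the losses
    charged to the number operator. *)
Lemma off_diagonal_bound :
  r * \sum_(e : 'I_N * 'I_N | (e.1 < e.2)%N) \sum_(e' : 'I_N * 'I_N | (e'.1 < e'.2)%N && (e' != e)) z e * y e' <=
  15 * N%:R * \sum_(e : 'I_N * 'I_N | (e.1 < e.2)%N)
     (t * z e ^+ 2 + t^-1 * y e ^+ 2) * \sum_v pair_weight e v.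
Proof.
pose A (e e' : 'I_N * 'I_N) := 15 / 2 * t * z e ^+ 2 * (pair_weight e e'.1 + pair_weight e e'.2).
pose B (e' e : 'I_N * 'I_N) := 15 / 2 * t^-1 * y e' ^+ 2 * (pair_weight e' e.1 + pair_weight e' e.2).
have A0 e e' : 0 <= A e e'.
  rewrite /A; apply: mulr_ge0; last by apply: addr_ge0; exact: pair_weight_ge0.
  by apply: mulr_ge0 (sqr_ge0 _); have := t0; lra.
have B0 e e' : 0 <= B e e'.
  rewrite /B; apply: mulr_ge0; last by apply: addr_ge0; exact: pair_weight_ge0.
  by apply: mulr_ge0 (sqr_ge0 _); rewrite mulr_ge0 ?invr_ge0 ?ltW.
apply: (@le_trans _ _ (\sum_(e : 'I_N * 'I_N | (e.1 < e.2)%N) \sum_(e' : 'I_N * 'I_N | (e'.1 < e'.2)%N) (A e e' + B e' e))).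
  rewrite mulr_sumr; apply: ler_sum => e ee; rewrite mulr_sumr.
  rewrite big_mkcondr/=; apply: ler_sum => e' ee'.
  case: ifPn => ne; last by rewrite addr_ge0.
  apply: (le_trans (pair_bound ee ee' _)); first by rewrite eq_sym.
  by rewrite /A /B le_eqVlt; apply/orP; left; apply/eqP; ring.
under eq_bigr do rewrite big_split/=.
rewrite big_split/= [X in _ + X]exchange_big/= -big_split/= mulr_sumr.
apply: ler_sum => e ee.
have S (F : 'I_N * 'I_N -> R) : (forall e, 0 <= F e) -> \sum_(e : 'I_N * 'I_N | (e.1 < e.2)%N) F e <= \sum_e F e.
  move=> F0; rewrite big_mkcond/=; apply: ler_sum => e' _; by case: ifP.
apply: (le_trans (lerD (S _ (A0 e)) (S _ (B0 e)))).
rewrite /A /B -!mulr_sumr !sum_pair_weight.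
by rewrite le_eqVlt; apply/orP; left; apply/eqP; field; rewrite gt_eqF.
Qed.

End off_diagonal.

(** * Diagonal terms *)

Lemma esum_EFinZl (R : realType) (T : choiceType) (c : R) (u : T -> R) :
  0 <= c -> (forall t, 0 <= u t) ->
  (\esum_(t in [set: T]) (c * u t)%:E = c%:E * \esum_(t in [set: T]) (u t)%:E)%E.
Proof.
have le (d : R) (v : T -> R) : 0 <= d -> (forall t, 0 <= v t) ->
    (\esum_(t in [set: T]) (d * v t)%:E <= d%:E * \esum_(t in [set: T]) (v t)%:E)%E.
  move=> d0 v0; apply: ge_ereal_sup => _ [X [fX XT] <-].
  have -> : (\sum_(t \in X) (d * v t)%:E = d%:E * \sum_(t \in X) (v t)%:E)%E.
    by rewrite !fsbig_finite// !sumEFin -EFinM mulr_sumr.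
  apply: lee_wpmul2l; first by rewrite lee_fin.
  by apply: esum_ge; exists X.
move=> c0 u0; apply/eqP; rewrite eq_le le//=.
have [->|cn0] := eqVneq c 0.
  by rewrite mul0e esum_ge0// => t _; rewrite mul0r.
have cp : 0 < c by rewrite lt0r cn0.
have cu t : 0 <= c * u t by rewrite mulr_ge0.
have := le c^-1 (fun t => c * u t); rewrite invr_ge0 => /(_ c0 cu).
under eq_esum do rewrite mulKf//.
move=> h; have := lee_wpmul2l (_ : 0 <= c%:E)%E h; rewrite lee_fin => /(_ c0).
by rewrite muleA -EFinM divff// mul1e.
Qed.

Lemma le_esum_EFin (R : realType) (T : choiceType) (u v : T -> R) :
  (forall t, u t <= v t) ->
  (\esum_(t in [set: T]) (u t)%:E <= \esum_(t in [set: T]) (v t)%:E)%E.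
Proof. by move=> uv; apply: le_esum => t _; rewrite lee_fin. Qed.

(** By symmetry of [a], any entry may play the role of the head. This trades [L0w], a sum over
    entries, for a sum over a distinguished momentum [p], which is the shape of the diagonal
    term. *)
Lemma esum_head (R : realType) (a : seq Z2 -> R) (q : Z2 -> R) :
  (forall k, 0 <= a k) -> (forall l, 0 <= q l) ->
  (forall k k', perm_eq k k' -> a k = a k') ->
  (\esum_(K in [set: seq Z2]) \esum_(p in [set: Z2]) ((size K).+1%:R * (a (p :: K) * q p))%:E =
   \esum_(k in [set: seq Z2]) (a k * \sum_(l <- k) q l)%:E)%E.
Proof.
move=> a0 q0 a_perm; pose Phi (k : seq Z2) := a k * q (head 0 k).
have Phi0 k : 0 <= Phi k by rewrite mulr_ge0.
transitivity (\esum_(k in [set: seq Z2]) ((size k)%:R * Phi k)%:E)%E.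
  rewrite [RHS](@esum_cons R)//; first by move=> k; rewrite lee_fin mulr_ge0.
  by rewrite mul0r.
rewrite -esum_one//; apply: eq_esum => k _; congr (_%:E).
rewrite (big_nth 0) big_mkord mulr_sumr; apply: eq_bigr => i _; rewrite /Phi /=.
by congr (_ * _); apply: a_perm; exact: perm_arrange (perm_split1 (ltn_ord i)).
Qed.

Lemma esum_pairs (R : realType) (b : nat -> R) (Phi : seq Z2 -> R) :
  (forall n, 0 <= b n) -> (forall k, 0 <= Phi k) ->
  (\esum_(k in [set: seq Z2]) (b (size k) * \sum_(i < size k) \sum_(j < size k | (i < j)%N)
      Phi (nth 0 k i :: nth 0 k j :: remove2 i j k))%:E =
   \esum_(K in [set: seq Z2]) \esum_(p in [set: Z2]) \esum_(l in [set: Z2])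
     (b (size K).+2 * 'C((size K).+2, 2)%:R * Phi (l :: (p - l) :: K))%:E)%E.
Proof.
move=> b0 Phi0; pose Phi' (k : seq Z2) := b (size k) * Phi k.
have Phi'0 k : 0 <= Phi' k by rewrite mulr_ge0.
transitivity (\esum_(k in [set: seq Z2]) ('C(size k, 2)%:R * Phi' k)%:E)%E.
  rewrite -esum_two//; apply: eq_esum => k _; congr (_%:E).
  rewrite mulr_sumr; apply: eq_bigr => i _; rewrite mulr_sumr; apply: eq_bigr => j ij.
  rewrite /Phi'; congr (b _ * _).
  by apply: esym; exact: perm_size (perm_arrange (perm_split2 ij (ltn_ord j))).
rewrite esum_two_cons; last 2 first.
- by move=> k; rewrite lee_fin mulr_ge0.
- by move=> k k1; rewrite bin_small ?mul0r.
apply: eq_esum => K _; apply: eq_esum => p _; apply: eq_esum => l _; congr (_%:E).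
by rewrite /Phi' /= mulrCA mulrA.
Qed.

Lemma esum2D (R : realType) (S T : choiceType) (F G : S -> T -> \bar R) :
  (forall s t, 0 <= F s t)%E -> (forall s t, 0 <= G s t)%E ->
  (\esum_(s in [set: S]) \esum_(t in [set: T]) (F s t + G s t) =
   \esum_(s in [set: S]) \esum_(t in [set: T]) F s t +
   \esum_(s in [set: S]) \esum_(t in [set: T]) G s t)%E.
Proof.
move=> F0 G0; rewrite -esumD => [|s _|s _]; do ?exact: esum_ge0.
by apply: eq_esum => s _; rewrite esumD.
Qed.

(** * Estimates for nonnegative symmetric families *)

Section symmetric_families.
Variables (R : realType) (w : R * R) (eps : R).
Hypotheses (w0 : 0 < w2 w) (e01 : 0 < eps < 1).

Definition energy_term (h : seq Z2 -> R) (k : seq Z2) : R :=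
  (size k)`!%:R * ((size k)%:R ^+ 2 * - L0 R k * h k).

(* [n!] times the squared modulus of the prefactor of [Aplus]. *)
Definition image_coef (n : nat) : R := n`!%:R * (lambda eps ^+ 2 / (pi ^+ 2 * n%:R ^+ 2)).

Definition pair_energy (h : seq Z2 -> R) (k : seq Z2) (i j : nat) : R :=
  wdot w (nth 0 k i + nth 0 k j) ^+ 2 * (J eps (nth 0 k i) (nth 0 k j))%:R *
  h ((nth 0 k i + nth 0 k j) :: remove2 i j k).

Definition diagonal_term (h : seq Z2 -> R) (k : seq Z2) : R :=
  image_coef (size k) * resolvent w eps k *
  \sum_(i < size k) \sum_(j < size k | (i < j)%N) pair_energy h k i j.

Definition off_diagonal_term (h : seq Z2 -> R) (k : seq Z2) : R :=
  image_coef (size k) * (15 * (size k)%:R) *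
  \sum_(i < size k) \sum_(j < size k | (i < j)%N)
    pair_energy h k i j * \sum_v pair_weight R (i, j) v.

(** The contribution of [L0w * Geps] with its sign reversed, so that it is nonnegative and
    comparable to [diagonal_term]. *)
Definition drift_term (h : seq Z2 -> R) (k : seq Z2) : R :=
  (size k)`!%:R * (- L0w w k * Geps w eps k * h k).

Lemma L0E k : - L0 R k = 2^-1 * \sum_(l <- k) norm2 R l.
Proof. by rewrite /L0 mulNr opprK. Qed.

Lemma L0wE k : - L0w w k = 2^-1 * \sum_(l <- k) wdot w l ^+ 2.
Proof. by rewrite /L0w mulNr opprK. Qed.

Lemma L0_ge0 k : 0 <= - L0 R k.
Proof. by rewrite L0E mulr_ge0 ?invr_ge0// sumr_ge0// => l _; exact: norm2_ge0. Qed.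

Lemma L0w_ge0 k : 0 <= - L0w w k.
Proof. by rewrite L0wE mulr_ge0 ?invr_ge0// sumr_ge0// => l _; exact: sqr_ge0. Qed.

Lemma L0w_le k : - L0w w k <= w2 w * - L0 R k.
Proof.
rewrite L0wE L0E mulrCA ler_pM2l ?invr_gt0// mulr_sumr; apply: ler_sum => l _; exact: wdot_le.
Qed.

Lemma L0_perm k k' : perm_eq k k' -> L0 R k = L0 R k'.
Proof. by move=> kk'; rewrite /L0 (perm_big _ kk'). Qed.

Lemma L0w_perm k k' : perm_eq k k' -> L0w w k = L0w w k'.
Proof. by move=> kk'; rewrite /L0w (perm_big _ kk'). Qed.

Lemma Geps_perm k k' : perm_eq k k' -> Geps w eps k = Geps w eps k'.
Proof. by move=> kk'; rewrite /Geps (L0_perm kk'). Qed.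

Lemma resolvent_perm k k' : perm_eq k k' -> resolvent w eps k = resolvent w eps k'.
Proof. by move=> kk'; rewrite /resolvent (L0_perm kk') (L0w_perm kk') (Geps_perm kk'). Qed.

Lemma Leps_nonneg x : 0 <= x -> 0 <= Leps eps x.
Proof.
rewrite le_eqVlt => /orP[/eqP <-|]; last exact: Leps_ge0.
(* The empty sequence has energy [0], where the convention [0^-1 = 0] gives [Leps] the value [0]. *)
by rewrite /Leps mulr0 invr0 addr0 ln1 mulr0.
Qed.

Lemma Geps_ge0 k : 0 <= Geps w eps k.
Proof. by apply: G_ge0 => //; apply: Leps_nonneg; exact: L0_ge0. Qed.

Lemma resolvent_ge0 k : 0 <= resolvent w eps k.
Proof.
rewrite /resolvent invr_ge0 -(mulNr (L0w w k)); apply: addr_ge0; first exact: L0_ge0.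
by apply: mulr_ge0; [exact: L0w_ge0|exact: Geps_ge0].
Qed.

Lemma resolvent_le k (u v : 'I_(size k)) : u != v -> nth 0 k u != 0 -> nth 0 k v != 0 ->
  resolvent w eps k <= (2^-1 * (norm2 R (nth 0 k u) + norm2 R (nth 0 k v)))^-1.
Proof.
move=> uv ku kv.
have nu := norm2_ge1 R ku; have nv := norm2_ge1 R kv.
have uvk : 2^-1 * (norm2 R (nth 0 k u) + norm2 R (nth 0 k v)) <= - L0 R k.
  rewrite L0E ler_pM2l ?invr_gt0// (big_nth 0) big_mkord (bigD1 u)//= (bigD1 v) 1?eq_sym//=.
  by rewrite addrA lerDl sumr_ge0// => i _; exact: norm2_ge0.
have den0 : 0 < 2^-1 * (norm2 R (nth 0 k u) + norm2 R (nth 0 k v)) by lra.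
have GW := mulr_ge0 (L0w_ge0 k) (Geps_ge0 k).
rewrite lef_pV2 ?posrE//; last by move: GW; rewrite mulNr; lra.
by move: GW; rewrite mulNr; lra.
Qed.

Lemma image_coef_ge0 n : 0 <= image_coef n.
Proof.
by rewrite mulr_ge0// divr_ge0 ?sqr_ge0// mulr_ge0 ?sqr_ge0.
Qed.

Lemma resolvent_pair (p l : Z2) (K : seq Z2) :
  resolvent w eps (l :: (p - l) :: K) = (pair_den w eps (- L0 R K) (- L0w w K) p l)^-1.
Proof.
have e1 : - L0 R (l :: (p - l) :: K) = 2^-1 * (norm2 R l + norm2 R (p - l)) + - L0 R K.
  by rewrite !L0E !big_cons; ring.
have e2 : - L0w w (l :: (p - l) :: K) =
    2^-1 * (wdot w l ^+ 2 + wdot w (p - l) ^+ 2) + - L0w w K.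
  by rewrite !L0wE !big_cons; ring.
by rewrite /resolvent /pair_den /Geps -(mulNr (L0w w _)) e1 e2.
Qed.

Lemma pair_sum_term_ge0 (p l : Z2) (K : seq Z2) :
  0 <= pair_sum_term w eps (- L0 R K) (- L0w w K) p l.
Proof. by rewrite /pair_sum_term -resolvent_pair mulr_ge0// resolvent_ge0. Qed.

Variable h : seq Z2 -> R.
Hypotheses (h0 : forall k, 0 <= h k) (h_perm : forall k k', perm_eq k k' -> h k = h k').
Hypothesis h_zero : forall k, 0 \in k -> h k = 0.

Local Notation E := (\esum_(k in [set: seq Z2]) (energy_term h k)%:E)%E.

Lemma pair_energy_ge0 k i j : 0 <= pair_energy h k i j.
Proof. by apply: mulr_ge0 => //; apply: mulr_ge0 => //; exact: sqr_ge0. Qed.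

Lemma energy_term_ge0 k : 0 <= energy_term h k.
Proof.
by apply: mulr_ge0 => //; apply: mulr_ge0 => //; apply: mulr_ge0 (sqr_ge0 _) (L0_ge0 _).
Qed.

Lemma diagonal_term_ge0 k : 0 <= diagonal_term h k.
Proof.
apply: mulr_ge0; first by apply: mulr_ge0; [exact: image_coef_ge0|exact: resolvent_ge0].
by apply: sumr_ge0 => i _; apply: sumr_ge0 => j _; exact: pair_energy_ge0.
Qed.

Lemma off_diagonal_term_ge0 k : 0 <= off_diagonal_term h k.
Proof.
apply: mulr_ge0; first by apply: mulr_ge0; [exact: image_coef_ge0|rewrite mulr_ge0].
apply: sumr_ge0 => i _; apply: sumr_ge0 => j _; apply: mulr_ge0; first exact: pair_energy_ge0.
by apply: sumr_ge0 => v _; exact: pair_weight_ge0.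
Qed.

Lemma drift_term_ge0 k : 0 <= drift_term h k.
Proof. by apply: mulr_ge0 => //; apply: mulr_ge0 => //; rewrite mulr_ge0 ?L0w_ge0 ?Geps_ge0. Qed.

(* The sums over pairs of momenta become sums over a merged momentum [p] and
   its splittings [l + (p - l)]. *)
Lemma diagonal_energyE :
  (\esum_(k in [set: seq Z2]) (diagonal_term h k)%:E =
   \esum_(K in [set: seq Z2]) \esum_(p in [set: Z2])
     ((image_coef (size K).+2 * 'C((size K).+2, 2)%:R * (wdot w p ^+ 2 * h (p :: K)))%:E *
     \esum_(l in [set: Z2])
       (pair_sum_term w eps (- L0 R K) (- L0w w K) p l)%:E))%E.
Proof.
pose Phi (k : seq Z2) : R := if k is l :: m :: K then
  resolvent w eps k * (wdot w (l + m) ^+ 2 * (J eps l m)%:R * h ((l + m) :: K)) else 0.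
have Phi0 k : 0 <= Phi k.
  case: k => [|l [|m K]]//=; apply: mulr_ge0; first exact: resolvent_ge0.
  by apply: mulr_ge0 => //; apply: mulr_ge0 => //; exact: sqr_ge0.
transitivity (\esum_(k in [set: seq Z2]) (image_coef (size k) *
    \sum_(i < size k) \sum_(j < size k | (i < j)%N)
      Phi (nth 0 k i :: nth 0 k j :: remove2 i j k))%:E)%E.
  apply: eq_esum => k _; congr (_%:E); rewrite /diagonal_term -mulrA; congr (_ * _).
  rewrite mulr_sumr; apply: eq_bigr => i _; rewrite mulr_sumr; apply: eq_bigr => j ij.
  rewrite /Phi (@resolvent_perm (nth 0 k i :: nth 0 k j :: remove2 i j k) k)//.
  exact: perm_arrange (perm_split2 ij (ltn_ord j)).
rewrite esum_pairs//; last exact: image_coef_ge0.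
apply: eq_esum => K _; apply: eq_esum => p _.
rewrite -esum_EFinZl; last 2 first.
- apply: mulr_ge0; first by apply: mulr_ge0 => //; exact: image_coef_ge0.
  by apply: mulr_ge0 => //; exact: sqr_ge0.
- by move=> l; exact: pair_sum_term_ge0.
apply: eq_esum => l _; congr (_%:E); rewrite /Phi /pair_sum_term.
rewrite (addrC l) subrK resolvent_pair; ring.
Qed.

Definition pair_const : R :=
  30 * 100 * 30 * (1 + 3 * w2 w) ^+ 2 + 16 * (6 + 48 * w2 w) + 32 * 10.

Lemma pair_const_ge0 : 0 <= pair_const.
Proof.
have W0 := w0; have := sqr_ge0 (1 + 3 * w2 w); rewrite /pair_const.
by move: ((1 + 3 * w2 w) ^+ 2) => c c0; lra.
Qed.

Lemma pi2_ge4 : 4 <= pi ^+ 2 :> R.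
Proof. by have := pi_ge2 R; rewrite expr2 => p2; nra. Qed.

(** Passing from order [n + 2] back to [n + 1], the factorial becomes the one of the source chaos,
    and the remaining [n + 1] is exactly the factor required by [esum_head]. *)
Lemma image_coef_bin n : image_coef n.+2 * 'C(n.+2, 2)%:R =
  n.+1%:R * (n.+1`!%:R * (lambda eps ^+ 2 / pi ^+ 2 / 2)).
Proof.
have pi0 : pi != 0 :> R by rewrite gt_eqF// pi_gt0.
have b2 : 'C(n.+2, 2)%:R = n.+2%:R * n.+1%:R / 2 :> R.
  have := congr1 (fun m => m%:R : R) (mul_bin_diag n.+2 1); rewrite /= bin1 !natrM => ->.
  by rewrite mulrC mulKf// pnatr_eq0.
rewrite /image_coef b2 factS natrM; move: pi pi0 => q q0; field.
by rewrite q0 -(natrD _ 2 n) pnatr_eq0.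
Qed.

Definition drift_head (k : seq Z2) : R := (size k)`!%:R / 2 * (Geps w eps k * h k).
Definition error_head (k : seq Z2) : R :=
  (size k)`!%:R * (lambda eps ^+ 2 / pi ^+ 2 / 2) * (pair_const * h k).

Lemma drift_head_ge0 k : 0 <= drift_head k.
Proof. by apply: mulr_ge0; [rewrite divr_ge0|apply: mulr_ge0 => //; exact: Geps_ge0]. Qed.

Lemma error_head_ge0 k : 0 <= error_head k.
Proof.
apply: mulr_ge0; last by apply: mulr_ge0 => //; exact: pair_const_ge0.
by apply: mulr_ge0 => //; rewrite !divr_ge0 ?sqr_ge0.
Qed.

(** The prefactor [lambda ^+ 2 / pi ^+ 2] cancels the inverse factor in [pair_sum], and the
    remaining [2^-1] is the one in [L0w]: the main term agrees exactly with [drift_term], and the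
    bounded error keeps its [lambda ^+ 2]. *)
Lemma merged_term_approx (K : seq Z2) (p : Z2) : exists z : R,
  ((image_coef (size K).+2 * 'C((size K).+2, 2)%:R * (wdot w p ^+ 2 * h (p :: K)))%:E *
     (\esum_(l in [set: Z2]) (pair_sum_term w eps (- L0 R K) (- L0w w K) p l)%:E) = z%:E)%E /\
  `|z - (size K).+1%:R * (drift_head (p :: K) * wdot w p ^+ 2)| <=
    (size K).+1%:R * (error_head (p :: K) * wdot w p ^+ 2).
Proof.
(* [pair_sum] concerns [p != 0] only; at [p = 0] every term vanishes with [h]. *)
have [->|p0] := eqVneq p 0.
  exists 0; rewrite /drift_head /error_head (h_zero (mem_head 0 K)) !mulr0 mul0e.
  by rewrite mul0r mulr0 subr0 normr0.
have [s [-> hs]] := pair_sum w0 e01 (L0_ge0 K) (L0w_ge0 K) (L0w_le K) p0.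
exists (image_coef (size K).+2 * 'C((size K).+2, 2)%:R * (wdot w p ^+ 2 * h (p :: K)) * s).
split; first by rewrite -EFinM.
have lam := lambda2_gt0 e01.
have pi0 : pi != 0 :> R by rewrite gt_eqF// pi_gt0.
have eG : Geps w eps (p :: K) = G w (Leps eps (2^-1 * norm2 R p + - L0 R K)).
  by rewrite /Geps !L0E big_cons mulrDr.
rewrite -eG in hs; rewrite image_coef_bin /drift_head /error_head /=.
set g := Geps w eps _ in hs *; set x := h _; set y := wdot w p ^+ 2.
have y0 : 0 <= y by exact: sqr_ge0.
have x0 : 0 <= x by exact: h0.
set n : R := (size K).+1%:R; set f : R := (size K).+1`!%:R.
have n0 : 0 <= n by []. have f0 : 0 <= f by [].
have -> : n * (f * (lambda eps ^+ 2 / pi ^+ 2 / 2)) * (y * x) * s - n * (f / 2 * (g * x) * y) =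
    n * (f * (lambda eps ^+ 2 / pi ^+ 2 / 2)) * (y * x) * (s - pi ^+ 2 / lambda eps ^+ 2 * g).
  by move: pi pi0 => q q0; field; rewrite q0 -sqrf_eq0 gt_eqF.
rewrite normrM ger0_norm; last first.
  apply: mulr_ge0; last exact: mulr_ge0.
  by apply: mulr_ge0 => //; apply: mulr_ge0 => //; rewrite !divr_ge0 ?sqr_ge0.
apply: (@le_trans _ _ (n * (f * (lambda eps ^+ 2 / pi ^+ 2 / 2)) * (y * x) * pair_const)).
  apply: ler_wpM2l hs; apply: mulr_ge0; last exact: mulr_ge0.
  by apply: mulr_ge0 => //; apply: mulr_ge0 => //; rewrite !divr_ge0 ?sqr_ge0.
by rewrite le_eqVlt; apply/orP; left; apply/eqP; ring.
Qed.

Lemma drift_headE : (\esum_(k in [set: seq Z2]) (drift_term h k)%:E =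
  \esum_(K in [set: seq Z2]) \esum_(p in [set: Z2])
    ((size K).+1%:R * (drift_head (p :: K) * wdot w p ^+ 2))%:E)%E.
Proof.
rewrite (@esum_head _ drift_head (fun p => wdot w p ^+ 2)); last 3 first.
- exact: drift_head_ge0.
- by move=> l; exact: sqr_ge0.
- by move=> k k' kk'; rewrite /drift_head (perm_size kk') (Geps_perm kk') (h_perm kk').
apply: eq_esum => k _; congr (_%:E); rewrite /drift_term /drift_head L0wE; ring.
Qed.

Lemma esum_energy_term_le (c : R) (F : seq Z2 -> R) : 0 <= c ->
  (forall k, F k <= c * energy_term h k) ->
  (\esum_(k in [set: seq Z2]) (F k)%:E <= c%:E * E)%E.
Proof.
move=> c0 Fle; rewrite -esum_EFinZl//; last exact: energy_term_ge0.
exact: le_esum_EFin.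
Qed.

Lemma error_head_le : (\esum_(K in [set: seq Z2]) \esum_(p in [set: Z2])
    ((size K).+1%:R * (error_head (p :: K) * wdot w p ^+ 2))%:E <=
  (pair_const * w2 w * lambda eps ^+ 2)%:E * E)%E.
Proof.
rewrite (@esum_head _ error_head (fun p => wdot w p ^+ 2)); last 3 first.
- exact: error_head_ge0.
- by move=> l; exact: sqr_ge0.
- by move=> k k' kk'; rewrite /error_head (perm_size kk') (h_perm kk').
have W0 := w0; have c0 := pair_const_ge0.
apply: esum_energy_term_le => [|k].
  by apply: mulr_ge0 (sqr_ge0 _); apply: mulr_ge0 => //; exact: ltW.
have [->|kn] := eqVneq k [::].
  rewrite big_nil mulr0; apply: mulr_ge0; last exact: energy_term_ge0.
  by apply: mulr_ge0 (sqr_ge0 _); apply: mulr_ge0 => //; exact: ltW.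
have n1 : 1 <= (size k)%:R ^+ 2 :> R by rewrite exprn_ege1// ler1n lt0n size_eq0.
have -> : error_head k * \sum_(l <- k) wdot w l ^+ 2 =
    (size k)`!%:R * lambda eps ^+ 2 * h k * pair_const * (- L0w w k) / pi ^+ 2.
  rewrite L0wE /error_head; ring.
have p4 := pi2_ge4.
rewrite ler_pdivrMr; last by lra.
have -> : pair_const * w2 w * lambda eps ^+ 2 * energy_term h k * pi ^+ 2 =
    (size k)`!%:R * lambda eps ^+ 2 * h k * pair_const *
      (w2 w * - L0 R k * ((size k)%:R ^+ 2 * pi ^+ 2)).
  rewrite /energy_term; ring.
apply: ler_wpM2l.
  apply: mulr_ge0 => //; apply: mulr_ge0 => //; apply: mulr_ge0 (sqr_ge0 _) => //.
apply: (le_trans (L0w_le k)); rewrite ler_peMr//.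
  by apply: mulr_ge0 (L0_ge0 k); exact: ltW.
by rewrite -[1]mulr1; apply: ler_pM => //; lra.
Qed.

(** The cancellation is stated as two one-sided inequalities, here and in [drift_le], since the sums
    live in [[0, +oo]], where a difference may be meaningless. *)
Lemma diagonal_le : (\esum_(k in [set: seq Z2]) (diagonal_term h k)%:E <=
  \esum_(k in [set: seq Z2]) (drift_term h k)%:E +
  (pair_const * w2 w * lambda eps ^+ 2)%:E * E)%E.
Proof.
rewrite diagonal_energyE drift_headE; apply: le_trans (leeD2l _ error_head_le).
rewrite -esum2D => [|K p|K p]; last 2 first.
- by rewrite lee_fin; apply: mulr_ge0 => //; apply: mulr_ge0 (sqr_ge0 _); exact: drift_head_ge0.
- by rewrite lee_fin; apply: mulr_ge0 => //; apply: mulr_ge0 (sqr_ge0 _); exact: error_head_ge0.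
apply: le_esum => K _; apply: le_esum => p _.
have [z [-> /ler_normlP[_ hz]]] := merged_term_approx K p.
by rewrite -EFinD lee_fin -lerBlDl.
Qed.

Lemma drift_le : (\esum_(k in [set: seq Z2]) (drift_term h k)%:E <=
  \esum_(k in [set: seq Z2]) (diagonal_term h k)%:E +
  (pair_const * w2 w * lambda eps ^+ 2)%:E * E)%E.
Proof.
rewrite diagonal_energyE drift_headE; apply: le_trans (leeD2l _ error_head_le).
rewrite -esum2D => [|K p|K p]; last 2 first.
- have [z [e _]] := merged_term_approx K p.
  apply: mule_ge0; last by apply: esum_ge0 => l _; rewrite lee_fin pair_sum_term_ge0.
  rewrite lee_fin; apply: mulr_ge0; first by apply: mulr_ge0 => //; exact: image_coef_ge0.
  by apply: mulr_ge0 => //; exact: sqr_ge0.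
- by rewrite lee_fin; apply: mulr_ge0 => //; apply: mulr_ge0 (sqr_ge0 _); exact: error_head_ge0.
apply: le_esum => K _; apply: le_esum => p _.
have [z [-> /ler_normlP[hz _]]] := merged_term_approx K p.
by rewrite -EFinD lee_fin; move: hz; rewrite opprB lerBlDl.
Qed.


Lemma sum_pair_weightE (k : seq Z2) (i j : 'I_(size k)) : \sum_v pair_weight R (i, j) v =
  \sum_(v <- remove2 i j k) (weight R (nth 0 k i) v + weight R (nth 0 k j) v).
Proof.
rewrite big_map big_filter -[X in iota 0 X]subn0 big_mkord [RHS]big_mkcond/=.
apply: eq_bigr => v _; rewrite /pair_weight /= -!val_eqE /= -negb_or.
by case: (_ || _).
Qed.

Lemma cutoff_box : exists m : nat, forall l, cutoff eps l -> l \in box m m.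
Proof.
have [e0 e1] := andP e01; exists (Num.bound (eps ^- 2)) => l.
rewrite cutoffE// => /andP[l0 lm].
have : norm2 R l < (Num.bound (eps ^- 2))%:R.
  by apply: le_lt_trans lm (archi_boundP _); rewrite invr_ge0 exprn_ge0// ltW.
move: (Num.bound _) => m; case: l {l0 lm} => x y; rewrite /norm2 /= => lm.
apply: mem_box => /=.
  have : x ^+ 2 < m%:Z.
    rewrite -(ltr_int R) rmorphXn/=; apply: le_lt_trans lm; by rewrite lerDl sqr_ge0.
  nia.
have : y ^+ 2 < m%:Z.
  rewrite -(ltr_int R) rmorphXn/=; apply: le_lt_trans lm; by rewrite lerDr sqr_ge0.
nia.
Qed.

Definition split_weight (p : Z2) (K : seq Z2) (l : Z2) : R :=
  (J eps l (p - l))%:R * \sum_(v <- K) (weight R l v + weight R (p - l) v).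

Lemma split_weight_ge0 p K l : 0 <= split_weight p K l.
Proof.
rewrite mulr_ge0// sumr_ge0// => v _; rewrite addr_ge0// ltW// weight_gt0//.
Qed.

(** For each of the [size K] spectators the Schur weights sum to a constant over any box; the cutoff
    only confines the sum to some box, so no logarithm of [eps] appears. *)
Lemma esum_split_weight_le p K :
  (\esum_(l in [set: Z2]) (split_weight p K l)%:E <= (2 * (8 * 8) * (size K)%:R)%:E)%E.
Proof.
have [m hm] := cutoff_box.
rewrite (@esum_box _ _ m m); last 2 first.
- exact: split_weight_ge0.
- move=> l; rewrite /split_weight; apply: contra_neqT => lm.
  have -> : J eps l (p - l) = false by apply/negP => /and3P[/hm]; rewrite (negbTE lm).
  by rewrite mul0r.
rewrite lee_fin; apply: (@le_trans _ _ (\sum_(l <- box m m) \sum_(v <- K) (weight R l v + weight R (p - l) v))).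
  apply: ler_sum => l _; rewrite /split_weight; case: (J _ _ _); rewrite ?mul1r// mul0r.
  by rewrite sumr_ge0// => v _; rewrite addr_ge0// ltW// weight_gt0.
rewrite exchange_big/= mulrC.
apply: (@le_trans _ _ (\sum_(v <- K) (2 * (8 * 8)))); first by apply: ler_sum => v _; exact: sum_weight_le.
by rewrite big_const_seq count_predT iter_addr addr0 (mulr_natl _ (size K)).
Qed.

(** The square of [size k] is what the number operator pays for: [n] spectators from the Schur sum
    and the factor [n + 2] of [off_diagonal_term], with [n * (n + 2) <= (n + 1) ^+ 2] for
    [size k = n + 1]. *)
Definition off_head (k : seq Z2) : R :=
  (size k)`!%:R * (8 * 30 * lambda eps ^+ 2 * ((size k)%:R ^+ 2 * h k)).

Lemma off_head_ge0 k : 0 <= off_head k.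
Proof.
apply: mulr_ge0 => //; apply: mulr_ge0; first by apply: mulr_ge0 (sqr_ge0 _).
by apply: mulr_ge0 (sqr_ge0 _) (h0 k).
Qed.

Lemma off_diagonal_le : (\esum_(k in [set: seq Z2]) (off_diagonal_term h k)%:E <=
  (16 * 30 * w2 w * lambda eps ^+ 2)%:E * E)%E.
Proof.
pose Phi (k : seq Z2) : R := if k is l :: m :: K then
  wdot w (l + m) ^+ 2 * (J eps l m)%:R * h ((l + m) :: K) *
    \sum_(v <- K) (weight R l v + weight R m v) else 0.
have Phi0 k : 0 <= Phi k.
  case: k => [|l [|m K]]//=; apply: mulr_ge0.
    by apply: mulr_ge0 => //; apply: mulr_ge0 => //; exact: sqr_ge0.
  by apply: sumr_ge0 => v _; apply: addr_ge0; apply: ltW; exact: weight_gt0.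
pose b n : R := image_coef n * (15 * n%:R).
have b0 n : 0 <= b n by apply: mulr_ge0; [exact: image_coef_ge0|exact: mulr_ge0].
have -> : (\esum_(k in [set: seq Z2]) (off_diagonal_term h k)%:E =
    \esum_(k in [set: seq Z2]) (b (size k) *
    \sum_(i < size k) \sum_(j < size k | (i < j)%N)
      Phi (nth 0 k i :: nth 0 k j :: remove2 i j k))%:E)%E.
  apply: eq_esum => k _; congr (_%:E); congr (_ * _).
  apply: eq_bigr => i _; apply: eq_bigr => j ij.
  by rewrite sum_pair_weightE.
rewrite esum_pairs//.
apply: (@le_trans _ _ (\esum_(K in [set: seq Z2]) \esum_(p in [set: Z2])
    ((size K).+1%:R * (off_head (p :: K) * wdot w p ^+ 2))%:E)%E).
  apply: le_esum => K _; apply: le_esum => p _.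
  pose c := b (size K).+2 * 'C((size K).+2, 2)%:R * (wdot w p ^+ 2 * h (p :: K)).
  have c0 : 0 <= c.
    by apply: mulr_ge0; apply: mulr_ge0 => //; exact: sqr_ge0.
  have -> : (\esum_(l in [set: Z2]) (b (size K).+2 * 'C((size K).+2, 2)%:R * Phi [:: l, p - l & K])%:E
      = \esum_(l in [set: Z2]) (c * split_weight p K l)%:E)%E.
    apply: eq_esum => l _; congr (_%:E); rewrite /Phi /c /split_weight (addrC l) subrK; ring.
  rewrite esum_EFinZl//; last exact: split_weight_ge0.
  have c0' : (0 <= c%:E)%E by rewrite lee_fin.
  apply: (le_trans (lee_wpmul2l c0' (esum_split_weight_le p K))).
  rewrite -EFinM lee_fin /c /b /off_head /=.
  have p4 := pi2_ge4.
  set n := size K; set x := h _; set y := wdot w p ^+ 2.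
  (* [8 * 30 * 4] is half of [15 * (2 * (8 * 8))]; the [4] is then absorbed by [pi ^+ 2]. *)
  have -> : image_coef n.+2 * (15 * n.+2%:R) * 'C(n.+2, 2)%:R * (y * x) * (2 * (8 * 8) * n%:R) =
     n.+1%:R * (n.+1`!%:R * (lambda eps ^+ 2 * (x * y))) * (8 * 30 * 4 * (n%:R * n.+2%:R)) / pi ^+ 2.
    transitivity (image_coef n.+2 * 'C(n.+2, 2)%:R *
      (15 * n.+2%:R * (y * x) * (2 * (8 * 8) * n%:R))); first by ring.
    rewrite image_coef_bin; have : pi ^+ 2 != 0 :> R by rewrite gt_eqF//; lra.
    by rewrite sqrf_eq0; move: pi => q q0; field.
  rewrite ler_pdivrMr; last by lra.
  have -> : n.+1%:R * (n.+1`!%:R * (8 * 30 * lambda eps ^+ 2 * (n.+1%:R ^+ 2 * x)) * y) * pi ^+ 2 =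
     n.+1%:R * (n.+1`!%:R * (lambda eps ^+ 2 * (x * y))) * (8 * 30 * (n.+1%:R ^+ 2 * pi ^+ 2)).
    ring.
  apply: ler_wpM2l.
    apply: mulr_ge0 => //; apply: mulr_ge0 => //; apply: mulr_ge0 (sqr_ge0 _) _.
    by apply: mulr_ge0 (h0 _) (sqr_ge0 _).
  have n0 : 0 <= n%:R :> R by [].
  have q4 : 0 <= pi ^+ 2 - 4 :> R by lra.
  have := mulr_ge0 (sqr_ge0 (n%:R + 1 : R)) q4; rewrite -(natr1 n.+1) -(natr1 n).
  by move: (pi ^+ 2) (n%:R : R) => q z; nra.
rewrite (@esum_head _ off_head (fun p => wdot w p ^+ 2)); last 3 first.
- exact: off_head_ge0.
- by move=> l; exact: sqr_ge0.
- by move=> k k' kk'; rewrite /off_head (perm_size kk') (h_perm kk').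
have W0 := w0.
apply: esum_energy_term_le => [|k].
  by apply: mulr_ge0 (sqr_ge0 _); apply: mulr_ge0 => //; exact: ltW.
have -> : off_head k * \sum_(l <- k) wdot w l ^+ 2 =
    (size k)`!%:R * (16 * 30 * lambda eps ^+ 2 * ((size k)%:R ^+ 2 * h k)) * (- L0w w k).
  by rewrite L0wE /off_head; field.
have -> : 16 * 30 * w2 w * lambda eps ^+ 2 * energy_term h k =
    (size k)`!%:R * (16 * 30 * lambda eps ^+ 2 * ((size k)%:R ^+ 2 * h k)) * (w2 w * - L0 R k).
  rewrite /energy_term; ring.
apply: ler_wpM2l (L0w_le k).
apply: mulr_ge0 => //; apply: mulr_ge0; first by apply: mulr_ge0 (sqr_ge0 _).
by apply: mulr_ge0 (sqr_ge0 _) (h0 k).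
Qed.

(** A crude bound with a constant depending on [eps]: only finiteness matters, to allow the later
    subtractions. *)
Lemma drift_lty : (E < +oo)%E -> (\esum_(k in [set: seq Z2]) (drift_term h k)%:E < +oo)%E.
Proof.
move=> Eoo; have W0 := w0; have [e0 e1] := andP e01; have l0 := lambda2_gt0 e01.
pose c := 2 * w2 w * lambda eps ^+ 2 / eps ^+ 2.
have e20 : 0 < eps ^+ 2 by rewrite exprn_gt0.
have c1 : 0 < 2 * w2 w * lambda eps ^+ 2 by apply: mulr_gt0 l0; apply: mulr_gt0 W0.
have c0 : 0 <= c by apply: divr_ge0; exact: ltW.
apply: (@le_lt_trans _ _ (c%:E * E)%E); last by rewrite lte_mul_pinfty.
apply: esum_energy_term_le => // k.
have [hk|hk] := eqVneq (h k) 0; first by rewrite /drift_term /energy_term hk !mulr0.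
have [->|kn] := eqVneq k [::].
  rewrite {1}/drift_term L0wE big_nil mulr0 mul0r mul0r mulr0.
  by apply: mulr_ge0 c0 (energy_term_ge0 _).
have n1 : 1 <= (size k)%:R ^+ 2 :> R by rewrite exprn_ege1// ler1n lt0n size_eq0.
have L1 : 2^-1 <= - L0 R k.
  rewrite L0E -[X in X <= _]mulr1 ler_pM2l ?invr_gt0//.
  case: k hk kn {n1} => [|l k] hk kn; first by rewrite eqxx in kn.
  have l0' : l != 0 by apply: contraNneq hk => l0'; rewrite h_zero// l0' mem_head.
  rewrite big_cons; apply: (le_trans (norm2_ge1 R l0')); rewrite lerDl.
  by apply: sumr_ge0 => m _; exact: norm2_ge0.
have L0p : 0 < - L0 R k by lra.
have GL : Geps w eps k <= 2 * lambda eps ^+ 2 / eps ^+ 2.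
  apply: (le_trans (G_le w0 (Leps_ge0 e01 L0p))); apply: (le_trans (Leps_le e01 L0p)).
  have eL : 0 < eps ^+ 2 * - L0 R k by apply: mulr_gt0 e20 L0p.
  rewrite ler_pdivrMr//.
  have -> : 2 * lambda eps ^+ 2 / eps ^+ 2 * (eps ^+ 2 * - L0 R k) =
      lambda eps ^+ 2 * (2 * - L0 R k) by field; rewrite -sqrf_eq0 gt_eqF.
  by rewrite ler_peMr ?(ltW l0)//; lra.
have -> : c * energy_term h k = (size k)`!%:R *
   (w2 w * - L0 R k * (2 * lambda eps ^+ 2 / eps ^+ 2 * (size k)%:R ^+ 2) * h k).
  by rewrite /c /energy_term; ring.
apply: ler_wpM2l => //; apply: ler_wpM2r => //.
apply: ler_pM (L0w_ge0 k) (Geps_ge0 k) (L0w_le k) _.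
apply: (le_trans GL); rewrite ler_peMr// divr_ge0 ?ltW//; exact: mulr_gt0.
Qed.

Lemma diagonal_lty : (E < +oo)%E -> (\esum_(k in [set: seq Z2]) (diagonal_term h k)%:E < +oo)%E.
Proof.
move=> Eoo; apply: (le_lt_trans diagonal_le); rewrite lte_add_pinfty ?drift_lty//.
rewrite lte_mul_pinfty//; have := pair_const_ge0; have := ltW w0; have := sqr_ge0 (lambda eps).
by move=> a b c; rewrite lee_fin; apply: mulr_ge0 a; apply: mulr_ge0.
Qed.

Lemma off_diagonal_lty : (E < +oo)%E ->
  (\esum_(k in [set: seq Z2]) (off_diagonal_term h k)%:E < +oo)%E.
Proof.
move=> Eoo; apply: (le_lt_trans off_diagonal_le).
rewrite lte_mul_pinfty//; have := ltW w0; have := sqr_ge0 (lambda eps).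
by move=> a b; rewrite lee_fin; apply: mulr_ge0 a; apply: mulr_ge0.
Qed.

End symmetric_families.

(** * Symmetry of the Fourier coefficients *)

Section permutation_invariance.
Local Open Scope classical_set_scope.
Variable R : realType.

Definition tuple_box n (A : 'I_n -> set (plane R)) : set (n.-tuple (plane R)) :=
  [set x | forall i, A i (tnth x i)].

Lemma measurable_tuple_box n (A : 'I_n -> set (plane R)) :
  (forall i, measurable (A i)) -> measurable (tuple_box A).
Proof.
move=> mA; have -> : tuple_box A = \bigcap_(i in [set: 'I_n]) ((@tnth n _ ^~ i) @^-1` A i).
  by apply/seteqP; split => [x Ax i _|x Ax i]; [exact: Ax|exact: Ax].
apply: fin_bigcap_measurable => // i _.
by rewrite -[X in measurable X]setTI; exact: measurable_tnth.
Qed.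

Lemma measurable_tupleE n : @measurable _ (n.-tuple (plane R)) =
  <<s [set B | exists2 A : 'I_n -> set (plane R), (forall i, measurable (A i)) & B = tuple_box A] >>.
Proof.
apply/seteqP; split; last first.
  apply: smallest_sub; first exact: sigma_algebra_measurable.
  by move=> _ [A mA ->]; exact: measurable_tuple_box.
apply: smallest_sub; first exact: smallest_sigma_algebra.
rewrite -bigcup_seq/= => B [i _ [C mC <-]].
apply: sub_sigma_algebra; exists (fun j => if j == i then C else setT).
  by move=> j; case: ifP.
apply/seteqP; split => [x [_ /= xC] j|x /= xA].
  by case: eqP => // ->.
by split => //=; have := xA i; rewrite eqxx.
Qed.

Lemma torus_box n (A : 'I_n -> set (plane R)) : (forall i, measurable (A i)) ->
  (torus R n (tuple_box A) = \prod_(i < n) torus1 R (A i))%E.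
Proof.
elim: n A => [|n IHn] A mA.
  rewrite big_ord0 /= diracE mem_set// => -[]//.
rewrite big_ord_recl -IHn; last by [].
have e : @tcons R n @^-1` tuple_box A = A ord0 `*` tuple_box (fun i => A (lift ord0 i)).
  apply/seteqP; split => [[y x] /= Ayx|[y x] /= [Ay Ax] i].
    split=> [|i]; first by have := Ayx ord0.
    by have := Ayx (lift ord0 i); rewrite tnthS.
  by case: (unliftP ord0 i) => [j|] ->; rewrite ?tnthS//; exact: Ax.
transitivity ((torus1 R \x torus R n)%E (@tcons R n @^-1` tuple_box A)); first by [].
by rewrite e product_measure1E//; apply: measurable_tuple_box.
Qed.

Definition permute n (s : 'S_n) (x : n.-tuple (plane R)) : n.-tuple (plane R) :=
  [tuple tnth x (s i) | i < n].

Lemma measurable_permute n (s : 'S_n) : measurable_fun setT (permute s).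
Proof.
apply/measurable_fun_tnthP => i.
rewrite (_ : _ \o _ = @tnth n _ ^~ (s i)); first exact: measurable_tnth.
by apply/funext => x /=; rewrite tnth_mktuple.
Qed.

Section permuted_measure.
Variables (n : nat) (s : 'S_n).

Definition permuted : set (n.-tuple (plane R)) -> \bar R :=
  pushforward (torus R n) (permute s).

Let measurable_preimage A : measurable A -> measurable (permute s @^-1` A).
Proof. by move=> mA; rewrite -[X in measurable X]setTI; exact: measurable_permute. Qed.

Let permuted0 : permuted set0 = 0%E.
Proof. by rewrite /permuted /pushforward preimage_set0 measure0. Qed.

Let permuted_ge0 A : (0 <= permuted A)%E.
Proof. by rewrite /permuted /pushforward measure_ge0. Qed.

Let permuted_sigma_additive : semi_sigma_additive permuted.
Proof.
move=> F mF tF mUF; rewrite /permuted /pushforward preimage_bigcup.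
apply: measure_semi_sigma_additive.
- by move=> k; exact: measurable_preimage.
- apply/trivIsetP => /= i j _ _ ij; rewrite -preimage_setI.
  by move/trivIsetP : tF => /(_ _ _ _ _ ij) ->//; rewrite preimage_set0.
- by rewrite -preimage_bigcup; exact: measurable_preimage.
Qed.

HB.instance Definition _ := isMeasure.Build _ _ _ permuted
  permuted0 permuted_ge0 permuted_sigma_additive.

(** [torus] adds one coordinate at a time, so its symmetry is not built in. Boxes form a generating
    class stable under intersection, and there the mass is a commutative product. *)
Lemma torus_permute B : measurable B -> permuted B = torus R n B.
Proof.
move=> mB; apply/esym; apply: (measure_unique
  [set B | exists2 A : 'I_n -> set (plane R), (forall i, measurable (A i)) & B = tuple_box A]
  (fun=> setT)) mB.
- exact: measurable_tupleE.
- move=> _ _ [A mA ->] [A' mA' ->]; exists (fun i => A i `&` A' i).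
    by move=> i; exact: measurableI.
  by apply/seteqP; split => [x [h h'] i|x h]; [split|split => i; case: (h i)].
- by move=> _; exists (fun=> setT) => //; apply/seteqP; split.
- by rewrite bigcup_const//; exists 0%N.
- move=> _ [A mA ->].
  change (torus R n (tuple_box A) = torus R n (permute s @^-1` tuple_box A)).
  have -> : permute s @^-1` tuple_box A = tuple_box (fun j => A ((s^-1)%g j)).
    apply/seteqP; split => [x /= h j|x h j /=].
      by have := h ((s^-1)%g j); rewrite tnth_mktuple permKV.
    by have := h (s j); rewrite tnth_mktuple permK.
  rewrite !torus_box//.
  by rewrite (reindex_inj (@perm_inj _ (s^-1)%g)).
- by move=> _; rewrite -ge0_fin_numE// fin_num_measure.
Qed.

Lemma integral_permute (f : n.-tuple (plane R) -> \bar R) : measurable_fun setT f ->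
  (\int[torus R n]_x f (permute s x) = \int[torus R n]_x f x)%E.
Proof.
have ge0 (g : n.-tuple (plane R) -> \bar R) : measurable_fun setT g -> (forall x, 0 <= g x)%E ->
    (\int[torus R n]_x g (permute s x) = \int[torus R n]_x g x)%E.
  move=> mg g0; transitivity (\int[permuted]_x g x)%E; last first.
    by apply: eq_measure_integral => A mA _; exact: torus_permute.
  by rewrite /permuted (ge0_integral_pushforward (@measurable_permute n s))// preimage_setT.
move=> mf; rewrite [LHS]integralE [RHS]integralE; congr (_ - _)%E.
- rewrite -(ge0 _ (measurable_funepos mf)) => [|x]; last exact: funepos_ge0.
  by apply: eq_integral => x _; rewrite !funeposE.
- rewrite -(ge0 _ (measurable_funeneg mf)) => [|x]; last exact: funeneg_ge0.
  by apply: eq_integral => x _; rewrite !funenegE.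
Qed.

End permuted_measure.

End permutation_invariance.

(** * Fourier coefficients under permutations *)

Section fourier_symmetry.
Variable R : realType.

Definition cmeasurable d (T : measurableType d) (f : T -> R[i]) : Prop :=
  measurable_fun setT (fun x => complex.Re (f x)) /\
  measurable_fun setT (fun x => complex.Im (f x)).

Lemma cmeasurableM d (T : measurableType d) (f g : T -> R[i]) :
  cmeasurable f -> cmeasurable g -> cmeasurable (fun x => f x * g x).
Proof.
move=> [f1 f2] [g1 g2]; split.
- rewrite (_ : (fun x => _) = (fun x => complex.Re (f x) * complex.Re (g x) -
    complex.Im (f x) * complex.Im (g x))).
    by apply: measurable_funB; exact: measurable_funM.
  by apply/funext => x; case: (f x) (g x) => [a b] [c e].
- rewrite (_ : (fun x => _) = (fun x => complex.Re (f x) * complex.Im (g x) +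
    complex.Im (f x) * complex.Re (g x))).
    by apply: measurable_funD; exact: measurable_funM.
  by apply/funext => x; case: (f x) (g x) => [a b] [c e].
Qed.

Lemma cmeasurable_prod d (T : measurableType d) n (f : 'I_n -> T -> R[i]) :
  (forall i, cmeasurable (f i)) -> cmeasurable (fun x => \prod_(i < n) f i x).
Proof.
elim: n f => [|n IHn] f mf.
  rewrite (_ : (fun x => _) = (fun=> 1)); last by apply/funext => x; rewrite big_ord0.
  by split; exact: measurable_cst.
rewrite (_ : (fun x => _) = (fun x => f ord0 x * \prod_(i < n) f (lift ord0 i) x)).
  by apply: cmeasurableM => //; exact: IHn.
by apply/funext => x; rewrite big_ord_recl.
Qed.

Lemma cmeasurable_expo (k : Z2) : cmeasurable (@expo R k).
Proof.
have mt : measurable_fun setT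
    (fun x : plane R => (k.1%:~R * x.1 + k.2%:~R * x.2 : R)).
  by apply: measurable_funD; apply: measurable_funM => //.
split; rewrite /expo/=; apply: measurable_funM => //.
- by apply: (measurableT_comp _ mt); apply: continuous_measurable_fun; exact: continuous_cos.
- by apply: (measurableT_comp _ mt); apply: continuous_measurable_fun; exact: continuous_sin.
Qed.

(** Permuting the frequencies permutes the variables of the exponential by [s^-1]. The same
    permutation can be put on [f] almost everywhere, and the invariance of the measure removes it
    from the whole integrand. *)
Lemma fourier_perm n (f : n.-tuple (plane R) -> R[i]) (s : 'S_n) (k : n.-tuple Z2) :
  chaos f -> fourier f [tuple tnth k (s i) | i < n] = fourier f k.
Proof.
move=> [mf1 mf2 _ symf _].
pose e (x : n.-tuple (plane R)) : R[i] := \prod_(j < n) expo (- tnth k j) (tnth x j).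
have mef : cmeasurable e.
  apply: cmeasurable_prod => i.
  have [h1 h2] := cmeasurable_expo (- tnth k i).
  by split; [apply: (measurableT_comp h1); exact: measurable_tnth|
             apply: (measurableT_comp h2); exact: measurable_tnth].
have me : cmeasurable (fun x => f x * e x) by exact: cmeasurableM.
have eE x : \prod_(j < n) expo (- tnth [tuple tnth k (s i) | i < n] j) (tnth x j) =
    e (permute (s^-1)%g x).
  rewrite /e (reindex_inj (@perm_inj _ (s^-1)%g)); apply: eq_bigr => j _.
  by rewrite !tnth_mktuple permKV.
pose t := (s^-1)%g.
have mP (P : R[i] -> R) (g : n.-tuple (plane R) -> R[i]) :
    measurable_fun setT (fun x => P (g x)) -> measurable_fun setT (fun x => P (g (permute t x))).
  by move=> mP; exact: (measurableT_comp mP (measurable_permute t)).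
have part (P : R[i] -> R) :
    (forall h : n.-tuple (plane R) -> R[i], cmeasurable h -> measurable_fun setT (fun x => P (h x))) ->
    (\int[torus R n]_x P (f x * \prod_(j < n) expo (- tnth [tuple tnth k (s i) | i < n] j) (tnth x j)))%R =
    (\int[torus R n]_x P (f x * e x))%R.
  move=> hP.
  have mE : measurable_fun setT (fun x => (P (f x * e x))%:E).
    by apply/measurable_EFinP; exact: (hP _ me).
  rewrite /Rintegral -(integral_permute t mE); congr fine.
  have -> : (fun x => (P (f x * \prod_(j < n) expo (- tnth [tuple tnth k (s i) | i < n] j) (tnth x j)))%:E) =
      (fun x => (P (f x * e (permute t x)))%:E).
    by apply/funext => x; rewrite eE.
  have met : cmeasurable (fun x => e (permute t x)).
    by case: mef => m1 m2; split; apply: mP.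
  apply: ae_eq_integral => //.
  - by apply/measurable_EFinP; apply: (hP (fun x => f x * e (permute t x))); exact: cmeasurableM.
  - by apply/measurable_EFinP; apply: (mP P (fun x => f x * e x)); exact: hP.
  - by apply: filterS (symf t) => x fx _; rewrite /= -[f x]fx.
by rewrite /fourier /cintegral; congr Complex; apply: part => h [].
Qed.

Lemma fhat_perm (psi : forall n, n.-tuple (plane R) -> R[i]) (k k' : seq Z2) :
  GammaL2 psi -> perm_eq k k' -> fhat psi k = fhat psi k'.
Proof.
move=> [cpsi _] kk'; have sk := perm_size kk'.
have /tuple_permP[s e] : perm_eq (in_tuple k) (in_tuple k') by [].
move: (cpsi (size k')) => ch; rewrite /fhat -(fourier_perm s _ ch).
(* The two coefficients involve components of [psi] indexed by [size k] and [size k']; a cast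
   bridges them until the equality of sizes is eliminated. *)
have -> : [tuple tnth (in_tuple k') (s i) | i < size k'] = tcast sk (in_tuple k).
  by apply: val_inj; rewrite -[LHS]e; apply: esym; exact: val_tcast.
by move: (size k') sk => m sk; case: m / sk; rewrite tcast_id.
Qed.

End fourier_symmetry.

(** * The sesquilinear form *)

Section modulus.
Variable R : realType.
Implicit Type z : R[i].

Lemma normc_ge0 z : 0 <= normc z.
Proof. by case: z => a b; exact: sqrtr_ge0. Qed.

Lemma normc_real (a : R) : normc a%:C%C = `|a|.
Proof. by rewrite /= expr0n addr0 sqrtr_sqr. Qed.

Lemma normcJ z : normc (conjc z) = normc z.
Proof. by case: z => a b /=; rewrite sqrrN. Qed.

Lemma Re_le_normc z : `|complex.Re z| <= normc z.
Proof.
by case: z => a b /=; rewrite -sqrtr_sqr ler_sqrt ?lerDl ?sqr_ge0// addr_ge0 ?sqr_ge0.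
Qed.

Lemma Im_le_normc z : `|complex.Im z| <= normc z.
Proof.
by case: z => a b /=; rewrite -sqrtr_sqr ler_sqrt ?lerDr ?sqr_ge0// addr_ge0 ?sqr_ge0.
Qed.

Lemma normc_le_ReIm z : normc z <= `|complex.Re z| + `|complex.Im z|.
Proof.
case: z => a b /=; have := normr_ge0 a; have := normr_ge0 b.
rewrite -(real_normK (num_real a)) -(real_normK (num_real b)); move: `|a| `|b| => x y y0 x0.
have xy : 0 <= x + y by lra.
rewrite -[leRHS]ger0_norm// -sqrtr_sqr ler_sqrt ?sqr_ge0//; nra.
Qed.

Lemma normc_sum (I : Type) (r : seq I) (P : pred I) (F : I -> R[i]) :
  normc (\sum_(i <- r | P i) F i) <= \sum_(i <- r | P i) normc (F i).
Proof.
elim/big_ind2 : _ => //; first by rewrite Normc.normc0.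
by move=> x a y b xa yb; apply: le_trans (le_normcD _ _) _; exact: lerD.
Qed.

Lemma complex_natr n : (n%:R : R[i]) = (n%:R : R)%:C%C.
Proof. by rewrite rmorph_nat. Qed.

Lemma complex_bool (b : bool) : (b%:R : R[i]) = (b%:R : R)%:C%C.
Proof. by case: b. Qed.

End modulus.

(** * Decomposition of the form *)

Section form_terms.
Variables (R : realType) (w : R * R) (eps : R).
Hypotheses (w0 : 0 < w2 w) (e01 : 0 < eps < 1).

Definition merged (f : seq Z2 -> R[i]) (k : seq Z2) (i j : nat) : R[i] :=
  (wdot w (nth 0 k i + nth 0 k j))%:C%C * (J eps (nth 0 k i) (nth 0 k j))%:R *
  f ((nth 0 k i + nth 0 k j) :: remove2 i j k).

Definition product (f g : seq Z2 -> R[i]) (k : seq Z2) : R[i] := f k * conjc (g k).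

Lemma normc_product f g k : normc (product f g k) = normc (f k) * normc (g k).
Proof. by rewrite Normc.normcM normcJ. Qed.

Lemma pairing_AplusE f g k :
  pairing_term (multiplier (resolvent w eps) (Aplus w eps f)) (Aplus w eps g) k =
  (image_coef eps (size k) * resolvent w eps k)%:C%C *
  \sum_(e : 'I_(size k) * 'I_(size k) | (e.1 < e.2)%N)
  \sum_(e' : 'I_(size k) * 'I_(size k) | (e'.1 < e'.2)%N)
     merged f k e.1 e.2 * conjc (merged g k e'.1 e'.2).
Proof.
rewrite /pairing_term /multiplier /Aplus.
have pairE (F : nat -> nat -> R[i]) : \sum_(i < size k) \sum_(j < size k | (i < j)%N) F i j =
    \sum_(e : 'I_(size k) * 'I_(size k) | (e.1 < e.2)%N) F e.1 e.2.
  by rewrite (pair_big_dep xpredT (fun i j : 'I_(size k) => (i < j)%N)).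
have -> : \sum_(i < size k) \sum_(j < size k | (i < j)%N)
      (wdot w (nth 0 k i + nth 0 k j))%:C%C * (J eps (nth 0 k i) (nth 0 k j))%:R *
      f ((nth 0 k i + nth 0 k j) :: remove2 i j k) = _ := pairE (merged f k).
have -> : \sum_(i < size k) \sum_(j < size k | (i < j)%N)
      (wdot w (nth 0 k i + nth 0 k j))%:C%C * (J eps (nth 0 k i) (nth 0 k j))%:R *
      g ((nth 0 k i + nth 0 k j) :: remove2 i j k) = _ := pairE (merged g k).
rewrite -big_distrlr/=.
have -> : \sum_(e : 'I_(size k) * 'I_(size k) | (e.1 < e.2)%N) conjc (merged g k e.1 e.2) =
    conjc (\sum_(e : 'I_(size k) * 'I_(size k) | (e.1 < e.2)%N) merged g k e.1 e.2).
  by rewrite rmorph_sum.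
move: (\sum_(_ | _) merged f k _ _) (\sum_(_ | _) merged g k _ _) => S T.
have c2 : Complex 0 (- (2 / (2 * pi))) * conjc (Complex 0 (- (2 / (2 * pi)))) =
    (pi^-1 ^+ 2 : R)%:C%C.
  rewrite /= invfM mulrA divff// mul1r.
  by move: (pi^-1) => p; apply/eqP; rewrite eq_complex /=; apply/andP; split; apply/eqP; ring.
move: (Complex 0 (- (2 / (2 * pi)))) c2 => D c2.
have conjM (x y : R[i]) : conjc (x * y) = conjc x * conjc y by rewrite rmorphM.
rewrite 2!conjM conjc_real complex_natr /image_coef.
have -> : (size k)`!%:R * (lambda eps ^+ 2 / (pi ^+ 2 * (size k)%:R ^+ 2)) * resolvent w eps k =
    (size k)`!%:R * resolvent w eps k * (lambda eps / (size k)%:R) ^+ 2 * pi^-1 ^+ 2.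
  by rewrite exprMn invfM !exprVn; ring.
move: (lambda eps / _) => l; rewrite 3!rmorphM (rmorphXn _ 2) /= -c2.
move: (conjc T) (conjc D) => T' D'; ring.
Qed.

(** On coinciding pairs the form depends on [f] and [g] only through [product f g], with a
    nonnegative weight; its components can therefore be treated as signed densities. *)
Lemma merged_diagonal f g k i j : merged f k i j * conjc (merged g k i j) =
  (wdot w (nth 0 k i + nth 0 k j) ^+ 2 * (J eps (nth 0 k i) (nth 0 k j))%:R)%:C%C *
  product f g ((nth 0 k i + nth 0 k j) :: remove2 i j k).
Proof.
have conjM (x y : R[i]) : conjc (x * y) = conjc x * conjc y by rewrite rmorphM.
rewrite /merged /product 2!conjM conjc_real conjc_nat rmorphM (rmorphXn _ 2) /= -complex_bool.
by case: (J _ _ _); rewrite ?mulr1 ?mulr0 ?mul0r//; ring.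
Qed.

Lemma normc_merged2 f k i j :
  normc (merged f k i j) ^+ 2 = pair_energy w eps (fun k => normc (f k) ^+ 2) k i j.
Proof.
rewrite /merged 2!Normc.normcM complex_bool !normc_real 2!exprMn real_normK ?num_real// /pair_energy.
by case: (J _ _ _); rewrite ?normr1 ?normr0 ?expr1n ?expr0n.
Qed.

Lemma merged_supp f k i j : normc (merged f k i j) != 0 -> nth 0 k i != 0 /\ nth 0 k j != 0.
Proof.
have [e0 e1] := andP e01.
rewrite /merged; case: (boolP (J _ _ _)) => [/and3P[]|]; last by rewrite mulr0 mul0r Normc.normc0 eqxx.
by rewrite !cutoffE// => /andP[-> _] /andP[-> _].
Qed.

Lemma normc_off_diagonal (f g : seq Z2 -> R[i]) (t : R) (k : seq Z2) : 0 < t ->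
  image_coef eps (size k) * resolvent w eps k *
  normc (\sum_(e : 'I_(size k) * 'I_(size k) | (e.1 < e.2)%N)
  \sum_(e' : 'I_(size k) * 'I_(size k) | (e'.1 < e'.2)%N && (e' != e))
     merged f k e.1 e.2 * conjc (merged g k e'.1 e'.2)) <=
  off_diagonal_term w eps (fun k => t * normc (f k) ^+ 2 + t^-1 * normc (g k) ^+ 2) k.
Proof.
move=> t_gt0; rewrite /off_diagonal_term -(mulrA (image_coef _ _) (resolvent _ _ _)) -(mulrA (image_coef _ _)).
apply: ler_wpM2l; first exact: image_coef_ge0.
pose z (e : 'I_(size k) * 'I_(size k)) := normc (merged f k e.1 e.2).
pose y (e : 'I_(size k) * 'I_(size k)) := normc (merged g k e.1 e.2).
apply: (@le_trans _ _ (resolvent w eps k *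
    \sum_(e : 'I_(size k) * 'I_(size k) | (e.1 < e.2)%N)
    \sum_(e' : 'I_(size k) * 'I_(size k) | (e'.1 < e'.2)%N && (e' != e)) z e * y e')).
  apply: ler_wpM2l; first exact: resolvent_ge0.
  apply: (le_trans (normc_sum _ _ _)); apply: ler_sum => e _.
  apply: (le_trans (normc_sum _ _ _)); apply: ler_sum => e' _.
  by rewrite Normc.normcM normcJ.
apply: (le_trans (@off_diagonal_bound R k (resolvent w eps k) _ z y t _ _ t_gt0 _ _)).
- exact: resolvent_le.
- by move=> e; exact: normc_ge0.
- by move=> e; exact: normc_ge0.
- by move=> e; exact: merged_supp.
- by move=> e; exact: merged_supp.
apply: ler_wpM2l; first exact: mulr_ge0.
rewrite (pair_big_dep xpredT (fun i j : 'I_(size k) => (i < j)%N))/= le_eqVlt; apply/orP; left; apply/eqP.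
apply: eq_bigr => -[i j] _; rewrite /z /y /= !normc_merged2; congr (_ * _).
rewrite /pair_energy; ring.
Qed.

Section component.
Variables (f g : seq Z2 -> R[i]) (t : R).
Hypotheses (f_perm : forall k k', perm_eq k k' -> f k = f k')
           (g_perm : forall k k', perm_eq k k' -> g k = g k').
Hypotheses (f_zero : forall k, 0 \in k -> f k = 0) (g_zero : forall k, 0 \in k -> g k = 0).
Hypothesis t_gt0 : 0 < t.

(** A majorant of [|f * conjc g|] that is additive in the two energies; [t] stays free until the
    end. *)
Definition mean_sqr (k : seq Z2) : R := t * normc (f k) ^+ 2 + t^-1 * normc (g k) ^+ 2.

Local Notation E h := (\esum_(k in [set: seq Z2]) (energy_term h k)%:E)%E.
Hypothesis mean_lty : (E mean_sqr < +oo)%E.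

Lemma mean_sqr_ge0 k : 0 <= mean_sqr k.
Proof.
have := t_gt0; rewrite -invr_gt0 => tV; apply: addr_ge0; apply: mulr_ge0 (sqr_ge0 _); exact: ltW.
Qed.

Lemma mean_sqr_perm k k' : perm_eq k k' -> mean_sqr k = mean_sqr k'.
Proof. by move=> kk'; rewrite /mean_sqr (f_perm kk') (g_perm kk'). Qed.

Lemma mean_sqr_zero k : 0 \in k -> mean_sqr k = 0.
Proof.
by move=> k0; rewrite /mean_sqr (f_zero k0) (g_zero k0) Normc.normc0 expr0n !mulr0 addr0.
Qed.

Lemma normc_product_le k : normc (product f g k) <= mean_sqr k.
Proof.
have := t_gt0; rewrite -invr_gt0 => tV; have t0 := t_gt0.
rewrite normc_product /mean_sqr; have := normc_ge0 (f k); have := normc_ge0 (g k).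
move: (normc (f k)) (normc (g k)) => x y y0 x0.
have tt : t * t^-1 = 1 by rewrite divff// gt_eqF.
have := sqr_ge0 (t * x - y); have := mulr_ge0 x0 y0 => xy h.
have : 0 <= t^-1 * (t * x - y) ^+ 2 by apply: mulr_ge0 => //; exact: ltW.
have -> : t^-1 * (t * x - y) ^+ 2 = (t * t^-1) * (t * x ^+ 2) - 2 * (t * t^-1) * (x * y) + t^-1 * y ^+ 2 by ring.
by rewrite tt; lra.
Qed.

(** [X] stands for the real or the imaginary part. *)
Variable X : R[i] -> R.
Hypotheses (XD : forall x y, X (x + y) = X x + X y) (XZ : forall (a : R) x, X (a%:C%C * x) = a * X x).
Hypothesis X_le : forall x, `|X x| <= normc x.

Definition pos_part (k : seq Z2) : R := Num.max (X (product f g k)) 0.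
Definition neg_part (k : seq Z2) : R := Num.max (- X (product f g k)) 0.

Lemma pos_part_ge0 k : 0 <= pos_part k. Proof. by rewrite le_max lexx orbT. Qed.
Lemma neg_part_ge0 k : 0 <= neg_part k. Proof. by rewrite le_max lexx orbT. Qed.

Lemma pos_neg_part k : pos_part k - neg_part k = X (product f g k).
Proof.
rewrite /pos_part /neg_part; move: (X _) => x.
by case: (leP x 0) => a; case: (leP (- x) 0) => b; lra.
Qed.

Lemma component0 : X 0 = 0.
Proof. by apply/eqP; rewrite -normr_le0 (le_trans (X_le 0))// Normc.normc0. Qed.

Lemma product_perm k k' : perm_eq k k' -> product f g k = product f g k'.
Proof. by move=> kk'; rewrite /product (f_perm kk') (g_perm kk'). Qed.

Lemma product_zero k : 0 \in k -> product f g k = 0.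
Proof. by move=> k0; rewrite /product (f_zero k0) mul0r. Qed.

Lemma pos_part_perm k k' : perm_eq k k' -> pos_part k = pos_part k'.
Proof. by move=> kk'; rewrite /pos_part (product_perm kk'). Qed.

Lemma neg_part_perm k k' : perm_eq k k' -> neg_part k = neg_part k'.
Proof. by move=> kk'; rewrite /neg_part (product_perm kk'). Qed.

Lemma pos_part_zero k : 0 \in k -> pos_part k = 0.
Proof. by move=> k0; rewrite /pos_part (product_zero k0) component0 maxxx. Qed.

Lemma neg_part_zero k : 0 \in k -> neg_part k = 0.
Proof. by move=> k0; rewrite /neg_part (product_zero k0) component0 oppr0 maxxx. Qed.

Lemma pos_part_le k : pos_part k <= mean_sqr k.
Proof.
rewrite ge_max mean_sqr_ge0 andbT.
exact: le_trans (ler_norm _) (le_trans (X_le _) (normc_product_le k)).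
Qed.

Lemma neg_part_le k : neg_part k <= mean_sqr k.
Proof.
rewrite ge_max mean_sqr_ge0 andbT.
apply: le_trans (ler_norm _) _; rewrite normrN.
exact: le_trans (X_le _) (normc_product_le k).
Qed.

Lemma energy_le (h h' : seq Z2 -> R) : (forall k, h k <= h' k) -> (E h <= E h')%E.
Proof.
move=> hh'; apply: le_esum_EFin => k.
by apply: ler_wpM2l => //; apply: ler_wpM2l (hh' k); apply: mulr_ge0 (sqr_ge0 _) (L0_ge0 R k).
Qed.

Lemma component_image k :
  `|X (pairing_term (multiplier (resolvent w eps) (Aplus w eps f)) (Aplus w eps g) k) -
    (diagonal_term w eps pos_part k - diagonal_term w eps neg_part k)| <=
  off_diagonal_term w eps mean_sqr k.
Proof.
rewrite pairing_AplusE XZ; set c := image_coef _ _ * _.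
have c0 : 0 <= c by apply: mulr_ge0; [exact: image_coef_ge0|exact: resolvent_ge0].
apply: le_trans (normc_off_diagonal f g k t_gt0).
have Xsum (I : Type) (r : seq I) (P : pred I) (F : I -> R[i]) :
    X (\sum_(i <- r | P i) F i) = \sum_(i <- r | P i) X (F i).
  exact: (big_morph X XD component0).
under eq_bigr => e ee do rewrite (bigD1 e)//=.
rewrite big_split/= XD -/c; set off := (Y in c * normc Y).
have -> : X (\sum_(e : 'I_(size k) * 'I_(size k) | (e.1 < e.2)%N)
     merged f k e.1 e.2 * conjc (merged g k e.1 e.2)) =
   \sum_(i < size k) \sum_(j < size k | (i < j)%N)
     (pair_energy w eps pos_part k i j - pair_energy w eps neg_part k i j).
  rewrite Xsum (pair_big_dep xpredT (fun i j : 'I_(size k) => (i < j)%N))/=.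
  apply: eq_bigr => e _; rewrite merged_diagonal XZ /pair_energy -pos_neg_part; ring.
have -> : diagonal_term w eps pos_part k - diagonal_term w eps neg_part k =
   c * \sum_(i < size k) \sum_(j < size k | (i < j)%N)
     (pair_energy w eps pos_part k i j - pair_energy w eps neg_part k i j).
  rewrite /diagonal_term -/c -mulrBr -sumrB; congr (_ * _).
  by apply: eq_bigr => i _; rewrite -sumrB.
by rewrite mulrDr addrAC subrr add0r normrM ger0_norm// ler_wpM2l.
Qed.

Lemma component_drift k :
  X (pairing_term (multiplier (fun k => L0w w k * Geps w eps k) f) g k) =
  drift_term w eps neg_part k - drift_term w eps pos_part k.
Proof.
have -> : pairing_term (multiplier (fun k => L0w w k * Geps w eps k) f) g k =
    ((size k)`!%:R * (L0w w k * Geps w eps k))%:C%C * product f g k.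
  by rewrite /pairing_term /multiplier /product complex_natr rmorphM/=; ring.
rewrite XZ -pos_neg_part /drift_term; ring.
Qed.

(** Diagonal and drift terms enter with opposite signs, separately for [pos_part] and [neg_part]. In
    each part they cancel up to one error, hence the [2 * pair_const w]; [16 * 30] comes from the
    distinct pairs. *)
Lemma component_bound :
  `|rsum (fun k => X (pairing_term (multiplier (resolvent w eps) (Aplus w eps f)) (Aplus w eps g) k)) +
    rsum (fun k => X (pairing_term (multiplier (fun k => L0w w k * Geps w eps k) f) g k))| <=
  (16 * 30 + 2 * pair_const w) * w2 w * lambda eps ^+ 2 * fine (E mean_sqr).
Proof.
have aux (t1 t2 ap an bp bn o c d : R) : `|t1 - (ap - an)| <= o -> `|t2 - (bn - bp)| <= 0 ->
    ap <= bp + c -> bp <= ap + c -> an <= bn + c -> bn <= an + c -> o <= d -> `|t1 + t2| <= d + 2 * c.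
  move=> /ler_normlP[h1 h1'] /ler_normlP[h2 h2'] h3 h4 h5 h6 h7.
  by rewrite ler_norml; apply/andP; split; lra.
have Ep := le_lt_trans (energy_le pos_part_le) mean_lty.
have En := le_lt_trans (energy_le neg_part_le) mean_lty.
have dp0 := diagonal_term_ge0 w0 e01 pos_part_ge0; have dn0 := diagonal_term_ge0 w0 e01 neg_part_ge0.
have rp0 := drift_term_ge0 w0 e01 pos_part_ge0; have rn0 := drift_term_ge0 w0 e01 neg_part_ge0.
have o0 := off_diagonal_term_ge0 w eps mean_sqr_ge0.
have dpoo := diagonal_lty w0 e01 pos_part_ge0 pos_part_perm pos_part_zero Ep.
have dnoo := diagonal_lty w0 e01 neg_part_ge0 neg_part_perm neg_part_zero En.
have rpoo := drift_lty w0 e01 pos_part_ge0 pos_part_zero Ep.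
have rnoo := drift_lty w0 e01 neg_part_ge0 neg_part_zero En.
have ooo := off_diagonal_lty w0 e01 mean_sqr_ge0 mean_sqr_perm mean_lty.
have h1 := rsum_approx dp0 dn0 o0 dpoo dnoo ooo component_image.
have z0 (k : seq Z2) : 0 <= 0 :> R by [].
have zoo : (\esum_(k in [set: seq Z2]) 0%:E < +oo :> \bar R)%E by rewrite esum1.
have d0 k : `|X (pairing_term (multiplier (fun k => L0w w k * Geps w eps k) f) g k) -
    (drift_term w eps neg_part k - drift_term w eps pos_part k)| <= 0.
  by rewrite component_drift subrr normr0.
have h2 := rsum_approx rn0 rp0 z0 rnoo rpoo zoo d0.
have fz : fine (\esum_(k in [set: seq Z2]) (0 : R)%:E)%E = 0 by rewrite esum1.
rewrite fz in h2.
have W0 := ltW w0; have l0 := sqr_ge0 (lambda eps); have c0 := pair_const_ge0 w0.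
have c1 : (0 <= (pair_const w * w2 w * lambda eps ^+ 2)%:E :> \bar R)%E.
  by rewrite lee_fin; apply: mulr_ge0 l0; apply: mulr_ge0.
have mp := lee_wpmul2l c1 (energy_le pos_part_le).
have mn := lee_wpmul2l c1 (energy_le neg_part_le).
have e0 := energy_term_ge0 mean_sqr_ge0.
have A1 := le_trans (diagonal_le w0 e01 pos_part_ge0 pos_part_perm pos_part_zero) (leeD2l _ mp).
have A2 := le_trans (drift_le w0 e01 pos_part_ge0 pos_part_perm pos_part_zero) (leeD2l _ mp).
have A3 := le_trans (diagonal_le w0 e01 neg_part_ge0 neg_part_perm neg_part_zero) (leeD2l _ mn).
have A4 := le_trans (drift_le w0 e01 neg_part_ge0 neg_part_perm neg_part_zero) (leeD2l _ mn).
have A5 := off_diagonal_le w0 e01 mean_sqr_ge0 mean_sqr_perm.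
move: A1 A2 A3 A4 A5.
rewrite -(esum_fineK dp0 dpoo) -(esum_fineK dn0 dnoo) -(esum_fineK rp0 rpoo) -(esum_fineK rn0 rnoo)
  -(esum_fineK o0 ooo) -(esum_fineK e0 mean_lty) -!EFinM -!EFinD !lee_fin /=.
move=> A1 A2 A3 A4 A5; apply: le_trans (aux _ _ _ _ _ _ _ _ _ h1 h2 A1 A2 A3 A4 A5) _.
by rewrite le_eqVlt; apply/orP; left; apply/eqP; ring.
Qed.


Lemma normc_image_le k :
  normc (pairing_term (multiplier (resolvent w eps) (Aplus w eps f)) (Aplus w eps g) k) <=
  diagonal_term w eps mean_sqr k + off_diagonal_term w eps mean_sqr k.
Proof.
rewrite pairing_AplusE Normc.normcM normc_real.
have c0 : 0 <= image_coef eps (size k) * resolvent w eps k.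
  by apply: mulr_ge0; [exact: image_coef_ge0|exact: resolvent_ge0].
rewrite (ger0_norm c0); under eq_bigr => e ee do rewrite (bigD1 e)//=.
rewrite big_split/=; apply: (le_trans (ler_wpM2l c0 (le_normcD _ _))).
rewrite mulrDr; apply: lerD; last exact: normc_off_diagonal.
apply: ler_wpM2l => //; apply: (le_trans (normc_sum _ _ _)).
rewrite (pair_big_dep xpredT (fun i j : 'I_(size k) => (i < j)%N))/=.
apply: ler_sum => e _; rewrite merged_diagonal Normc.normcM normc_real ger0_norm; last first.
  by apply: mulr_ge0 => //; exact: sqr_ge0.
apply: ler_wpM2l (normc_product_le _).
by apply: mulr_ge0 => //; exact: sqr_ge0.
Qed.

Lemma normc_drift_le k :
  normc (pairing_term (multiplier (fun k => L0w w k * Geps w eps k) f) g k) <=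
  drift_term w eps mean_sqr k.
Proof.
rewrite /pairing_term /multiplier !Normc.normcM normcJ complex_natr !normc_real /drift_term.
rewrite normr_nat -(normrN (_ * _)) -(mulNr (L0w w k)) ger0_norm; last first.
  by apply: mulr_ge0; [exact: L0w_ge0|exact: Geps_ge0].
have -> : (size k)`!%:R * (- L0w w k * Geps w eps k * normc (f k)) * normc (g k) =
    (size k)`!%:R * (- L0w w k * Geps w eps k * normc (product f g k)).
  by rewrite normc_product; ring.
apply: ler_wpM2l => //; apply: ler_wpM2l (normc_product_le k).
by apply: mulr_ge0; [exact: L0w_ge0|exact: Geps_ge0].
Qed.

Lemma form_defined : op_form_defined w eps f g.
Proof.
have m0 := mean_sqr_ge0; have mp := mean_sqr_perm; have mz := mean_sqr_zero; have ml := mean_lty.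
have d0 := diagonal_term_ge0 w0 e01 m0; have o0 := off_diagonal_term_ge0 w eps m0.
split; rewrite /pairing_summable /summable.
- apply: (@esum_EFin_lty_le _ _ _ (fun k => diagonal_term w eps mean_sqr k + off_diagonal_term w eps mean_sqr k)) => [k|k|].
  + exact: normr_ge0.
  + by rewrite ger0_norm ?normc_ge0// normc_image_le.
  + rewrite (esum_EFinD d0 o0); apply: lte_add_pinfty.
      exact: (diagonal_lty w0 e01 m0 mp mz ml).
    exact: (off_diagonal_lty w0 e01 m0 mp ml).
- apply: (@esum_EFin_lty_le _ _ _ (drift_term w eps mean_sqr)) => [k|k|].
  + exact: normr_ge0.
  + by rewrite ger0_norm ?normc_ge0// normc_drift_le.
  + exact: (drift_lty w0 e01 m0 mz ml).
Qed.

End component.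

Lemma form_bound f g t :
  (forall k k', perm_eq k k' -> f k = f k') -> (forall k k', perm_eq k k' -> g k = g k') ->
  (forall k, 0 \in k -> f k = 0) -> 0 < t ->
  (\esum_(k in [set: seq Z2]) (energy_term (mean_sqr f g t) k)%:E < +oo)%E ->
  normc (op_form w eps f g) <= 2 * ((16 * 30 + 2 * pair_const w) * w2 w * lambda eps ^+ 2 *
    fine (\esum_(k in [set: seq Z2]) (energy_term (mean_sqr f g t) k)%:E)%E).
Proof.
move=> fp gp fz t0 moo; rewrite mulr_natl mulr2n; apply: (le_trans (normc_le_ReIm _)).
apply: lerD.
- have ReD (x y : R[i]) : complex.Re (x + y) = complex.Re x + complex.Re y by case: x; case: y.
  have ReZ (a : R) (x : R[i]) : complex.Re (a%:C%C * x) = a * complex.Re x.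
    by case: x => b c /=; rewrite mul0r subr0.
  exact: (component_bound fp gp fz t0 moo ReD ReZ (@Re_le_normc R)).
- have ImD (x y : R[i]) : complex.Im (x + y) = complex.Im x + complex.Im y by case: x; case: y.
  have ImZ (a : R) (x : R[i]) : complex.Im (a%:C%C * x) = a * complex.Im x.
    by case: x => b c /=; rewrite mul0r addr0.
  exact: (component_bound fp gp fz t0 moo ImD ImZ (@Im_le_normc R)).
Qed.

(** The constants do not contribute: [L0w] vanishes on the empty sequence, and a merged frequency is
    never empty. *)
Lemma form_eq0 f g : (forall k k', k != [::] -> k' != [::] -> f k * conjc (g k') = 0) ->
  op_form w eps f g = 0.
Proof.
move=> fg0; have conjM (x y : R[i]) : conjc (x * y) = conjc x * conjc y by rewrite rmorphM.
have c0 (T : choiceType) (a : T -> R[i]) : (forall k, a k = 0) -> csum a = 0.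
  move=> a0; have r0 (b : T -> R) : (forall k, b k = 0) -> rsum b = 0.
    by move=> b0; rewrite /rsum !esum1 ?subrr// => k _; rewrite b0 ?oppr0 maxxx.
  by rewrite /csum !r0// => k; rewrite a0.
rewrite /op_form /pairing c0 ?c0 ?addr0// => k.
- rewrite /pairing_term /multiplier; have [->|kn] := eqVneq k [::].
    by rewrite /L0w big_nil mulr0 mul0r mul0r mulr0 mul0r.
  by rewrite mulrA -mulrA fg0// mulr0.
- rewrite pairing_AplusE big1 ?mulr0// => e _; rewrite big1// => e' _.
  by rewrite /merged conjM mulrACA fg0 ?mulr0.
Qed.

End form_terms.

Lemma fhat_zero (R : realType) (psi : forall n, n.-tuple (plane R) -> R[i]) (k : seq Z2) :
  GammaL2 psi -> 0 \in k -> fhat psi k = 0.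
Proof. by move=> [chaos_psi _] k0; have [_ _ _ _ psi0] := chaos_psi (size k); exact: psi0. Qed.

(** * The energy norm and the conclusion *)

Section energy.
Variables (R : realType) (f : seq Z2 -> R[i]).

Definition sqr_energy : \bar R :=
  (\esum_(k in [set: seq Z2]) (energy_term (fun k => normc (f k) ^+ 2) k)%:E)%E.

Lemma energyE : energy f = sqrte sqr_energy.
Proof.
rewrite /energy /fock_norm; congr (sqrte _); apply: eq_esum => k _.
rewrite /multiplier Normc.normcM normc_real exprMn real_normK ?num_real//.
rewrite /number exprMn sqr_sqrtr ?L0_ge0//.
Qed.

Lemma sqr_energy_ge0 : (0 <= sqr_energy)%E.
Proof. by apply: esum_EFin_ge0 => k; apply: energy_term_ge0 => l; exact: sqr_ge0. Qed.

Lemma sqr_energy_eq0 : (forall k, 0 \in k -> f k = 0) -> sqr_energy = 0%E ->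
  forall k, k != [::] -> f k = 0.
Proof.
move=> fz e0 k kn; have [k0|k0] := boolP (0 \in k); first exact: fz.
have t0 l : 0 <= energy_term (fun k => normc (f k) ^+ 2) l.
  by apply: energy_term_ge0 => m; exact: sqr_ge0.
have : energy_term (fun k => normc (f k) ^+ 2) k = 0.
  apply/eqP; rewrite eq_le t0 andbT -lee_fin -[leRHS]e0.
  apply: esum_ge; exists [set k]%classic; last by rewrite fsbig_set1.
  by split => //; exact: finite_set1.
have L0p : - L0 R k != 0.
  case: k kn k0 => [//|l k _]; rewrite in_cons eq_sym negb_or => /andP[l0 _].
  rewrite L0E big_cons gt_eqF// mulr_gt0 ?invr_gt0//.
  apply: (@lt_le_trans _ _ 1) => //; apply: (le_trans (norm2_ge1 R l0)); rewrite lerDl.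
  by apply: sumr_ge0 => m _; exact: norm2_ge0.
have n0 : (size k)`!%:R != 0 :> R by rewrite pnatr_eq0 gtn_eqF ?fact_gt0.
have s0 : (size k)%:R != 0 :> R by rewrite pnatr_eq0 size_eq0.
rewrite /energy_term; move: (- L0 R k) (_%:R : R) ((size k)`!%:R) L0p s0 n0 => x y z x0 y0 z0.
move/eqP; rewrite !mulf_eq0 (negbTE x0) (negbTE y0) (negbTE z0) /= orbb => /eqP.
exact: Normc.eq0_normc.
Qed.

End energy.

Lemma energy_mean_sqr (R : realType) (f g : seq Z2 -> R[i]) (t : R) : 0 < t ->
  (\esum_(k in [set: seq Z2]) (energy_term (mean_sqr f g t) k)%:E =
   t%:E * sqr_energy f + t^-1%:E * sqr_energy g)%E.
Proof.
move=> t0; have tV0 : 0 < t^-1 by rewrite invr_gt0.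
have e0 (u : seq Z2 -> R[i]) l : 0 <= energy_term (fun k => normc (u k) ^+ 2) l.
  by apply: energy_term_ge0 => m; exact: sqr_ge0.
rewrite -!esum_EFinZl// ?ltW// -esum_EFinD.
- by apply: eq_esum => k _; congr (_%:E); rewrite /energy_term /mean_sqr; ring.
- by move=> k; rewrite mulr_ge0// ltW.
- by move=> k; rewrite mulr_ge0// ltW.
Qed.

Theorem lemma5p2 (R : realType) (w : R * R) (hw : w != 0) :
  exists C : R, 0 < C /\
    forall (eps : R) (psi1 psi2 : forall n, n.-tuple (plane R) -> R[i]),
      0 < eps < 1 -> GammaL2 psi1 -> GammaL2 psi2 ->
      ((energy (fhat psi1) < +oo)%E -> (energy (fhat psi2) < +oo)%E ->
        op_form_defined w eps (fhat psi1) (fhat psi2)) /\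
      ((Normc.normc (op_form w eps (fhat psi1) (fhat psi2)))%:E <=
        (C * lambda eps ^+ 2)%:E * energy (fhat psi1) * energy (fhat psi2))%E.
Proof.
have w0 : 0 < w2 w.
  rewrite lt_neqAle addr_ge0 ?sqr_ge0// andbT eq_sym paddr_eq0 ?sqr_ge0// !sqrf_eq0.
  by apply: contra hw => /andP[/eqP w1 /eqP w2]; apply/eqP; case: w w1 w2 => a b /= -> ->.
pose K : R := (16 * 30 + 2 * pair_const w) * w2 w.
have c_ge0 := pair_const_ge0 w0.
have K0 : 0 < K by apply: mulr_gt0 w0; lra.
(* One factor [2] is for the real and imaginary parts, the other comes from
   [t * x ^+ 2 + y ^+ 2 / t = 2 * x * y]. *)
exists (4 * K); split; first by apply: mulr_gt0 K0.
move=> eps psi1 psi2 e01 G1 G2; set f := fhat psi1; set g := fhat psi2.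
have fp k k' : perm_eq k k' -> f k = f k' by exact: fhat_perm.
have gp k k' : perm_eq k k' -> g k = g k' by exact: fhat_perm.
have fz k : 0 \in k -> f k = 0 by exact: fhat_zero.
have gz k : 0 \in k -> g k = 0 by exact: fhat_zero.
have l0 := lambda2_gt0 e01.
have lty (x : \bar R) : (sqrte x < +oo)%E -> (0 <= x)%E -> (x < +oo)%E.
  by case: x => // r _ _; exact: ltry.
have Ef0 := sqr_energy_ge0 f; have Eg0 := sqr_energy_ge0 g.
rewrite !energyE; split.
  move=> /lty/(_ Ef0) fo /lty/(_ Eg0) go.
  (* Only finiteness is at stake, so [t = 1] will do. *)
  apply: (@form_defined _ w eps w0 e01 f g 1) => //.
  have := energy_mean_sqr f g ltr01; rewrite invr1 !mul1e => ->.
  exact: (lte_add_pinfty fo go).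
have c0 : 0 < 4 * K * lambda eps ^+ 2 by apply: mulr_gt0 l0; apply: mulr_gt0 K0.
have s0 := sqrte_ge0.
have trivial_form : op_form w eps f g = 0 -> ((normc (op_form w eps f g))%:E <=
    (4 * K * lambda eps ^+ 2)%:E * sqrte (sqr_energy f) * sqrte (sqr_energy g))%E.
  by move=> ->; rewrite Normc.normc0 !mule_ge0// lee_fin ltW.
(* A zero energy makes the right-hand side [0] even if the other energy is [+oo], so the form itself
   has to vanish. Once both are nonzero, an infinite one makes the bound trivial. *)
have [Ef|Ef] := eqVneq (sqr_energy f) 0%E.
  apply: trivial_form; apply: form_eq0 => k k' kn _.
  by rewrite (sqr_energy_eq0 fz Ef)// mul0r.
have [Eg|Eg] := eqVneq (sqr_energy g) 0%E.
  apply: trivial_form; apply: form_eq0 => k k' _ kn'.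
  by rewrite (sqr_energy_eq0 gz Eg)// conjc0 mulr0.
have gtE (x : \bar R) : (0 <= x)%E -> x != 0%E -> (0 < sqrte x)%E.
  case: x => //= r; rewrite lee_fin lte_fin sqrtr_gt0 lt0r => r0 rn.
  by rewrite r0 andbT; apply: contra rn => /eqP ->.
have sf := gtE _ Ef0 Ef; have sg := gtE _ Eg0 Eg.
have [fo|] := ltP (sqr_energy f) +oo%E; last first.
  rewrite leye_eq => /eqP ->; rewrite gt0_muley ?lte_fin//.
  by rewrite gt0_mulye ?leey.
have [go|] := ltP (sqr_energy g) +oo%E; last first.
  rewrite leye_eq => /eqP ->; rewrite gt0_muley; first exact: leey.
  by apply: mule_gt0; [rewrite lte_fin|exact: sf].
have [a ea] : exists a : R, sqr_energy f = a%:E.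
  exists (fine (sqr_energy f)); apply: esym; apply: fineK.
  by rewrite (ge0_fin_numE Ef0); exact: fo.
have [b eb] : exists b : R, sqr_energy g = b%:E.
  exists (fine (sqr_energy g)); apply: esym; apply: fineK.
  by rewrite (ge0_fin_numE Eg0); exact: go.
move: sf sg; rewrite ea eb /= !lte_fin => sa sb.
have aE : a = Num.sqrt a ^+ 2 by rewrite sqr_sqrtr// ltW// -sqrtr_gt0.
have bE : b = Num.sqrt b ^+ 2 by rewrite sqr_sqrtr// ltW// -sqrtr_gt0.
set x := Num.sqrt a in sa aE *; set y := Num.sqrt b in sb bE *.
(* [t = y / x] turns [t x^2 + y^2 / t] into [2 x y]. *)
have t0 : 0 < y / x by exact: divr_gt0.
have mE := energy_mean_sqr f g t0; rewrite ea eb -!EFinM -EFinD in mE.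
have := form_bound w0 e01 fp gp fz t0; rewrite mE => /(_ (ltry _)) /= h.
rewrite -!EFinM lee_fin; apply: (le_trans h).
rewrite aE bE -/K le_eqVlt; apply/orP; left; apply/eqP; field.
by rewrite !gt_eqF.
Qed.
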